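(* For every $\eta>0$, every $\delta>0$ and every $\rho\in(0,\tfrac12)$, there exists $n_{\eta,\delta,\rho}\in\mathbb{N}$ such that, for every integer $n\geq n_{\eta,\delta,\rho}$, the region $$\left\{(a,b)\in\mathbb{R}_+^2:\ ab\leq n^{-\frac23-\eta}\right\}\ \cup\ \left\{(a,b)\in\mathbb{R}_+^2:\ ab\leq\tfrac12-\rho,\quad \min\{a,b\}\leq n^{-\frac12-\delta}\right\}$$ is contained in the frame set $\mathcal{F}(h_n)$ of the $n$-th Hermite function $h_n$.
   Context: Here $\mathbb{N}$ is the set of positive integers, and $\mathbb{R}_+^2=\{(a,b): a>0,\ b>0\}$. Hermite functions: for $n\in\mathbb{N}_0=\mathbb{N}\cup\{0\}$, the $n$-th Hermite function is $$h_n(t)=c_n(-1)^n e^{\pi t^2}\frac{d^n}{dt^n}e^{-2\pi t^2},\qquad t\in\mathbb{R},$$ where the constant $c_n>0$ is chosen so that $\|h_n\|_2=1$ in $L^2(\mathbb{R})$. Gabor systems and frame set: for $g\in L^2(\mathbb{R})$ and $a,b>0$, the Gabor system is $\mathcal{G}(g,a,b)=\{g_{k,l}: k,l\in\mathbb{Z}\}$ with $g_{k,l}(t)=e^{2\pi i b l t}g(t-ak)$. It is a frame for $L^2(\mathbb{R})$ if there exist constants $A,B>0$ such that for all $f\in L^2(\mathbb{R})$ $$A\|f\|_2^2\leq\sum_{(k,l)\in\mathbb{Z}^2}|\langle f,g_{k,l}\rangle|^2\leq B\|f\|_2^2 .$$ The frame set of $g$ is $\mathcal{F}(g)=\{(a,b)\in\mathbb{R}_+^2: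 \mathcal{G}(g,a,b)\text{ is a frame for }L^2(\mathbb{R})\}$. *)

(* Defs.v *)
From HB Require Import structures.
From mathcomp Require Import all_boot all_order all_algebra.
From mathcomp Require Import complex.
From mathcomp Require Import all_classical all_reals all_analysis.

Set Implicit Arguments.
Unset Strict Implicit.
Unset Printing Implicit Defensive.

Import Order.TTheory GRing.Theory Num.Theory.
Import numFieldNormedType.Exports.

Local Open Scope classical_set_scope.
Local Open Scope ring_scope.
Local Open Scope complex_scope.

Section Gabor.
Context {R : realType}.
Implicit Types (f g : R -> R[i]) (a b t : R).

Notation mu := (@lebesgue_measure R).

Definition cabs (z : R[i]) : R := ComplexField.Normc.normc z.

(* Extended-real valued: +oo when a measurable f is not square integrable. *)
Definition L2norm f : \bar R := 'N[mu]_2%:E[EFin \o (cabs \o f)].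

(* R[i] carries no sigma-algebra in the library, so measurability is stated
   on the real and imaginary parts. Membership concerns functions rather than
   classes modulo a.e. equality; L2norm and inner do not see the difference. *)
Definition L2 : set (R -> R[i]) :=
  [set f | [/\ measurable_fun setT (fun t => complex.Re (f t)),
               measurable_fun setT (fun t => complex.Im (f t)) &
               (L2norm f < +oo)%E]].

Definition cintegral f : R[i] :=
  (\int[mu]_t complex.Re (f t))%R +i* (\int[mu]_t complex.Im (f t))%R.

Definition inner f g : R[i] := cintegral (fun t => f t * conjc (g t)).

Definition cis (x : R) : R[i] := cos x +i* sin x.

Definition gabor_atom g a b (k l : int) : R -> R[i] :=
  fun t => cis (2 * pi * b * l%:~R * t) * g (t - a * k%:~R).

Definition gabor_frame g a b : Prop :=
  exists A B : R, [/\ 0 < A, 0 < B &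
    forall f, L2 f ->
      (A%:E * L2norm f ^+ 2
         <= \esum_(kl in [set: int * int])
              (cabs (inner f (gabor_atom g a b kl.1 kl.2)) ^+ 2)%:E
         <= B%:E * L2norm f ^+ 2)%E].

Definition frame_set g : set (R * R) :=
  [set ab | [/\ 0 < ab.1, 0 < ab.2 & gabor_frame g ab.1 ab.2]].

Definition hermite_raw (n : nat) : R -> R := fun t =>
  (-1) ^+ n * expR (pi * t ^+ 2) * derive1n n (fun s => expR (- (2 * pi * s ^+ 2))) t.

(* The constant c_n > 0 making the L^2 norm equal to 1; the default value 0
   would only be returned if there were no such constant. *)
Definition hermite_cst (n : nat) : R :=
  xget 0 [set c | 0 < c /\ L2norm (fun t => (c * hermite_raw n t)%:C) = 1%E].

Definition hermite (n : nat) : R -> R[i] :=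
  fun t => (hermite_cst n * hermite_raw n t)%:C.

End Gabor.

(* Main.v *)
(** A window criterion: suppose [a <= 1/b] and on some interval [[X, X + a]] the window [g]
    is bounded away from zero and [|g (x + m/b)| <= eps_m |g x|] with the sum of the [eps_m],
    [m <> 0], at most 1/2. Translates of that interval tile the line, and Parseval on a
    period of length [1/b], applied to the periodization of [f (t) g (t - a k)], gives the
    lower frame inequality; the upper one follows from Gaussian decay. Since [h_n] is an
    eigenfunction of the Fourier transform, [(a, b)] and [(b, a)] are interchangeable, so
    one may take [b <= a].

    After rescaling by [sqrt (2 pi)], [h_n] solves [u'' = (y^2 - T^2) u] with
    [T^2 = 2n + 1 = c^6]. Beyond the turning point [T] it decays at least like
    [exp (- (y - T)^2 / 2)]; inside, an energy argument gives [u^2 <= C c u(T)^2 / s] with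
    [s = sqrt (T^2 - y^2)]. If [1/b] dominates [T], the window starting at [T] has all its
    aliases beyond the turning points. If only [1/b >> c^2] and [a << 1/c], the aliases
    inside the oscillatory zone add up to [O (b c^2)]; the single alias that may come close
    to [-T] is avoided by moving the window a large multiple of [1/c] inside, to a place
    where an energy lower bound shows that [u] is not small. *)

From HB Require Import structures.
Require Import Defs.
From mathcomp Require Import all_boot all_order all_algebra.
From mathcomp Require Import complex ring lra.
From mathcomp Require Import all_classical all_reals all_analysis.
From mathcomp Require Import measurable_realfun zify.

Set Implicit Arguments.
Unset Strict Implicit.
Unset Printing Implicit Defensive.

Import Order.TTheory GRing.Theory Num.Theory.
Import numFieldNormedType.Exports.

Local Open Scope classical_set_scope.
Local Open Scope ring_scope.

(** * Derivatives of explicit functions *)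

Section DeriveFun.
Context {R : realType}.
Implicit Types (f g : R -> R) (x a b c : R).

(** The scales come from the turning point. With T = c^3 the equation near T is Airy's at length
    1/c: over a fraction of 1/c beyond T, [u] keeps half of u(T), and deeper inside [u^2] falls like
    c u(T)^2 / s. The obstacle is that |u| is just as large near -T. A window at T may be spoilt by
    the one alias falling within O(1/c) of -T; moving the window inwards pushes that alias outwards
    by the same amount, into exponential decay, while [u] on the window loses only a constant
    factor. The exponent 2/3 is read off the alias sum: relative amplitudes sqrt (c / s) at spacing
    D = sqrt (2 pi) / b add up to about c^2 / D, and c^2 is of order n^(1/3), so b << n^(-1/3) is
    wanted; for b <= a this follows from ab << n^(-2/3). The demand a << 1/c is no extra
    restriction: when it fails, b << n^(-1/2) and all aliases are beyond the turning points. The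
    analysis is kept real: cosine and sine coefficients are summed over symmetric boxes, where odd
    cross terms cancel, and frame sums are handled through finite boxes only. *)

Lemma df_eq x f a b : is_derive x 1 f a -> a = b -> is_derive x 1 f b.
Proof. by move=> ? <-. Qed.
Lemma dfC x c : is_derive x 1 (fun _ : R => c) 0.
Proof. exact: is_derive_cst. Qed.
Lemma dfI x : is_derive x 1 (fun y : R => y) 1.
Proof. exact: is_derive_id. Qed.
Lemma dfD x f g a b : is_derive x 1 f a -> is_derive x 1 g b ->
  is_derive x 1 (fun y => f y + g y) (a + b).
Proof. by move=> ? ?; exact: is_deriveD. Qed.
Lemma dfN x f a : is_derive x 1 f a -> is_derive x 1 (fun y => - f y) (- a).
Proof. by move=> ?; exact: is_deriveN. Qed.
Lemma dfM x f g a b : is_derive x 1 f a -> is_derive x 1 g b ->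
  is_derive x 1 (fun y => f y * g y) (a * g x + f x * b).
Proof.
move=> fa gb; apply: is_derive_eq (is_deriveM fa gb) _.
by rewrite /GRing.scale/= addrC [g x * a]mulrC.
Qed.
Lemma dfX x f a n : is_derive x 1 f a ->
  is_derive x 1 (fun y => f y ^+ n) (n%:R * f x ^+ n.-1 * a).
Proof.
move=> fa; have -> : (fun y => f y ^+ n) = f ^+ n.
  by apply/funext => y; rewrite exprfctE.
exact: is_deriveX.
Qed.
Lemma df_comp x f g a b : is_derive (g x) 1 f a -> is_derive x 1 g b ->
  is_derive x 1 (fun y => f (g y)) (a * b).
Proof. by move=> fa gb; apply: is_derive_eq (is_derive1_comp fa gb) _. Qed.
Lemma df_sin x f a : is_derive x 1 f a ->
  is_derive x 1 (fun y => sin (f y)) (cos (f x) * a).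
Proof. by move=> fa; apply: df_comp. Qed.
Lemma df_cos x f a : is_derive x 1 f a ->
  is_derive x 1 (fun y => cos (f y)) (- sin (f x) * a).
Proof. by move=> fa; apply: df_comp. Qed.
Lemma df_exp x f a : is_derive x 1 f a ->
  is_derive x 1 (fun y => expR (f y)) (expR (f x) * a).
Proof. by move=> fa; apply: df_comp. Qed.
Lemma df_inv x f a : f x != 0 -> is_derive x 1 f a ->
  is_derive x 1 (fun y => (f y)^-1) (- f x ^- 2 * a).
Proof. by move=> fx0 fa; apply: is_derive_eq (is_deriveV fx0 fa) _. Qed.
Lemma df_sqrt x f a : 0 < f x -> is_derive x 1 f a ->
  is_derive x 1 (fun y => Num.sqrt (f y)) ((2 * Num.sqrt (f x))^-1 * a).
Proof. by move=> fx0 fa; apply: df_comp => //; exact: is_derive1_sqrt. Qed.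

Lemma df_cont f g : (forall x, is_derive x 1 f (g x)) -> continuous f.
Proof.
by move=> df x; apply/differentiable_continuous/derivable1_diffP; have [] := df x.
Qed.

Lemma df_within f g a b : (forall x, a <= x <= b -> is_derive x 1 f (g x)) ->
  {within `[a, b], continuous f}.
Proof.
move=> df; apply: derivable_within_continuous => x; rewrite in_itv/= => xab.
by have [] := df _ xab.
Qed.

Lemma df_MVT f g a b : a <= b -> (forall x, a <= x <= b -> is_derive x 1 f (g x)) ->
  exists2 c, a <= c <= b & f b - f a = g c * (b - a).
Proof.
move=> ab df; have df' x : x \in `]a, b[ -> is_derive x 1 f (g x).
  by rewrite in_itv/= => /andP[ax xb]; apply: df; rewrite !ltW.
have [c cab e] := MVT_segment ab df' (df_within df).
by exists c => //; rewrite in_itv/= in cab.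
Qed.

Lemma df_le f g a b : a <= b -> (forall x, a <= x <= b -> is_derive x 1 f (g x)) ->
  (forall x, a <= x <= b -> g x <= 0) -> f b <= f a.
Proof.
move=> ab df g0; have [c cab e] := df_MVT ab df.
by rewrite -subr_le0 e mulr_le0_ge0 ?g0 ?subr_ge0.
Qed.

Lemma df_ge f g a b : a <= b -> (forall x, a <= x <= b -> is_derive x 1 f (g x)) ->
  (forall x, a <= x <= b -> 0 <= g x) -> f a <= f b.
Proof.
move=> ab df g0; have [c cab e] := df_MVT ab df.
by rewrite -subr_ge0 e mulr_ge0 ?g0 ?subr_ge0.
Qed.

End DeriveFun.

(** Structural differentiation. [notypeclasses refine] keeps instance search from solving the
    [is_derive] subgoals before the recursion reaches them. Side conditions of [Num.sqrt] and of the
    inverse come back as goals, ahead of the identity between derivatives that [deriv] leaves. *)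
Ltac der := lazymatch goal with
  | |- is_derive _ _ (fun _ => ?c) _ => notypeclasses refine (dfC _ _)
  | |- is_derive _ _ (fun y => y) _ => notypeclasses refine (dfI _)
  | |- is_derive _ _ (fun y => _ + _) _ => notypeclasses refine (dfD _ _); der
  | |- is_derive _ _ (fun y => - _) _ => notypeclasses refine (dfN _); der
  | |- is_derive _ _ (fun y => _ * _) _ => notypeclasses refine (dfM _ _); der
  | |- is_derive _ _ (fun y => _ ^+ _) _ => notypeclasses refine (dfX _ _); der
  | |- is_derive _ _ (fun y => sin _) _ => notypeclasses refine (df_sin _); der
  | |- is_derive _ _ (fun y => cos _) _ => notypeclasses refine (df_cos _); der
  | |- is_derive _ _ (fun y => expR _) _ => notypeclasses refine (df_exp _); der
  | |- is_derive _ _ (fun y => Num.sqrt _) _ => notypeclasses refine (df_sqrt _ _); [|der]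
  | |- is_derive _ _ (fun y => _^-1) _ => notypeclasses refine (df_inv _ _); [|der]
  (* The next clauses cover eta-contracted functions, such as [GRing.mul k] for [fun y => k * y]. *)
  | |- is_derive ?x ?v (GRing.mul ?k) ?d => notypeclasses refine (@dfM _ x (fun=> k) (fun y => y) _ _ _ _); der
  | |- is_derive ?x ?v (Algebra.add ?k) ?d => notypeclasses refine (@dfD _ x (fun=> k) (fun y => y) _ _ _ _); der
  | |- is_derive _ _ Algebra.opp _ => notypeclasses refine (dfN (dfI _))
  | |- is_derive _ _ sin _ => notypeclasses refine (is_derive_sin _)
  | |- is_derive _ _ cos _ => notypeclasses refine (is_derive_cos _)
  | |- is_derive _ _ expR _ => notypeclasses refine (is_derive_expR _)
  | |- is_derive _ _ atan _ => notypeclasses refine (is_derive1_atan _)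
  | |- _ => first [eassumption | match goal with
      H : forall x, is_derive _ _ _ _ |- _ => notypeclasses refine (H _) end]
  end.

Ltac deriv := notypeclasses refine (df_eq _ _); [der|rewrite /=].

(** * Integrable functions on the line *)

Section Integrals.
Context {R : realType}.
Implicit Types (f g : R -> R) (a b c h t x : R) (D : set (measurableTypeR R)).
Notation mu := (@lebesgue_measure R).

Definition itgb D f := mu.-integrable D (EFin \o f).

Lemma itgb_mfun D f : itgb D f -> measurable_fun D f.
Proof. by move=> /measurable_int /measurable_EFinP. Qed.

Lemma itgb_le D f g : measurable D -> measurable_fun D f ->
  (forall x, D x -> `|f x| <= g x) -> itgb D g -> itgb D f.
Proof.
move=> mD mf fg ig; apply: le_integrable (ig) => //.
  exact/measurable_EFinP.
by move=> x Dx /=; rewrite lee_fin (le_trans (fg _ Dx))// ler_norm.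
Qed.

Lemma itgbD D f g : measurable D -> itgb D f -> itgb D g ->
  itgb D (fun x => f x + g x).
Proof. by move=> mD fi gi; exact: (integrableD mD fi gi). Qed.

Lemma itgbB D f g : measurable D -> itgb D f -> itgb D g ->
  itgb D (fun x => f x - g x).
Proof. by move=> mD fi gi; exact: (integrableB mD fi gi). Qed.

Lemma itgbZ D k f : measurable D -> itgb D f -> itgb D (fun x => k * f x).
Proof. by move=> mD fi; exact: (integrableZl mD k fi). Qed.

Lemma itgbZr D k f : measurable D -> itgb D f -> itgb D (fun x => f x * k).
Proof. by move=> mD fi; under eq_fun do rewrite mulrC; exact: itgbZ. Qed.

Lemma itgb0 D : measurable D -> itgb D (fun=> 0).
Proof. by move=> mD; exact: integrable0. Qed.

Lemma itgb_sum D (I : Type) (s : seq I) (P : pred I) (F : I -> R -> R) :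
  measurable D -> (forall i, P i -> itgb D (F i)) ->
  itgb D (fun x => \sum_(i <- s | P i) F i x).
Proof.
move=> mD Fi; elim: s => [|i s IH].
  rewrite (_ : (fun _ => _) = fun=> 0); first exact: itgb0.
  by apply/funext => x; rewrite big_nil.
case: (boolP (P i)) => Pi; last first.
  rewrite (_ : (fun _ => _) = (fun x => \sum_(i <- s | P i) F i x)) //.
  by apply/funext => x; rewrite big_cons (negbTE Pi).
rewrite (_ : (fun _ => _) = (fun x => F i x + \sum_(i <- s | P i) F i x)).
  by apply: itgbD => //; exact: Fi.
by apply/funext => x; rewrite big_cons Pi.
Qed.

Lemma Rint_sum D (I : Type) (s : seq I) (P : pred I) (F : I -> R -> R) :
  measurable D -> (forall i, P i -> itgb D (F i)) ->
  \int[mu]_(x in D) (\sum_(i <- s | P i) F i x) =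
  \sum_(i <- s | P i) \int[mu]_(x in D) F i x.
Proof.
move=> mD Fi; elim: s => [|i s IH].
  rewrite big_nil (@eq_Rintegral _ _ _ _ _ (fun=> 0)).
    by rewrite Rintegral_cst// mul0r.
  by move=> x _ /=; rewrite big_nil.
rewrite big_cons; case: (boolP (P i)) => Pi; last first.
  by rewrite -IH; apply: eq_Rintegral => x _; rewrite big_cons (negbTE Pi).
rewrite -IH -RintegralD//; [|exact: Fi|exact: itgb_sum].
by apply: eq_Rintegral => x _; rewrite big_cons Pi.
Qed.

Lemma itgb_norm D f : itgb D f -> itgb D (fun x => `|f x|).
Proof. exact: integrable_norm. Qed.

Lemma itgb_sub D D' f : measurable D -> measurable D' -> D' `<=` D ->
  itgb D f -> itgb D' f.
Proof. by move=> mD mD' DD' fi; exact: integrableS fi. Qed.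

Lemma seg_bounded_itgb a b f M : measurable_fun `[a, b] f ->
  (forall x, a <= x <= b -> `|f x| <= M) -> itgb `[a, b] f.
Proof.
move=> mf fM; apply: measurable_bounded_integrable => //.
  exact/compact_finite_measure/segment_compact.
exists M; split; first exact: num_real.
by move=> y My x /=; rewrite in_itv/= => /fM/le_trans; apply; exact: ltW.
Qed.

Lemma cont_itgb a b f : continuous f -> itgb `[a, b] f.
Proof.
move=> cf; apply: continuous_compact_integrable; first exact: segment_compact.
exact: continuous_subspaceT.
Qed.

Let shift h : measurableTypeR R -> measurableTypeR R := fun x => x + h.

Let mshift h : measurable_fun setT (shift h).
Proof. exact: measurable_funD. Qed.

(** Both sides are measures in [A], so by uniqueness of the Lebesgue measure it is enough that they
    agree on half-open intervals. *)
Lemma pushforward_shift h (A : set (measurableTypeR R)) : measurable A ->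
  pushforward mu (shift h) A = mu A.
Proof.
move=> mA.
pose S : {mfun measurableTypeR R >-> measurableTypeR R} := HB.pack (shift h)
  (isMeasurableFun.Build _ _ _ _ _ (mshift h)).
apply/esym; apply: (lebesgue_measure_unique (mu := pushforward mu S)) => //.
move=> X [[u v] /= uv <-]; rewrite /pushforward.
rewrite (_ : S @^-1` _ = `]u - h, v - h]%classic); last first.
  by apply/seteqP; split=> x; rewrite /S /shift /= !in_itv/= ltrBlDr lerBrDr.
rewrite !lebesgue_measure_itv/= !lte_fin ltrD2r; case: ifP => // _.
by rewrite -!EFinB; congr EFin; lra.
Qed.

Lemma ge0_integral_shift h (f : measurableTypeR R -> \bar R) :
  measurable_fun setT f -> (forall x, (0 <= f x)%E) ->
  (\int[mu]_x f (x + h)%R = \int[mu]_x f x)%E.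
Proof.
move=> mf f0.
rewrite -[LHS](ge0_integral_pushforward (mshift h) mu (D := setT))//.
by apply: eq_measure_integral => A mA _; exact: pushforward_shift.
Qed.

Lemma itgb_shift h f : itgb setT f -> itgb setT (fun x => f (x + h)).
Proof.
move=> fi; have mf := itgb_mfun fi.
apply/integrableP; split.
  by apply/measurable_EFinP; apply: measurableT_comp mf _; exact: mshift.
move/integrableP : fi => [_].
rewrite -(@ge0_integral_shift h)//.
by apply: measurableT_comp => //; exact/measurable_EFinP.
Qed.

Lemma Rint_shift h f : itgb setT f ->
  \int[mu]_x f (x + h) = \int[mu]_x f x.
Proof.
move=> fi; congr fine.
rewrite -[LHS](integral_pushforward (mshift h) (mu := mu) (D := setT) (f := EFin \o f))//.
- by apply: eq_measure_integral => A mA _; exact: pushforward_shift.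
- by apply/measurable_EFinP; exact: itgb_mfun fi.
- by rewrite preimage_setT; exact: itgb_shift.
Qed.

End Integrals.

(** * Fourier coefficients on a period *)

Section BoxSums.
Context {R : realType}.
Implicit Types (F G : int -> R) (N : nat).

(** The index runs over the integers from [-N] to [N]. The symmetric range makes odd cross terms
    vanish, which lets real cosine and sine coefficients stand for complex exponentials. *)
Definition bsum N F : R := \sum_(i < N.*2.+1) F (i%:Z - N%:Z).

Lemma bsum_split N F :
  bsum N F = \sum_(i < N) F (i%:Z - N%:Z) + \sum_(i < N.+1) F i%:Z.
Proof.
rewrite /bsum -addnn -addnS big_split_ord/=; congr (_ + _).
by apply: eq_bigr => i _; rewrite PoszD addrAC subrr add0r.
Qed.

Lemma bsum_opp N F : bsum N F = bsum N (fun l => F (- l)).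
Proof.
rewrite /bsum (reindex_inj rev_ord_inj)/=; apply: eq_bigr => i _; congr (F _).
rewrite subSS -subzn; last by rewrite -ltnS.
by case: i => i /= ilt; lia.
Qed.

Lemma bsumD N F G : bsum N (fun l => F l + G l) = bsum N F + bsum N G.
Proof. by rewrite /bsum big_split. Qed.

Lemma bsumZ N c F : bsum N (fun l => c * F l) = c * bsum N F.
Proof. by rewrite /bsum mulr_sumr. Qed.

Lemma eq_bsum N F G : F =1 G -> bsum N F = bsum N G.
Proof. by move=> FG; apply: eq_bigr => i _. Qed.

Lemma le_bsum N F G : (forall l, F l <= G l) -> bsum N F <= bsum N G.
Proof. by move=> FG; apply: ler_sum => i _. Qed.

Lemma bsum_ge0 N F : (forall l, 0 <= F l) -> 0 <= bsum N F.
Proof. by move=> F0; apply: sumr_ge0 => i _. Qed.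

Lemma bsum_odd N F : (forall l, F (- l) = - F l) -> bsum N F = 0.
Proof.
move=> oF; have := bsum_opp N F; rewrite (eq_bsum _ oF) {2}/bsum sumrN -/(bsum N F).
by move=> h; lra.
Qed.

Lemma bsum_ge_nat N F : (forall l, 0 <= F l) -> \sum_(i < N) F i%:Z <= bsum N F.
Proof.
move=> F0; rewrite bsum_split (big_ord_recr N)/=.
have : 0 <= \sum_(i < N) F (i%:Z - N%:Z) by apply: sumr_ge0 => i _.
by have := F0 N%:Z => *; lra.
Qed.

Lemma bsumS N F : bsum N.+1 F = bsum N F + F N.+1%:Z + F (- N.+1%:Z).
Proof.
rewrite !bsum_split (big_ord_recr N.+1)/= (big_ord_recl N)/=.
rewrite (eq_bigr (fun i : 'I_N => F (i%:Z - N%:Z))); last first.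
  by move=> i _; congr (F _); rewrite /bump /= ; lia.
by rewrite sub0r; ring.
Qed.

End BoxSums.

Section Fourier.
Context {R : realType}.
Implicit Types (F G : R -> R) (a b t x K M : R).
Notation mu := (@lebesgue_measure R).

Lemma Rint_FTC a b F f : a < b -> (forall x, is_derive x 1 F (f x)) ->
  continuous f -> \int[mu]_(x in `[a, b]) f x = F b - F a.
Proof.
move=> ab dF cf; rewrite /Rintegral (@continuous_FTC2 _ f F a b)//.
- exact: continuous_subspaceT.
- have cF : continuous F.
    by move=> x; apply/differentiable_continuous/derivable1_diffP; have [] := dF x.
  split.
  + by move=> x _; have [] := dF x.
  + exact/cvg_at_right_filter/cF.
  + exact/cvg_at_left_filter/cF.
- by move=> x _; rewrite derive1E; exact: derive_val.
Qed.

Lemma Rint1_seg a b : a < b -> \int[mu]_(x in `[a, b]) 1 = b - a.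
Proof.
move=> ab; apply: (@Rint_FTC _ _ id (fun=> 1)) => // x.
exact: cvg_cst.
Qed.

Lemma cosz x (l : int) : cos (x + 2 * pi * l%:~R) = cos x.
Proof.
have H n y : cos (y + 2 * pi * n%:R) = cos y :> R.
  have -> : 2 * pi * n%:R = (pi *+ 2) *+ n :> R.
    by rewrite -[RHS]mulr_natr -[X in _ = X * _]mulr_natl.
  by rewrite periodicn//; exact: cosD2pi.
case: l => n; first by rewrite -pmulrn.
rewrite NegzE mulrNz mulrN -pmulrn.
by have := H n.+1 (x - 2 * pi * n.+1%:R); rewrite subrK => ->.
Qed.

Lemma sinz x (l : int) : sin (x + 2 * pi * l%:~R) = sin x.
Proof. by rewrite -cosBpihalf addrAC cosz cosBpihalf. Qed.

Variables (t0 P : R).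
Hypothesis P0 : 0 < P.
Let D : set (measurableTypeR R) := `[t0, t0 + P]%classic.
Let w := 2 * pi / P.

Lemma Rint_cos_period (l : int) al : l != 0 ->
  \int[mu]_(x in D) cos (w * l%:~R * x + al) = 0.
Proof.
move=> l0; have wl0 : w * l%:~R != 0.
  by rewrite mulf_neq0 ?intr_eq0// /w mulf_neq0 ?invr_eq0 ?gt_eqF// mulr_gt0 ?pi_gt0.
have dF x : is_derive x 1 (fun x => (w * l%:~R)^-1 * sin (w * l%:~R * x + al))
    (cos (w * l%:~R * x + al)).
  by deriv; rewrite !mul0r !add0r mulr1 addr0 mulrCA mulVf// mulr1.
have cc : continuous (fun x => cos (w * l%:~R * x + al)).
  apply: (@df_cont _ _ (fun x => - sin (w * l%:~R * x + al) * (w * l%:~R))) => x.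
  by deriv; ring.
rewrite (Rint_FTC _ dF cc) ?ltrDl// mulrDr.
have -> : w * l%:~R * P = 2 * pi * l%:~R by rewrite /w; field; rewrite gt_eqF.
by rewrite addrAC sinz subrr.
Qed.

Let mD : measurable D. Proof. exact: measurable_itv. Qed.

(** The Hartley kernel: one real orthogonal family indexed by all integers, with equal norms, where
    cosines and sines would need two families and a separate treatment of frequency 0. *)
Definition wave l x : R := cos (w * l%:~R * x) + sin (w * l%:~R * x).

Lemma wave_cont l : continuous (wave l).
Proof.
apply: (@df_cont _ _ (fun x => (- sin (w * l%:~R * x) + cos (w * l%:~R * x)) * (w * l%:~R))) => x.
by rewrite /wave; deriv; ring.
Qed.

Lemma cosw_cont (l : int) al : continuous (fun x => cos (w * l%:~R * x + al)).
Proof.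
apply: (@df_cont _ _ (fun x => - sin (w * l%:~R * x + al) * (w * l%:~R))) => x.
by deriv; ring.
Qed.

Lemma wave_ortho (l j : int) :
  \int[mu]_(x in D) (wave l x * wave j x) = P * (l == j)%:R.
Proof.
(* The second term is the sine of the sum frequency, written as a shifted cosine so that
   [Rint_cos_period] serves both terms; for [l + j = 0] it vanishes identically. *)
have wE x : wave l x * wave j x = cos (w * (l - j)%:~R * x + 0) +
    cos (w * (l + j)%:~R * x + - (pi / 2)).
  rewrite cosBpihalf addr0 /wave !rmorphD/= rmorphN/=.
  have -> : w * (l%:~R - j%:~R) * x = w * l%:~R * x - w * j%:~R * x by ring.
  have -> : w * (l%:~R + j%:~R) * x = w * l%:~R * x + w * j%:~R * x by ring.
  by rewrite cosB sinD; ring.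
under eq_Rintegral do rewrite wE.
rewrite RintegralD//; [|exact/cont_itgb/cosw_cont..].
have -> : \int[mu]_(x in D) cos (w * (l + j)%:~R * x - pi / 2) = 0.
  have [lj|lj] := eqVneq (l + j) 0; last by rewrite Rint_cos_period.
  under eq_Rintegral do rewrite lj mulr0 mul0r add0r cosN cos_pihalf.
  by rewrite Rintegral_cst// mul0r.
rewrite addr0; have [->|lj] := eqVneq l j; last first.
  by rewrite Rint_cos_period ?mulr0// subr_eq0.
under eq_Rintegral do rewrite subrr mulr0 mul0r add0r cos0.
by rewrite Rint1_seg ?ltrDl// mulr1 addrAC subrr add0r.
Qed.

Lemma l2_mul_itgb F G M : measurable_fun D F -> itgb D (fun x => F x ^+ 2) ->
  measurable_fun D G -> (forall x, D x -> `|G x| <= M) ->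
  itgb D (fun x => F x * G x).
Proof.
move=> mF iF2 mG GM.
apply: (@itgb_le _ _ _ (fun x => F x ^+ 2 + M ^+ 2)) => //.
- exact: measurable_funM.
- move=> x Dx; rewrite normrM; have := GM x Dx; have := normr_ge0 (G x).
  have := normr_ge0 (F x); rewrite -(real_normK (num_real (F x))).
  set a := `|F x|; set b := `|G x| => a0 b0 bM.
  have : a * b <= a * M by rewrite ler_wpM2l.
  by nra.
- by apply: itgbD => //; apply: cont_itgb => y; exact: cvg_cst.
Qed.

(** Both claims come from expanding squares against the orthogonality relations; the first one uses
    that the squared remainder of the projection has a nonnegative integral. *)
Lemma bessel_core n (phi : 'I_n -> R -> R) M F : measurable_fun D F ->
  itgb D (fun x => F x ^+ 2) ->
  (forall i, continuous (phi i)) -> (forall i x, `|phi i x| <= M) ->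
  (forall i j, \int[mu]_(x in D) (phi i x * phi j x) = P * (i == j)%:R) ->
  let h i := \int[mu]_(x in D) (F x * phi i x) in
  \sum_i h i ^+ 2 <= P * \int[mu]_(x in D) F x ^+ 2 /\
  \int[mu]_(x in D) (\sum_i h i / P * phi i x) ^+ 2 = P^-1 * \sum_i h i ^+ 2.
Proof.
move=> mF iF2 cphi phiM ortho h.
have iFphi i : itgb D (fun x => F x * phi i x).
  apply: (@l2_mul_itgb _ _ M) => //.
  by apply: measurable_funTS; exact: continuous_measurable_fun.
have iphi i j : itgb D (fun x => phi i x * phi j x).
  by apply: cont_itgb => x; apply: cvgM; exact: cphi.
have iFS : itgb D (fun x => \sum_i h i / P * (F x * phi i x)).
  by apply: itgb_sum => // i _; exact: itgbZ.
have iphi2 i : itgb D (fun x => \sum_j (h i / P * (h j / P)) * (phi i x * phi j x)).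
  by apply: itgb_sum => // j _; exact: itgbZ.
have iSS : itgb D (fun x => \sum_i \sum_j (h i / P * (h j / P)) * (phi i x * phi j x)).
  exact: itgb_sum.
have P0' : P != 0 by rewrite gt_eqF.
have S2E x : (\sum_i h i / P * phi i x) ^+ 2 =
    \sum_i \sum_j (h i / P * (h j / P)) * (phi i x * phi j x).
  rewrite expr2 big_distrl/=; apply: eq_bigr => i _; rewrite big_distrr/=.
  by apply: eq_bigr => j _; ring.
have intS2 : \int[mu]_(x in D) (\sum_i h i / P * phi i x) ^+ 2 =
    P^-1 * \sum_i h i ^+ 2.
  under eq_Rintegral do rewrite S2E.
  rewrite Rint_sum// mulr_sumr; apply: eq_bigr => i _.
  rewrite Rint_sum//; last by move=> j _; exact: itgbZ.
  rewrite (bigD1 i)//= big1 ?addr0; last first.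
    move=> j ji; rewrite RintegralZl//; last exact: iphi.
    by rewrite ortho eq_sym (negbTE ji) !mulr0.
  rewrite RintegralZl//; last exact: iphi.
  by rewrite ortho eqxx mulr1; field.
split=> //.
have : 0 <= \int[mu]_(x in D) ((F x - \sum_i h i / P * phi i x) ^+ 2).
  by apply: Rintegral_ge0 => x _; exact: sqr_ge0.
have E x : (F x - \sum_i h i / P * phi i x) ^+ 2 = F x ^+ 2 -
    (2 * (\sum_i h i / P * (F x * phi i x)) -
      \sum_i \sum_j (h i / P * (h j / P)) * (phi i x * phi j x)).
  rewrite -S2E (_ : \sum_i _ * (F x * _) = F x * \sum_i h i / P * phi i x); first by ring.
  by rewrite mulr_sumr; apply: eq_bigr => i _; ring.
under eq_Rintegral do rewrite E.
rewrite RintegralB//; last by apply: itgbB => //; exact: itgbZ.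
rewrite RintegralB//; last exact: itgbZ.
under [X in _ - (_ - X)]eq_Rintegral do rewrite -S2E.
rewrite intS2 RintegralZl// Rint_sum//; last by move=> i _; exact: itgbZ.
rewrite (eq_bigr (fun i => P^-1 * h i ^+ 2)); last first.
  move=> i _; rewrite RintegralZl//; last exact: iFphi.
  by rewrite -/(h i); field.
rewrite -mulr_sumr.
set A := \sum_i _; set B := (\int[mu]_(_ in _) _) => H.
have {}H : P^-1 * A <= B by lra.
by rewrite mulrC -ler_pdivrMr// mulrC.
Qed.

Definition Cf F (l : int) := \int[mu]_(x in D) (F x * cos (w * l%:~R * x)).
Definition Sf F (l : int) := \int[mu]_(x in D) (F x * sin (w * l%:~R * x)).
Definition psum F N t : R :=
  P^-1 * bsum N (fun l => Cf F l * cos (w * l%:~R * t) + Sf F l * sin (w * l%:~R * t)).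

Lemma sinw_cont (l : int) : continuous (fun x => sin (w * l%:~R * x)).
Proof.
apply: (@df_cont _ _ (fun x => cos (w * l%:~R * x) * (w * l%:~R))) => x.
by deriv; ring.
Qed.

Lemma cosw_cont0 (l : int) : continuous (fun x => cos (w * l%:~R * x)).
Proof.
apply: (@df_cont _ _ (fun x => - sin (w * l%:~R * x) * (w * l%:~R))) => x.
by deriv; ring.
Qed.

Lemma Fcos_itgb F l : measurable_fun D F -> itgb D (fun x => F x ^+ 2) ->
  itgb D (fun x => F x * cos (w * l%:~R * x)).
Proof.
move=> mF iF; apply: (@l2_mul_itgb _ _ 1) => //; last by move=> x _; exact: cos_max.
by apply: measurable_funTS; apply: continuous_measurable_fun; exact: cosw_cont0.
Qed.

Lemma Fsin_itgb F l : measurable_fun D F -> itgb D (fun x => F x ^+ 2) ->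
  itgb D (fun x => F x * sin (w * l%:~R * x)).
Proof.
move=> mF iF; apply: (@l2_mul_itgb _ _ 1) => //; last by move=> x _; exact: sin_max.
by apply: measurable_funTS; apply: continuous_measurable_fun; exact: sinw_cont.
Qed.

Lemma CfN F l : Cf F (- l) = Cf F l.
Proof. by apply: eq_Rintegral => x _; rewrite rmorphN/= mulrN mulNr cosN. Qed.

Lemma SfN F l : measurable_fun D F -> itgb D (fun x => F x ^+ 2) -> Sf F (- l) = - Sf F l.
Proof.
move=> mF iF; rewrite -[RHS]mulN1r /Sf -RintegralZl//; last exact: Fsin_itgb.
by apply: eq_Rintegral => x _; rewrite rmorphN/= mulrN mulNr sinN; ring.
Qed.

(** The coefficient of [F] on [wave l] is [Cf F l + Sf F l]. Since [Cf] is even and [Sf] odd in [l],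
    the cross terms [2 * Cf * Sf] cancel over the symmetric range; the same parity turns the wave
    expansion into [psum]. *)
Lemma bessel F N : measurable_fun D F -> itgb D (fun x => F x ^+ 2) ->
  bsum N (fun l => Cf F l ^+ 2 + Sf F l ^+ 2) <= P * \int[mu]_(x in D) F x ^+ 2 /\
  \int[mu]_(x in D) psum F N x ^+ 2 =
    P^-1 * bsum N (fun l => Cf F l ^+ 2 + Sf F l ^+ 2).
Proof.
move=> mF iF; pose phi (i : 'I_N.*2.+1) := wave (i%:Z - N%:Z).
have [|i x|i j|] := @bessel_core _ phi 2 F mF iF.
- by move=> i; exact: wave_cont.
- rewrite /phi /wave; apply: le_trans (ler_normD _ _) _.
  by rewrite -[2]/(1 + 1) lerD// ?cos_max ?sin_max.
- rewrite wave_ortho; congr (_ * (nat_of_bool _)%:R); apply/eqP/eqP => [|->//].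
  by move/(congr1 (fun z => z + N%:Z)); rewrite !subrK => -[] ij; exact: val_inj.
have hE (l : int) : \int[mu]_(x in D) (F x * wave l x) = Cf F l + Sf F l.
  rewrite /Cf /Sf -RintegralD//; [|exact: Fcos_itgb|exact: Fsin_itgb].
  by apply: eq_Rintegral => x _; rewrite /wave; ring.
have sE : \sum_i (\int[mu]_(x in D) (F x * phi i x)) ^+ 2 =
    bsum N (fun l => Cf F l ^+ 2 + Sf F l ^+ 2).
  rewrite -[RHS]addr0 -[X in _ = _ + X](@bsum_odd _ N (fun l => 2 * Cf F l * Sf F l)).
    rewrite -bsumD; apply: eq_bigr => i _; rewrite hE; ring.
  by move=> l; rewrite CfN SfN//; ring.
rewrite sE => H1 H2; split=> //; rewrite -H2; apply: eq_Rintegral => t _.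
congr (_ ^+ 2); rewrite /psum -bsumZ.
rewrite -[LHS]addr0 -[X in _ + X = _](@bsum_odd _ N (fun l =>
   P^-1 * (Cf F l * sin (w * l%:~R * t) + Sf F l * cos (w * l%:~R * t)))).
  by rewrite -bsumD; apply: eq_bigr => i _; rewrite hE /phi /wave; ring.
by move=> l; rewrite CfN SfN// rmorphN/= !(mulrN, mulNr) sinN cosN; ring.
Qed.

End Fourier.

(** * Dirichlet kernel, pointwise convergence of Fourier series and the lower half of Parseval *)

Section Aux.
Context {R : realType}.
Notation mu := (@lebesgue_measure R).

Lemma measurable_invr : measurable_fun setT (fun x : R => x^-1).
Proof.
rewrite -(setUv [set 0 : R]); apply/measurable_funU => //; first exact: measurableC.
split.
  exact: measurable_fun_set1.
apply: open_continuous_measurable_fun.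
  by apply: closed_openC; apply: accessible_closed_set1; exact/hausdorff_accessible/Rhausdorff.
by move=> x; rewrite inE/= => /eqP x0; exact: inv_continuous.
Qed.

Lemma dirichlet (t : R) N :
  bsum N (fun l => cos (l%:~R * (2 * t))) * sin t = sin (N.*2.+1%:R * t).
Proof.
elim: N => [|N IH].
  by rewrite /bsum big_ord1 mul0r cos0 mul1r mul1r.
rewrite bsumS 2!mulrDl IH rmorphN/= mulNr cosN -pmulrn.
have -> : N.*2.+1%:R * t = N.+1%:R * (2 * t) - t.
  by rewrite -!natr1 -mul2n natrM; ring.
have -> : N.+1.*2.+1%:R * t = N.+1%:R * (2 * t) + t.
  by rewrite doubleS -!natr1 -mul2n natrM; ring.
by rewrite sinB sinD; ring.
Qed.

(** The mean value theorem gives the factor [cos 1] on [[0, 1]], and beyond 1 the sine has a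
    positive minimum on a compact interval that stops before [pi]. This bounds the quotient by the
    denominator of the Dirichlet kernel over a whole period. *)
Lemma sin_lower (eta : R) : 0 < eta ->
  exists2 c : R, 0 < c & forall v, `|v| <= pi - eta -> c * `|v| <= `|sin v|.
Proof.
move=> eta0; have pi0 := @pi_gt0 R.
pose b : R := Num.max 1 (pi - eta).
have cs : {within `[1, b], continuous (@sin R)}.
  by apply: continuous_subspaceT; exact: continuous_sin.
have b1 : 1 <= b by rewrite /b le_max lexx.
have [x] := EVT_min b1 cs.
rewrite in_itv/= => /andP[x1 xb] minx.
have bpi : b < pi.
  by rewrite /b gt_max ltrBlDr ltrDl eta0 (lt_le_trans _ (pi_ge2 R))// ltr1n.
have sx0 : 0 < sin x by rewrite sin_gt0_pi// (lt_le_trans _ x1)//= (le_lt_trans xb).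
have cos1 := @cos1_gt0 R.
exists (Num.min (cos 1) (sin x / pi)).
  by rewrite lt_min cos1 divr_gt0.
move=> v; wlog v0 : v / 0 <= v => [H|].
  have [/H//|/ltW v0] := leP 0 v.
  by rewrite -normrN -(normrN (sin v)) -sinN; apply: H; rewrite oppr_ge0.
rewrite ger0_norm// => vpi.
rewrite (le_trans _ (ler_norm _))//.
have [v1|/ltW v1] := leP v 1.
  apply: (@le_trans _ _ (cos 1 * v)).
    by rewrite ler_wpM2r// ge_min lexx.
  have [c /andP[c0 cv]] := @df_MVT R sin cos _ _ v0 (fun y _ => is_derive_sin y).
  rewrite sin0 !subr0 => ->; rewrite ler_wpM2r//.
  have [->//|c1] := eqVneq c 1.
  rewrite ltW// ltr_cos ?in_itv/=; last 2 first.
  - by rewrite c0/= (le_trans cv)// (le_trans v1)// (le_trans _ (pi_ge2 R))// ler1n.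
  - by rewrite ler01/= (le_trans _ (pi_ge2 R))// ler1n.
  by rewrite lt_neqAle c1 (le_trans cv).
apply: (@le_trans _ _ (sin x)).
  apply: (@le_trans _ _ (sin x / pi * v)).
    by rewrite ler_wpM2r// ge_min lexx orbT.
  rewrite -mulrA ger_pMr// mulrC ler_pdivrMr// mul1r (le_trans vpi)//.
  by rewrite gerBl ltW.
by apply: minx; rewrite in_itv/= v1/= /b le_max vpi orbT.
Qed.

Lemma limn_einf_ub (u : nat -> \bar R) c : (forall n, u n <= c)%E ->
  (limn_einf u <= c)%E.
Proof.
move=> uc; rewrite limn_einf_lim; apply: lime_le; first exact: is_cvg_einfs.
apply: nearW => n; apply: (le_trans _ (uc n)).
by apply: ereal_inf_lbound; exists n => /=.
Qed.

End Aux.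

Section Parseval.
Context {R : realType}.
Implicit Types (F G : R -> R) (t x K M : R).
Notation mu := (@lebesgue_measure R).
Variables (t0 P : R).
Hypothesis P0 : 0 < P.
Let D : set (measurableTypeR R) := `[t0, t0 + P]%classic.
Let w := 2 * pi / P.
Let mD : measurable D. Proof. exact: measurable_itv. Qed.
Let w0 : 0 < w. Proof. by rewrite divr_gt0// mulr_gt0// pi_gt0. Qed.

(** By Bessel the partial sums of the squared coefficients are bounded, so the series converges and
    its terms tend to 0. *)
Lemma riemann_lebesgue G M : measurable_fun D G -> (forall x, D x -> `|G x| <= M) ->
  (fun n : nat => Cf t0 P G n%:Z) @ \oo --> 0 /\
  (fun n : nat => Sf t0 P G n%:Z) @ \oo --> 0.
Proof.
move=> mG GM.
have iG : itgb D (fun x => G x ^+ 2).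
  apply: (@seg_bounded_itgb _ _ _ _ (M ^+ 2)); first exact: measurable_funX.
  move=> x xD; rewrite ger0_norm ?sqr_ge0// -(real_normK (num_real (G x))).
  by rewrite lerXn2r ?nnegrE//; [exact: le_trans (GM x _)|exact: GM].
have H : (fun n : nat => Cf t0 P G n%:Z ^+ 2 + Sf t0 P G n%:Z ^+ 2) @ \oo --> 0.
  apply: cvg_series_cvg_0; apply: nondecreasing_is_cvgn.
    apply/nondecreasing_seqP => n; rewrite /series/= big_nat_recr//= lerDl.
    by rewrite addr_ge0 ?sqr_ge0.
  exists (P * \int[mu]_(x in D) G x ^+ 2) => _ [n _ <-].
  have [b _] := @bessel R t0 P P0 G n mG iG; apply: le_trans b.
  rewrite /series/= big_mkord; apply: bsum_ge_nat => l.
  by rewrite addr_ge0 ?sqr_ge0.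
have sq0 (u v : nat -> R) : (fun n => u n ^+ 2 + v n ^+ 2) @ \oo --> 0 ->
    u @ \oo --> 0.
  move=> /cvgr0Pnorm_lt uv; apply/cvgr0Pnorm_lt => e e0.
  have e2 : 0 < e ^+ 2 by rewrite exprn_gt0.
  apply: filterS (uv _ e2) => n.
  rewrite ger0_norm ?addr_ge0 ?sqr_ge0// => uve.
  have : u n ^+ 2 < e ^+ 2 by have := sqr_ge0 (v n); lra.
  rewrite -(real_normK (num_real (u n))) => h; rewrite ltNge; apply/negP => eu.
  have : e ^+ 2 <= `|u n| ^+ 2 by rewrite !expr2 ler_pM// ltW.
  by rewrite leNgt h.
split; first exact: sq0 H.
by apply: sq0; under eq_fun do rewrite addrC; exact: H.
Qed.

Lemma dirichlet_int N t : \int[mu]_(x in D) bsum N (fun l => cos (w * l%:~R * (x - t))) = P.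
Proof.
have ic (l : int) : itgb D (fun x => cos (w * l%:~R * (x - t))).
  apply: cont_itgb; under eq_fun do rewrite mulrBr.
  exact: (@cosw_cont _ P).
rewrite Rint_sum// -/(bsum N (fun l => \int[mu]_(x in D) cos (w * l%:~R * (x - t)))).
rewrite bsum_split big1 ?add0r; last first.
  move=> i _; under eq_Rintegral do rewrite mulrBr.
  by rewrite (@Rint_cos_period _ t0 P)//; case: i => i /= iN; lia.
rewrite big_ord_recl/= big1 ?addr0; last first.
  move=> i _; under eq_Rintegral do rewrite mulrBr.
  by rewrite (@Rint_cos_period _ t0 P)//; case: i => i /= iN; lia.
under eq_Rintegral do rewrite mulr0 mul0r cos0.
by rewrite Rint1_seg ?ltrDl// addrAC subrr add0r.
Qed.

(** Dini's argument: the quotient of [F x - F t] by the sine in the Dirichlet kernel is bounded,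
    because [F] is Lipschitz at [t] and because [t], being interior, keeps [v x] away from the other
    zeros of the sine at [pi] and [- pi]. Riemann-Lebesgue then kills the remainder. *)
Lemma psum_cvg F M K t : measurable_fun D F -> (forall x, D x -> `|F x| <= M) ->
  t0 < t < t0 + P -> (forall x, D x -> `|F x - F t| <= K * `|x - t|) ->
  psum t0 P F N t @[N --> \oo] --> F t.
Proof.
move=> mF FM /andP[t0t tP] FK.
have iF2 : itgb D (fun x => F x ^+ 2).
  apply: (@seg_bounded_itgb _ _ _ _ (M ^+ 2)); first exact: measurable_funX.
  move=> x xD; rewrite ger0_norm ?sqr_ge0// -(real_normK (num_real (F x))).
  by rewrite lerXn2r ?nnegrE//; [exact: le_trans (FM x _)|exact: FM].
have w2 : 0 < w / 2 by rewrite divr_gt0.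
have iF : itgb D F by exact: seg_bounded_itgb FM.
pose v x := w / 2 * (x - t).
(* At [x = t] both numerator and sine vanish, and the convention [0^-1 = 0] gives [G t = 0]; no
   exceptional point has to be removed. *)
pose G x := (F x - F t) / sin (v x).
have dv x : is_derive x 1 v (w / 2) by rewrite /v; deriv; ring.
have mv : measurable_fun setT v by apply: continuous_measurable_fun; exact: df_cont dv.
have msin : measurable_fun setT (@sin R) by apply: continuous_measurable_fun; exact: continuous_sin.
have mcos : measurable_fun setT (@cos R) by apply: continuous_measurable_fun; exact: continuous_cos.
have msv : measurable_fun setT (fun x => sin (v x)) by exact: measurableT_comp.
have mcv : measurable_fun setT (fun x => cos (v x)) by exact: measurableT_comp.
have mG : measurable_fun D G.
  apply: measurable_funM; first exact: measurable_funB.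
  by apply: measurable_funTS; apply: measurableT_comp => //; exact: measurable_invr.
pose d := Num.min (t - t0) (t0 + P - t).
have d0 : 0 < d by rewrite lt_min !subr_gt0 t0t tP.
have pi0 := @pi_gt0 R.
have eta0 : 0 < w / 2 * d by rewrite mulr_gt0.
have [c c0 sinlow] := sin_lower eta0.
have vlow x : D x -> `|v x| <= pi - w / 2 * d.
  rewrite /D/= in_itv/= => /andP[xt0 xP].
  have -> : pi - w / 2 * d = w / 2 * (P - d).
    by rewrite /w; field; rewrite gt_eqF.
  have -> : `|v x| = w / 2 * `|x - t|.
    by rewrite /v normrM [`|w / 2|]gtr0_norm.
  rewrite ler_pM2l//.
  have : d <= t - t0 by rewrite ge_min lexx.
  have : d <= t0 + P - t by rewrite ge_min lexx orbT.
  by move=> *; rewrite ler_norml; lra.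
have K0 : 0 <= K.
  have : 0 <= K * `|t0 - t| by apply: le_trans (FK t0 _); rewrite // /D/= in_itv/= lexx lerDl ltW.
  by rewrite pmulr_lge0// normr_gt0 subr_eq0 lt_eqF.
pose MG := K / (c * (w / 2)).
have GM x : D x -> `|G x| <= MG.
  move=> Dx; have [->|xt] := eqVneq x t.
    by rewrite /G subrr mul0r normr0 divr_ge0// mulr_ge0// ltW.
  have xt0 : 0 < `|x - t| by rewrite normr_gt0 subr_eq0.
  have h := sinlow _ (vlow _ Dx).
  have vx : `|v x| = w / 2 * `|x - t|.
    by rewrite /v normrM [`|w / 2|]gtr0_norm.
  have sv0 : 0 < `|sin (v x)|.
    by apply: lt_le_trans h; rewrite vx mulr_gt0// mulr_gt0.
  rewrite /G normrM normfV ler_pdivrMr//.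
  apply: le_trans (FK _ Dx) _.
  apply: (@le_trans _ _ (MG * (c * `|v x|))); last first.
    by rewrite ler_wpM2l// divr_ge0// mulr_ge0// ltW.
  by rewrite vx /MG le_eqVlt; apply/orP; left; apply/eqP; field; rewrite !gt_eqF.
pose G1 x := G x * cos (v x); pose G2 x := G x * sin (v x).
have mG1 : measurable_fun D G1 by apply: measurable_funM => //; exact: measurable_funTS.
have mG2 : measurable_fun D G2 by apply: measurable_funM => //; exact: measurable_funTS.
have GM1 x : D x -> `|G1 x| <= MG.
  by move=> /GM; apply: le_trans; rewrite /G1 normrM ler_piMr ?cos_max.
have GM2 x : D x -> `|G2 x| <= MG.
  by move=> /GM; apply: le_trans; rewrite /G2 normrM ler_piMr ?sin_max.
have iG1 : itgb D G1 by exact: seg_bounded_itgb GM1.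
have iG2 : itgb D G2 by exact: seg_bounded_itgb GM2.
have sqi (H : R -> R) : measurable_fun D H -> (forall x, D x -> `|H x| <= MG) -> itgb D (fun x => H x ^+ 2).
  move=> mH HM; apply: (@seg_bounded_itgb _ _ _ _ (MG ^+ 2)); first exact: measurable_funX.
  move=> x xD; rewrite ger0_norm ?sqr_ge0// -(real_normK (num_real (H x))).
  by rewrite lerXn2r ?nnegrE//; [exact: le_trans (HM x _)|exact: HM].
have [cG1 sG1] := riemann_lebesgue mG1 GM1.
have [cG2 sG2] := riemann_lebesgue mG2 GM2.
have iDN N : itgb D (fun x => bsum N (fun l => cos (w * l%:~R * (x - t)))).
  apply: itgb_sum => // i _.
  apply: cont_itgb; under eq_fun do rewrite mulrBr.
  exact: (@cosw_cont _ P).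
(* The kernel has integral [P], which produces [F t]. In the remainder, [dirichlet] gives
   [G x * sin ((2N+1) v x)], whose angle splits as [w N (x - t) + v x]; the addition formulas leave
   coefficients of [G1] and [G2] at frequency [N]. *)
have E N : psum t0 P F N t = F t + P^-1 *
   (Sf t0 P G1 N%:Z * cos (w * N%:R * t) - Cf t0 P G1 N%:Z * sin (w * N%:R * t) +
    (Cf t0 P G2 N%:Z * cos (w * N%:R * t) + Sf t0 P G2 N%:Z * sin (w * N%:R * t))).
  have iFD : itgb D (fun x => F x * bsum N (fun l => cos (w * l%:~R * (x - t)))).
    under eq_fun do rewrite /bsum mulr_sumr.
    apply: itgb_sum => // i _.
    apply: (@l2_mul_itgb _ _ _ _ _ 1) => //.
      apply: measurable_funTS; apply: continuous_measurable_fun.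
      under eq_fun do rewrite mulrBr.
      exact: (@cosw_cont _ P).
    by move=> x _; exact: cos_max.
  transitivity (P^-1 * \int[mu]_(x in D) (F x * bsum N (fun l => cos (w * l%:~R * (x - t))))).
    congr (_ * _); under [RHS]eq_Rintegral do rewrite /bsum mulr_sumr.
    rewrite Rint_sum//; last first.
      move=> i _; apply: (@l2_mul_itgb _ _ _ _ _ 1) => //.
        apply: measurable_funTS; apply: continuous_measurable_fun.
        under eq_fun do rewrite mulrBr.
        exact: (@cosw_cont _ P).
      by move=> x _; exact: cos_max.
    apply: eq_bigr => i _; set l := (i%:Z - N%:Z).
    have ic := @Fcos_itgb R t0 P _ l mF iF2; have is_ := @Fsin_itgb R t0 P _ l mF iF2.
    rewrite /Cf /Sf -!RintegralZr// -RintegralD//.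
    - by apply: eq_Rintegral => x _; rewrite -/w -/l mulrBr cosB; ring.
    - exact: itgbZr.
    - exact: itgbZr.
  have FE x : F x * bsum N (fun l => cos (w * l%:~R * (x - t))) =
     F t * bsum N (fun l => cos (w * l%:~R * (x - t))) +
     (F x - F t) * bsum N (fun l => cos (w * l%:~R * (x - t))) by ring.
  have iFtD : itgb D (fun x => F t * bsum N (fun l => cos (w * l%:~R * (x - t)))).
    exact: itgbZ.
  have iFFD : itgb D (fun x => (F x - F t) * bsum N (fun l => cos (w * l%:~R * (x - t)))).
    by under eq_fun do rewrite mulrBl; exact: itgbB.
  under eq_Rintegral do rewrite FE.
  have eZ : \int[mu]_(x in D) (F t * bsum N (fun l => cos (w * l%:~R * (x - t)))) = F t * P.
    by rewrite RintegralZl; [rewrite dirichlet_int|exact: mD|exact: iDN].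
  rewrite RintegralD// eZ mulrDr; congr (_ + _).
    by field; rewrite gt_eqF.
  congr (_ * _).
  have i1 := @Fsin_itgb R t0 P _ N%:Z mG1 (sqi _ mG1 GM1).
  have i2 := @Fcos_itgb R t0 P _ N%:Z mG1 (sqi _ mG1 GM1).
  have i3 := @Fsin_itgb R t0 P _ N%:Z mG2 (sqi _ mG2 GM2).
  have i4 := @Fcos_itgb R t0 P _ N%:Z mG2 (sqi _ mG2 GM2).
  have j1 : itgb D (fun x => G1 x * sin (w * N%:R * x) * cos (w * N%:R * t)).
    exact: itgbZr.
  have j2 : itgb D (fun x => G1 x * cos (w * N%:R * x) * sin (w * N%:R * t)).
    exact: itgbZr.
  have j3 : itgb D (fun x => G2 x * cos (w * N%:R * x) * cos (w * N%:R * t)).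
    exact: itgbZr.
  have j4 : itgb D (fun x => G2 x * sin (w * N%:R * x) * sin (w * N%:R * t)).
    exact: itgbZr.
  rewrite /Cf /Sf -!RintegralZr// -RintegralB// -RintegralD// -RintegralD//; last 2 first.
  - exact: itgbB.
  - exact: itgbD.
  apply: eq_Rintegral => x /set_mem Dx; rewrite -/w -!pmulrn.
  have [->|xt] := eqVneq x t.
    by rewrite subrr mul0r /G1 /G2 /G subrr !mul0r; ring.
  have sv0 : sin (v x) != 0.
    have h := sinlow _ (vlow _ Dx).
    rewrite -normr_gt0; apply: lt_le_trans h.
    by rewrite mulr_gt0// normr_gt0 /v mulf_neq0 ?subr_eq0// gt_eqF.
  have -> : F x - F t = G x * sin (v x) by rewrite /G divfK.
  rewrite -mulrA [sin (v x) * _]mulrC.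
  have -> : bsum N (fun l => cos (w * l%:~R * (x - t))) =
     bsum N (fun l => cos (l%:~R * (2 * v x))).
    by apply: eq_bsum => l; congr cos; rewrite /v; field.
  rewrite dirichlet /G1 /G2.
  have -> : N.*2.+1%:R * v x = (w * N%:R * x - w * N%:R * t) + v x.
    by rewrite -natr1 -mul2n natrM /v; field.
  by rewrite sinD sinB cosB; ring.
have bz (u s : nat -> R) : u @ \oo --> 0 -> (forall n, `|s n| <= 1) -> (fun n => u n * s n) @ \oo --> 0.
  move=> u0 s1; apply/norm_cvg0P.
  apply: (@squeeze_cvgr _ _ _ _ (cst 0) (fun n => `|u n|)); last 2 first.
  - exact: cvg_cst.
  - by apply/norm_cvg0P.
  by apply: nearW => n; rewrite normr_ge0/= normrM ler_piMr.
under eq_fun do rewrite E.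
have H : (fun N : nat => F t + P^-1 *
   (Sf t0 P G1 N%:Z * cos (w * N%:R * t) - Cf t0 P G1 N%:Z * sin (w * N%:R * t) +
    (Cf t0 P G2 N%:Z * cos (w * N%:R * t) + Sf t0 P G2 N%:Z * sin (w * N%:R * t)))) @ \oo -->
    F t + P^-1 * (0 - 0 + (0 + 0)).
  apply: cvgD; first exact: cvg_cst.
  apply: cvgM; first exact: cvg_cst.
  apply: cvgD; first apply: cvgB.
  - by apply: bz => // n; exact: cos_max.
  - by apply: bz => // n; exact: sin_max.
  apply: cvgD.
  - by apply: bz => // n; exact: cos_max.
  - by apply: bz => // n; exact: sin_max.
by rewrite subr0 !addr0 mulr0 addr0 in H.
Qed.

Lemma psum_cont F N : continuous (psum t0 P F N).
Proof.
pose dS (l : int) x := (Cf t0 P F l * (- sin (w * l%:~R * x)) +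
   Sf t0 P F l * cos (w * l%:~R * x)) * (w * l%:~R).
suff H (n : nat) (s : 'I_n -> int) : continuous (fun t => \sum_(i < n)
    (Cf t0 P F (s i) * cos (w * (s i)%:~R * t) + Sf t0 P F (s i) * sin (w * (s i)%:~R * t))).
  by move=> x; apply: cvgM; [exact: cvg_cst|exact: H].
elim: n s => [|n IH] s.
  under eq_fun do rewrite big_ord0; exact: cst_continuous.
under eq_fun do rewrite big_ord_recr/=.
move=> x; apply: cvgD; first exact: IH.
have c : continuous (fun y => Cf t0 P F (s ord_max) * cos (w * (s ord_max)%:~R * y) +
    Sf t0 P F (s ord_max) * sin (w * (s ord_max)%:~R * y)).
  by apply: (@df_cont _ _ (dS (s ord_max))) => y; deriv; rewrite /dS; ring.
exact: c.
Qed.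

Lemma itgb_fin (E : set (measurableTypeR R)) F : measurable E -> itgb E F ->
  (\int[mu]_(x in E) (F x)%:E = (\int[mu]_(x in E) F x)%:E)%E.
Proof. by move=> mE iF; rewrite /Rintegral fineK//; exact: integrable_fin_num. Qed.

(** Fatou: [F^2] is the pointwise limit of the squared partial sums, whose integrals are at most
    [P^-1 * B] by the second part of [bessel]. The open interval [O] is used because [psum_cvg]
    concerns interior points. *)
Lemma parseval_lower F M K B : measurable_fun D F -> (forall x, D x -> `|F x| <= M) ->
  (forall x y, D x -> D y -> `|F x - F y| <= K * `|x - y|) ->
  (forall N, bsum N (fun l => Cf t0 P F l ^+ 2 + Sf t0 P F l ^+ 2) <= B) ->
  P * \int[mu]_(x in D) F x ^+ 2 <= B.
Proof.
move=> mF FM FK HB.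
pose O : set (measurableTypeR R) := `]t0, t0 + P[%classic.
have mO : measurable O by exact: measurable_itv.
have OD : O `<=` D by exact: subset_itv_oo_cc.
have iF2 : itgb D (fun x => F x ^+ 2).
  apply: (@seg_bounded_itgb _ _ _ _ (M ^+ 2)); first exact: measurable_funX.
  move=> x xD; rewrite ger0_norm ?sqr_ge0// -(real_normK (num_real (F x))).
  by rewrite lerXn2r ?nnegrE//; [exact: le_trans (FM x _)|exact: FM].
have DO G : measurable_fun D G -> (\int[mu]_(x in D) (G x)%:E = \int[mu]_(x in O) (G x)%:E)%E.
  move=> mG; apply: integral_itv_bndoo; apply/measurable_EFinP.
  exact: measurable_funS mG.
have ps N : itgb D (fun x => psum t0 P F N x ^+ 2).
  by apply: cont_itgb => x; apply: cvgM; exact: psum_cont.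
rewrite -(@ler_pM2l _ P^-1) ?invr_gt0// mulrA mulVf ?gt_eqF// mul1r.
rewrite -lee_fin -itgb_fin// DO; last exact: itgb_mfun iF2.
have -> : (\int[mu]_(x in O) (F x ^+ 2)%:E =
   \int[mu]_(x in O) limn_einf (fun N => (psum t0 P F N x ^+ 2)%:E))%E.
  apply: eq_integral => x /set_mem Ox.
  have xO : t0 < x < t0 + P by move: Ox; rewrite /O/= in_itv.
  have c : psum t0 P F N x @[N --> \oo] --> F x.
    by apply: (@psum_cvg F M K) => // y Dy; apply: FK => //; exact: OD.
  have c2 : (psum t0 P F N x ^+ 2)%:E @[N --> \oo] --> (F x ^+ 2)%:E.
    by apply: cvg_EFin; [exact: nearW|apply: cvgM].
  by rewrite is_cvg_limn_einfE; [apply/esym/cvg_lim|apply/cvg_ex; exists (F x ^+ 2)%:E].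
apply: (le_trans (fatou mu mO _ _)).
- move=> N; apply/measurable_EFinP; apply: measurable_funS (itgb_mfun (ps N)) => //.
- by move=> N x _; rewrite lee_fin sqr_ge0.
apply: limn_einf_ub => N; rewrite -DO; last exact: itgb_mfun (ps N).
rewrite itgb_fin// lee_fin; have [_ ->] := @bessel R t0 P P0 F N mF iF2.
by rewrite ler_pM2l ?invr_gt0.
Qed.

End Parseval.

(** * Tilings of the line, lattice sums and weighted Cauchy-Schwarz *)

Section Tiles.
Context {R : realType}.
Implicit Types (f g : R -> R) (a b c x h t P : R).
Notation mu := (@lebesgue_measure R).

Lemma Rint_segD a b c f : a <= b -> b <= c -> itgb `[a, c] f ->
  \int[mu]_(x in `[a, c]) f x =
  \int[mu]_(x in `[a, b]) f x + \int[mu]_(x in `[b, c]) f x.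
Proof.
move=> ab bc fi.
have H := @Rintegral_itvB R f (BLeft a) (BRight c) b fi.
rewrite bnd_simp ab bnd_simp bc in H.
have {}H := H isT isT.
have -> : \int[mu]_(x in `[b, c]) f x = \int[mu]_(x in `]b, c]) f x.
  apply/esym/Rintegral_itv_obnd_cbnd.
  apply: itgb_sub fi => //.
  by apply: subset_itv; rewrite bnd_simp.
by rewrite -H addrC subrK.
Qed.

Lemma itgb_seg a b f : itgb setT f -> itgb `[a, b] f.
Proof. exact: itgb_sub. Qed.

Lemma tile_sum t0 P N f : 0 < P -> (forall x y, itgb `[x, y] f) ->
  \int[mu]_(x in `[t0 - N%:R * P, t0 + N.+1%:R * P]) f x =
  bsum N (fun m => \int[mu]_(x in `[t0 + m%:~R * P, t0 + m%:~R * P + P]) f x).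
Proof.
move=> P0 fi; elim: N => [|N IH].
  by rewrite /bsum big_ord1 /= subrr mul0r mul1r subr0 addr0.
rewrite bsumS -IH.
have Pn n : (0 : R) <= n%:R * P by rewrite mulr_ge0// ltW.
rewrite (@Rint_segD (t0 - N.+1%:R * P) (t0 - N%:R * P)); last 3 first.
- by rewrite lerB// ler_pM2r// ler_nat.
- by have := Pn N; have := Pn N.+2; lra.
- exact: fi.
rewrite (@Rint_segD (t0 - N%:R * P) (t0 + N.+1%:R * P)); last 3 first.
- by have := Pn N; have := Pn N.+1; lra.
- by rewrite lerD2l ler_pM2r// ler_nat.
- exact: fi.
rewrite [LHS]addrC; congr (_ + _ + _).
  congr (\int[mu]_(x in _) _); apply/seteqP; split=> x; rewrite /= !in_itv/= -pmulrn -addrA.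
    by rewrite -[N.+2%:R]natr1 mulrDl mul1r.
  by rewrite -[N.+2%:R]natr1 mulrDl mul1r.
congr (\int[mu]_(x in _) _); apply/seteqP.
have -> : t0 + (- N.+1%:Z)%:~R * P + P = t0 - N%:R * P.
  by rewrite rmorphN/= -pmulrn -natr1; ring.
by rewrite rmorphN/= -pmulrn mulNr; split.
Qed.

Lemma Rint_wide t0 P f : 0 < P -> itgb setT f ->
  (fun N : nat => \int[mu]_(x in `[t0 - N%:R * P, t0 + N.+1%:R * P]) f x) @ \oo -->
  \int[mu]_x f x.
Proof.
move=> P0 fi.
pose I (N : nat) : set (measurableTypeR R) := `[t0 - N%:R * P, t0 + N.+1%:R * P]%classic.
have mI N : measurable (I N) by exact: measurable_itv.
pose fN (N : nat) x : \bar R := ((f \_ (I N)) x)%:E.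
have mf := itgb_mfun fi.
have mfN N : measurable_fun setT (fN N).
  apply/measurable_EFinP; apply/measurable_restrict => //; first exact: mI.
  by rewrite setTI; exact: measurable_funS mf.
have cv : {ae mu, forall x, setT x -> fN ^~ x @ \oo --> (f x)%:E}.
  apply: aeW => x _; apply: cvg_near_cst.
  have [n nx] : exists n : nat, `|x - t0| / P < n%:R.
    by exists (Num.bound (`|x - t0| / P)); apply: archi_boundP; rewrite divr_ge0// ltW.
  exists n => // m /= nm; rewrite /fN patchE ifT// inE /I/= in_itv/=.
  have : `|x - t0| <= m%:R * P.
    by rewrite -ler_pdivrMr//; apply: (le_trans (ltW nx)); rewrite ler_nat.
  rewrite ler_norml -natr1 mulrDl mul1r => /andP[]; lra.
have dom : {ae mu, forall x n, setT x -> (`|fN n x| <= (`|f x|%R)%:E)%E}.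
  apply: aeW => x n _; rewrite /fN /= lee_fin patchE; case: ifP => // _.
  by rewrite normr0.
have mf' : measurable_fun setT (EFin \o f) by exact/measurable_EFinP.
have [_ _ H] := @dominated_convergence _ _ _ mu setT measurableT fN (EFin \o f)
  (EFin \o (fun x => `|f x|)) mfN mf' cv (itgb_norm fi) dom.
have {}H : fine (\int[mu]_x fN n x)%E @[n --> \oo] --> \int[mu]_x f x.
  by apply: fine_cvg; rewrite fineK//; exact: integrable_fin_num.
apply: cvg_trans H; apply: near_eq_cvg; apply: nearW => N.
by rewrite Rintegral_mkcond.
Qed.

Lemma cvg_bigsum n (u : nat -> 'I_n -> R) (v : 'I_n -> R) :
  (forall i, u N i @[N --> \oo] --> v i) ->
  \sum_i u N i @[N --> \oo] --> \sum_i v i.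
Proof.
elim: n u v => [|n IH] u v uv.
  by under eq_fun do rewrite big_ord0; rewrite big_ord0; exact: cvg_cst.
under eq_fun do rewrite big_ord_recr/=.
rewrite big_ord_recr/=; apply: cvgD; last exact: uv.
by apply: IH => i; exact: uv.
Qed.

Lemma exchange_bsum N L (F : int -> int -> R) :
  bsum N (fun k => bsum L (F k)) = bsum L (fun l => bsum N (F ^~ l)).
Proof. exact: exchange_big. Qed.

Lemma bsum_telescope N (u : int -> R) :
  bsum N (fun m => u (m + 1) - u m) = u N.+1%:Z - u (- N%:Z).
Proof.
elim: N => [|N IH]; first by rewrite /bsum big_ord1 /= subrr add0r oppr0.
rewrite bsumS IH.
have -> : - N.+1%:Z + 1 = - N%:Z by lia.
have -> : N.+1%:Z + 1 = N.+2%:Z by lia.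
by ring.
Qed.

(** Peetre's inequality: moving the argument by at most [h] costs a bounded factor in the quadratic
    weight. *)
Lemma oneDsqr_comp x y h : `|x - y| <= h -> (1 + y ^+ 2)^-1 <= 2 * (1 + h ^+ 2) * (1 + x ^+ 2)^-1.
Proof.
move=> xyh.
have p z : 0 < 1 + z ^+ 2 :> R by rewrite ltr_pwDl// sqr_ge0.
rewrite -div1r ler_pdivrMr// mulrAC ler_pdivlMr// mul1r.
have : (x - y) ^+ 2 <= h ^+ 2.
  by rewrite -(real_normK (num_real (x - y))) lerXn2r ?nnegrE// (le_trans _ xyh).
have := sqr_ge0 (x - 2 * y); have := sqr_ge0 y; have := sqr_ge0 h.
have : 0 <= h ^+ 2 * y ^+ 2 by rewrite mulr_ge0 ?sqr_ge0.
by move=> *; nra.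
Qed.

(** Each term is compared, through [oneDsqr_comp], with the increment of [atan] over a cell of
    length [h], whence the constant [c]. The increments telescope to less than [pi], uniformly in
    [x] and [N]. *)
Lemma lattice_sum h : 0 < h -> exists2 S : R, 0 < S &
  forall N x, bsum N (fun m => (1 + (m%:~R * h - x) ^+ 2)^-1) <= S.
Proof.
move=> h0; pose c := 2 * (1 + h ^+ 2) / h.
have c0 : 0 < c by rewrite divr_gt0// mulr_gt0// ltr_pwDl// sqr_ge0.
exists (c * pi); first by rewrite mulr_gt0// pi_gt0.
move=> N x.
pose u (m : int) := c * atan (m%:~R * h - x).
apply: (@le_trans _ _ (bsum N (fun m => u (m + 1) - u m))).
  apply: le_bsum => m; rewrite /u -mulrBr rmorphD/= mulrDl mul1r addrAC.
  set y := m%:~R * h - x.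
  have yh : y <= y + h by rewrite lerDl ltW.
  have [z /andP[z1 z2] ->] := @df_MVT R atan _ _ _ yh (fun z _ => is_derive1_atan z).
  rewrite [y + h]addrC addrK.
  have := @oneDsqr_comp z y h; rewrite ger0_norm ?subr_ge0// lerBlDl => /(_ z2).
  move=> H; apply: (le_trans H); rewrite le_eqVlt; apply/orP; left; apply/eqP.
  have zn : 1 + z ^+ 2 != 0 by rewrite gt_eqF// ltr_pwDl// sqr_ge0.
  have hn : h != 0 by rewrite gt_eqF.
  by rewrite /c; field; rewrite ?hn ?zn.
rewrite bsum_telescope /u -mulrBr ler_pM2l//.
have [/andP[_ a1] _] := (atan_def (N.+1%:~R * h - x)).
have := atan_ltpi2 (N.+1%:~R * h - x); have := atan_gtNpi2 ((- N%:Z)%:~R * h - x).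
by lra.
Qed.

Lemma weighted_CS n (s z : 'I_n -> R) : (forall i, 0 < s i) ->
  (\sum_i z i) ^+ 2 <= (\sum_i s i) * (\sum_i z i ^+ 2 / s i).
Proof.
case: n s z => [|n] s z s0; first by rewrite !big_ord0 mul0r expr0n.
have S0 : 0 < \sum_i s i.
  by rewrite big_ord_recl ltr_pwDl// sumr_ge0// => i _; exact: ltW.
set S := \sum_i s i; set A := \sum_i z i; set Q := \sum_i _.
have : 0 <= \sum_i s i * (z i / s i - A / S) ^+ 2.
  by apply: sumr_ge0 => i _; rewrite mulr_ge0 ?sqr_ge0 ?ltW.
have -> : \sum_i s i * (z i / s i - A / S) ^+ 2 = Q - A ^+ 2 / S.
  rewrite (eq_bigr (fun i => z i ^+ 2 / s i + (- (2 * (A / S))) * z i + (A / S) ^+ 2 * s i)).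
    rewrite !big_split/= -!mulr_sumr -/S -/A -/Q; field; rewrite gt_eqF//.
  by move=> i _; field; rewrite !gt_eqF//.
by rewrite subr_ge0 ler_pdivrMr// mulrC.
Qed.

End Tiles.

(** * The upper frame bound *)

Section UpperBound.
Context {R : realType}.
Implicit Types (f : R -> R) (t x : R).
Notation mu := (@lebesgue_measure R).
Variables (g : R -> R) (Cg : R).
Hypothesis cg : continuous g.
Hypothesis gle : forall x, `|g x| <= Cg * gauss_fun x.
Variables (a b : R).
Hypotheses (a0 : 0 < a) (b0 : 0 < b).

(** For real [f], the inner product with the complex atom is [GC - i GS], and [GQ] is its squared
    modulus. *)
Definition GC f (k l : int) :=
  \int[mu]_t (f t * g (t - a * k%:~R) * cos (2 * pi * b * l%:~R * t)).
Definition GS f (k l : int) :=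
  \int[mu]_t (f t * g (t - a * k%:~R) * sin (2 * pi * b * l%:~R * t)).
Definition GQ f (k l : int) := GC f k l ^+ 2 + GS f k l ^+ 2.

Definition L2r f := measurable_fun setT f /\ itgb setT (fun t => f t ^+ 2).

Lemma Cg_ge0 : 0 <= Cg.
Proof.
have := gle 0; rewrite /gauss_fun expr0n oppr0 expR0 mulr1.
exact: le_trans.
Qed.

Lemma g_decay x : `|g x| <= Cg * (1 + x ^+ 2)^-1.
Proof.
apply: (le_trans (gle x)); rewrite ler_wpM2l ?Cg_ge0//.
rewrite /gauss_fun expRN lef_pV2 ?posrE ?expR_gt0//; first exact: expR_ge1Dx.
by rewrite ltr_pwDl// sqr_ge0.
Qed.

Lemma g_bounded x : `|g x| <= Cg.
Proof.
apply: (le_trans (gle x)); rewrite ler_piMr ?Cg_ge0//.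
exact: gauss_fun_le1.
Qed.

Lemma g_meas : measurable_fun setT g.
Proof. exact: continuous_measurable_fun. Qed.

Lemma g_itgb : itgb setT g.
Proof.
apply: (itgb_le _ g_meas (fun x _ => gle x)) => //.
by apply: itgbZ => //; exact: integrableT_gauss.
Qed.

Lemma gshift_meas c : measurable_fun setT (fun t => g (t - c)).
Proof.
apply: continuous_measurable_fun.
move=> x; apply: continuous_comp; last exact: cg.
by apply: cvgB; [exact: cvg_id|exact: cvg_cst].
Qed.

Lemma fg_itgb f c : L2r f -> itgb setT (fun t => f t * g (t - c)).
Proof.
move=> [mf if2].
have ig : itgb setT (fun t => g (t - c)) by apply: (itgb_shift (- c)); exact: g_itgb.
apply: (@itgb_le _ _ _ (fun t => f t ^+ 2 + Cg * `|g (t - c)|)) => //.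
- by apply: measurable_funM => //; exact: gshift_meas.
- move=> x _; rewrite normrM -(real_normK (num_real (f x))).
  have := g_bounded (x - c); have := normr_ge0 (f x); have := normr_ge0 (g (x - c)).
  set u := `|f x|; set v := `|g _| => *.
  have : v * v <= Cg * v by rewrite ler_wpM2r.
  by have := sqr_ge0 (u - v); have := sqr_ge0 u; have := sqr_ge0 v; nra.
- by apply: itgbD => //; apply: itgbZ => //; exact: itgb_norm.
Qed.

Lemma bounded_itgbM f h : itgb setT f -> continuous h -> (forall x, `|h x| <= 1) ->
  itgb setT (fun t => f t * h t).
Proof.
move=> fi ch h1; apply: (@itgb_le _ _ _ (fun t => `|f t|)) => //.
- apply: measurable_funM; first exact: itgb_mfun fi.
  exact: continuous_measurable_fun.
- by move=> x _; rewrite normrM ler_piMr.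
- exact: itgb_norm.
Qed.

Lemma cosl_cont c : continuous (fun t : R => cos (c * t)).
Proof.
by apply: (@df_cont _ _ (fun x => - sin (c * x) * c)) => x; deriv; ring.
Qed.

Lemma sinl_cont c : continuous (fun t : R => sin (c * t)).
Proof.
by apply: (@df_cont _ _ (fun x => cos (c * x) * c)) => x; deriv; ring.
Qed.

Lemma GC_itgb f k l : L2r f ->
  itgb setT (fun t => f t * g (t - a * k%:~R) * cos (2 * pi * b * l%:~R * t)).
Proof.
move=> f2; apply: bounded_itgbM; first exact: fg_itgb.
  exact: cosl_cont.
by move=> x; exact: cos_max.
Qed.

Lemma GS_itgb f k l : L2r f ->
  itgb setT (fun t => f t * g (t - a * k%:~R) * sin (2 * pi * b * l%:~R * t)).
Proof.
move=> f2; apply: bounded_itgbM; first exact: fg_itgb.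
  exact: sinl_cont.
by move=> x; exact: sin_max.
Qed.

Let P := b^-1.
Let P0 : 0 < P. Proof. by rewrite invr_gt0. Qed.
Let J (m : int) : set (measurableTypeR R) := `[0 + m%:~R * P, 0 + m%:~R * P + P]%classic.

Let mJ m : measurable (J m).
Proof. exact: measurable_itv. Qed.

Let wE (l : int) t : 2 * pi * b * l%:~R * t = 2 * pi / P * l%:~R * t.
Proof. by rewrite /P invrK. Qed.

(** A Schur test. On a tile of length [1/b] the modulations are Fourier modes, so Bessel applies
    tile by tile; [s k m] majorizes the translate number [k] of [g] on tile [m], and its sums over
    [k] and over [m] are both uniformly bounded. Weighted Cauchy-Schwarz with weights [s k m]
    recombines the tiles. *)
Lemma upper_bound : exists2 B : R, 0 < B & forall f K L, L2r f ->
  bsum K (fun k => bsum L (fun l => GQ f k l)) <= B * \int[mu]_t f t ^+ 2.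
Proof.
have [S1 S10 HS1] := lattice_sum P0.
have [S2 S20 HS2] := lattice_sum a0.
(* [Cg + 1] instead of [Cg] keeps [C], and so all the weights, strictly positive. The second factor
   is the cost of replacing a point of a tile by its left end. *)
pose C := (Cg + 1) * (2 * (1 + P ^+ 2)).
have Cg0 := Cg_ge0.
have C0 : 0 < C by rewrite mulr_gt0// ?ltr_wpDl// mulr_gt0// ltr_pwDl// sqr_ge0.
pose s (k m : int) := C * (1 + (m%:~R * P - a * k%:~R) ^+ 2)^-1.
have s0 k m : 0 < s k m.
  by rewrite mulr_gt0// invr_gt0 ltr_pwDl// sqr_ge0.
have gs k m t : J m t -> `|g (t - a * k%:~R)| <= s k m.
  rewrite /J/= in_itv/= add0r => /andP[t1 t2].
  apply: (le_trans (g_decay _)).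
  rewrite /s /C -mulrA ler_pM//.
  - by rewrite invr_ge0 addr_ge0// sqr_ge0.
  - by rewrite lerDl.
  - by apply: oneDsqr_comp; rewrite ler_norml; lra.
have CS1 : 0 < C * S1 by exact: mulr_gt0.
have CS2 : 0 < C * S2 by exact: mulr_gt0.
have CS1P : 0 < C * S1 * P by exact: mulr_gt0.
have CSP : 0 < C * S1 * (C * S2) * P by apply: mulr_gt0 => //; exact: mulr_gt0.
exists (C * S1 * (C * S2) * P) => //.
move=> f K L f2; have [mf if2] := f2.
have fJ k m : measurable_fun (J m) (fun t => f t * g (t - a * k%:~R)) /\
    itgb (J m) (fun t => (f t * g (t - a * k%:~R)) ^+ 2).
  have mfg : measurable_fun (J m) (fun t => f t * g (t - a * k%:~R)).
    by apply: measurable_funTS; apply: measurable_funM => //; exact: gshift_meas.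
  split=> //.
  apply: (@itgb_le _ _ _ (fun t => s k m ^+ 2 * f t ^+ 2)) => //.
  - exact: measurable_funX.
  - move=> t Jt; rewrite ger0_norm ?sqr_ge0// exprMn mulrC ler_wpM2r ?sqr_ge0//.
    rewrite -(real_normK (num_real (g _))) lerXn2r ?nnegrE//; last exact: gs.
    exact: ltW.
  - by apply: itgbZ => //; apply: itgb_sub if2.
pose E (m : int) := \int[mu]_(t in J m) f t ^+ 2.
have E0 m : 0 <= E m by apply: Rintegral_ge0 => t _; exact: sqr_ge0.
have bess k m : bsum L (fun l => Cf (0 + m%:~R * P) P (fun t => f t * g (t - a * k%:~R)) l ^+ 2 +
      Sf (0 + m%:~R * P) P (fun t => f t * g (t - a * k%:~R)) l ^+ 2) <= P * s k m ^+ 2 * E m.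
  have [m1 m2] := fJ k m.
  have [h _] := @bessel R (0 + m%:~R * P) P P0 _ L m1 m2.
  apply: (le_trans h); rewrite -mulrA ler_pM2l// /E -RintegralZl//; last first.
    exact: itgb_sub if2.
  apply: le_Rintegral => //.
  - by apply: itgbZ => //; apply: itgb_sub if2.
  - move=> t Jt; rewrite exprMn mulrC ler_wpM2r ?sqr_ge0//.
    rewrite -(real_normK (num_real (g _))) lerXn2r ?nnegrE//; last exact: gs.
    exact: ltW.
pose CN N k l := \int[mu]_(t in `[0 - N%:R * P, 0 + N.+1%:R * P])
   (f t * g (t - a * k%:~R) * cos (2 * pi * b * l%:~R * t)).
pose SN N k l := \int[mu]_(t in `[0 - N%:R * P, 0 + N.+1%:R * P])
   (f t * g (t - a * k%:~R) * sin (2 * pi * b * l%:~R * t)).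
have main N : bsum K (fun k => bsum L (fun l => CN N k l ^+ 2 + SN N k l ^+ 2)) <=
    C * S1 * (C * S2) * P * \int[mu]_t f t ^+ 2.
  have Sm k : bsum N (fun m => s k m) <= C * S1.
    by rewrite bsumZ ler_pM2l.
  have Sk m : bsum K (fun k => s k m) <= C * S2.
    rewrite bsumZ ler_pM2l//; apply: le_trans (HS2 K (m%:~R * P)).
    apply: le_bsum => k; rewrite (_ : (m%:~R * P - a * k%:~R) ^+ 2 = (k%:~R * a - m%:~R * P) ^+ 2)//.
    by ring.
  have step k : bsum L (fun l => CN N k l ^+ 2 + SN N k l ^+ 2) <=
      C * S1 * P * bsum N (fun m => s k m * E m).
    pose cm m l := Cf (0 + m%:~R * P) P (fun t => f t * g (t - a * k%:~R)) l.
    pose sm m l := Sf (0 + m%:~R * P) P (fun t => f t * g (t - a * k%:~R)) l.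
    have H l : CN N k l ^+ 2 + SN N k l ^+ 2 <=
        C * S1 * bsum N (fun m => (cm m l ^+ 2 + sm m l ^+ 2) / s k m).
      have -> : CN N k l = bsum N (cm ^~ l).
        rewrite /CN tile_sum//; last by move=> x y; apply: itgb_seg; exact: GC_itgb.
        apply: eq_bsum => m; apply: eq_Rintegral => t _.
        by rewrite wE.
      have -> : SN N k l = bsum N (sm ^~ l).
        rewrite /SN tile_sum//; last by move=> x y; apply: itgb_seg; exact: GS_itgb.
        apply: eq_bsum => m; apply: eq_Rintegral => t _.
        by rewrite wE.
      rewrite (@eq_bsum _ N (fun m => (cm m l ^+ 2 + sm m l ^+ 2) / s k m)
        (fun m => cm m l ^+ 2 / s k m + sm m l ^+ 2 / s k m)); last first.
        by move=> m; rewrite mulrDl.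
      rewrite bsumD mulrDr.
      have CS (z : int -> R) : bsum N z ^+ 2 <= C * S1 * bsum N (fun m => z m ^+ 2 / s k m).
        apply: le_trans (weighted_CS _ _) _; first by move=> i; exact: (s0 k (i%:Z - N%:Z)).
        have Z0 : 0 <= bsum N (fun m => z m ^+ 2 / s k m).
          by apply: bsum_ge0 => m; rewrite divr_ge0 ?sqr_ge0 ?ltW.
        by have := ler_wpM2r Z0 (Sm k).
      by rewrite lerD.
    apply: (le_trans (le_bsum L H)).
    rewrite bsumZ -[leRHS]mulrA ler_pM2l// exchange_bsum -bsumZ; apply: le_bsum => m.
    under eq_bsum do rewrite mulrC.
    rewrite bsumZ mulrC ler_pdivrMr//.
    by apply: (le_trans (bess k m)); rewrite le_eqVlt; apply/orP; left; apply/eqP; ring.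
  apply: (le_trans (le_bsum K step)).
  rewrite bsumZ.
  have -> : bsum K (fun k => bsum N (fun m => s k m * E m)) =
      bsum N (fun m => E m * bsum K (fun k => s k m)).
    rewrite exchange_bsum; apply: eq_bsum => m; rewrite -bsumZ.
    by apply: eq_bsum => k; rewrite mulrC.
  apply: (@le_trans _ _ (C * S1 * P * (C * S2 * bsum N E))).
    rewrite ler_pM2l// -bsumZ; apply: le_bsum => m.
    by rewrite mulrC ler_wpM2r.
  rewrite -tile_sum//; last by move=> x y; exact: itgb_seg.
  have -> : C * S1 * P * (C * S2 * \int[mu]_(x in `[0 - N%:R * P, 0 + N.+1%:R * P]) f x ^+ 2) =
     C * S1 * (C * S2) * P * \int[mu]_(x in `[0 - N%:R * P, 0 + N.+1%:R * P]) f x ^+ 2 by ring.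
  rewrite ler_pM2l// -lee_fin -!itgb_fin//; last exact: itgb_seg.
  apply: ge0_subset_integral => //.
  - by apply/measurable_EFinP; exact: itgb_mfun if2.
  - by move=> x _; rewrite lee_fin sqr_ge0.
have cvC k l : CN N k l @[N --> \oo] --> GC f k l.
  by apply: Rint_wide => //; exact: GC_itgb.
have cvS k l : SN N k l @[N --> \oo] --> GS f k l.
  by apply: Rint_wide => //; exact: GS_itgb.
have cvb M (u : nat -> int -> R) v : (forall l, u N l @[N --> \oo] --> v l) ->
    bsum M (u N) @[N --> \oo] --> bsum M v.
  by move=> uv; apply: cvg_bigsum => i; exact: uv.
have cv : bsum K (fun k => bsum L (fun l => CN N k l ^+ 2 + SN N k l ^+ 2)) @[N --> \oo] -->
   bsum K (fun k => bsum L (fun l => GQ f k l)).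
  by apply: (cvb) => k; apply: (cvb) => l; apply: cvgD; apply: cvgM.
by apply: (cvgr_to_le cv); exact: nearW.
Qed.

End UpperBound.

(** * Density of Lipschitz functions with compact support *)

Section Blip.
Context {R : realType}.
Implicit Types (f g : R -> R) (x y c : R).

(** Bounded Lipschitz functions: closed under products and translations, dense in L^2 once supports
    are compact, and regular enough for [psum_cvg]. *)
Definition blip f := exists M K : R, [/\ 0 <= M, 0 <= K, forall x, `|f x| <= M &
  forall x y, `|f x - f y| <= K * `|x - y|].

Lemma blip_cst c : blip (fun=> c).
Proof.
exists `|c|, 0; split=> //.
by move=> x y; rewrite subrr normr0 mul0r.
Qed.

Lemma blipD f g : blip f -> blip g -> blip (fun x => f x + g x).
Proof.
move=> [M1 [K1 [? ? H1 L1]]] [M2 [K2 [? ? H2 L2]]].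
exists (M1 + M2), (K1 + K2); split; rewrite ?addr_ge0//.
  by move=> x; rewrite (le_trans (ler_normD _ _))// lerD.
move=> x y; rewrite opprD addrACA (le_trans (ler_normD _ _))//.
by rewrite mulrDl lerD.
Qed.

Lemma blipM f g : blip f -> blip g -> blip (fun x => f x * g x).
Proof.
move=> [M1 [K1 [? ? H1 L1]]] [M2 [K2 [? ? H2 L2]]].
exists (M1 * M2), (M1 * K2 + K1 * M2); split; rewrite ?addr_ge0 ?mulr_ge0//.
  by move=> x; rewrite normrM ler_pM.
move=> x y.
have -> : f x * g x - f y * g y = f x * (g x - g y) + (f x - f y) * g y by ring.
rewrite (le_trans (ler_normD _ _))// !normrM mulrDl lerD//.
  by rewrite -mulrA ler_pM.
by rewrite mulrAC ler_pM.
Qed.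

Lemma blip_shift f c : blip f -> blip (fun x => f (x + c)).
Proof.
move=> [M [K [? ? H L]]]; exists M, K; split=> // x y.
by apply: (le_trans (L _ _)); rewrite opprD addrACA subrr addr0.
Qed.

Lemma blip_sum n (f : 'I_n -> R -> R) : (forall i, blip (f i)) ->
  blip (fun x => \sum_i f i x).
Proof.
elim: n f => [|n IH] f bf.
  by under eq_fun do rewrite big_ord0; exact: blip_cst.
under eq_fun do rewrite big_ord_recr/=.
by apply: blipD => //; apply: IH.
Qed.

Lemma blip_cont f : blip f -> continuous f.
Proof.
move=> [M [K [M0 K0 H L]]] x; apply/cvgrPdist_lt => e e0.
have K1 : 0 < K + 1 by rewrite ltr_wpDl.
near=> y; apply: (le_lt_trans (L _ _)).
apply: (@le_lt_trans _ _ ((K + 1) * `|x - y|)).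
  by rewrite ler_wpM2r// lerDl.
rewrite mulrC -ltr_pdivlMr//; near: y.
by apply: cvgr_dist_lt; rewrite ?divr_gt0.
Unshelve. all: by end_near. Qed.

End Blip.

Section Density.
Context {R : realType}.
Implicit Types (f g h : R -> R) (x y e M : R).
Notation mu := (@lebesgue_measure R).

Definition csupp f := exists r : R, 0 < r /\ forall x, r < `|x| -> f x = 0.

Lemma supp_itgb h x y : measurable_fun setT h -> (forall t, ~~ (x <= t <= y) -> h t = 0) ->
  itgb `[x, y] h -> itgb setT h.
Proof.
move=> mh h0 ih.
have e : (EFin \o h) \_ `[x, y] = EFin \o h.
  apply/funext => t; rewrite patchE; case: ifPn => // tn.
  by rewrite /= h0//; move: tn; rewrite notin_setE/= in_itv/= => /negP.
rewrite /itgb -e.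
have mI : measurable (`[x, y]%classic : set (measurableTypeR R)) by exact: measurable_itv.
by have [H _] := @integrable_mkcond _ (measurableTypeR R) R mu _ (EFin \o h) mI; exact: H.
Qed.

Lemma supp_Rint h x y : (forall t, ~~ (x <= t <= y) -> h t = 0) ->
  \int[mu]_t h t = \int[mu]_(t in `[x, y]) h t.
Proof.
move=> h0; rewrite [RHS]Rintegral_mkcond; apply: eq_Rintegral => t _.
rewrite patchE; case: ifPn => // tn.
by rewrite h0//; move: tn; rewrite notin_setE/= in_itv/= => /negP.
Qed.

Lemma L2r_blip f : blip f -> csupp f -> L2r f.
Proof.
move=> bf [r [r0 fr]]; have cf := blip_cont bf.
have mf : measurable_fun setT f by exact: continuous_measurable_fun.
split=> //; apply: (@supp_itgb _ (- r) r).
- exact: measurable_funX.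
- by move=> t; rewrite -ler_norml -ltNge => /fr ->; rewrite expr0n.
- by apply: cont_itgb => x; apply: cvgM; exact: cf.
Qed.

Lemma L2rB f g : L2r f -> L2r g -> L2r (fun x => f x - g x).
Proof.
move=> [mf if2] [mg ig2]; split; first exact: measurable_funB.
apply: (@itgb_le _ _ _ (fun x => 2 * f x ^+ 2 + 2 * g x ^+ 2)) => //.
- by apply: measurable_funX; exact: measurable_funB.
- move=> x _; rewrite ger0_norm ?sqr_ge0//.
  by have := sqr_ge0 (f x + g x); nra.
- by apply: itgbD => //; exact: itgbZ.
Qed.

Lemma int_sqB_le f g h : L2r f -> L2r g -> L2r h ->
  \int[mu]_x (f x - g x) ^+ 2 <=
  2 * \int[mu]_x (f x - h x) ^+ 2 + 2 * \int[mu]_x (h x - g x) ^+ 2.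
Proof.
move=> f2 g2 h2.
have [_ i1] := L2rB f2 h2; have [_ i2] := L2rB h2 g2; have [_ i3] := L2rB f2 g2.
rewrite -!RintegralZl// -RintegralD//; [|exact: itgbZ..].
apply: le_Rintegral => //; first by apply: itgbD => //; exact: itgbZ.
by move=> x _; have := sqr_ge0 ((f x - h x) - (h x - g x)); nra.
Qed.

Lemma dct_sq (u : nat -> R -> R) f (G : R -> R) :
  (forall n, measurable_fun setT (u n)) -> measurable_fun setT f -> itgb setT G ->
  (forall n x, (f x - u n x) ^+ 2 <= G x) ->
  {ae mu, forall x, u n x @[n --> \oo] --> f x} ->
  forall e, 0 < e -> exists n, \int[mu]_x (f x - u n x) ^+ 2 <= e.
Proof.
move=> mu_ mf iG domG cv e e0.
pose v (n : nat) x : \bar R := ((f x - u n x) ^+ 2)%:E.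
have mv n : measurable_fun setT (v n).
  by apply/measurable_EFinP/measurable_funX/measurable_funB.
have cv0 : {ae mu, forall x, setT x -> v ^~ x @ \oo --> (cst 0%E) x}.
  apply: filterS cv; first exact: (ae_filter_ringOfSetsType mu).
  move=> x cx _.
  have H : (f x - u n x) ^+ 2 @[n --> \oo] --> (f x - f x) ^+ 2.
    have H1 : (f x - u n x) @[n --> \oo] --> f x - f x.
      by apply: cvgB => //; exact: cvg_cst.
    by apply: cvgM.
  rewrite subrr expr0n/= in H.
  by apply: cvg_EFin; first exact: nearW.
have dom : {ae mu, forall x n, setT x -> (`|v n x| <= (EFin \o G) x)%E}.
  by apply: aeW => x n _; rewrite /v /= lee_fin ger0_norm ?sqr_ge0.
have mc : measurable_fun setT (cst 0%E : R -> \bar R) by exact: measurable_cst.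
have [_ _ H] := @dominated_convergence _ _ _ mu setT measurableT v (cst 0%E)
  (EFin \o G) mv mc cv0 iG dom.
have {}H : fine (\int[mu]_x v n x)%E @[n --> \oo] --> 0.
  by rewrite integral0 in H; exact: fine_cvg.
have /cvgr0Pnorm_le/(_ e e0)[n _ Hn] := H.
exists n; apply: le_trans (ler_norm _) _; exact: (Hn n (leqnn n)).
Qed.

Lemma truncate_approx f e : L2r f -> 0 < e -> exists h M,
  [/\ 0 < M, measurable_fun setT h & forall x, `|h x| <= M] /\
  [/\ forall x, M < `|x| -> h x = 0, L2r h & \int[mu]_x (f x - h x) ^+ 2 <= e].
Proof.
move=> [mf if2] e0.
pose A (n : nat) : set (measurableTypeR R) := `[(- n.+1%:R), n.+1%:R]%classic `&` f @^-1` `[(- n.+1%:R), n.+1%:R]%classic.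
have mA n : measurable (A n).
  apply: measurableI => //; rewrite -[X in measurable X]setTI.
  exact: mf.
pose u (n : nat) := f \_ (A n).
have mu_ n : measurable_fun setT (u n).
  apply/measurable_restrict => //; rewrite setTI.
  exact: measurable_funTS.
have uP n x : u n x = 0 \/ (u n x = f x /\ `|x| <= n.+1%:R /\ `|f x| <= n.+1%:R).
  rewrite /u patchE; case: ifPn => [|_]; last by left.
  rewrite inE => -[]; rewrite /= !in_itv/= => h1 h2; right; split=> //.
  by rewrite !ler_norml.
have domu n x : (f x - u n x) ^+ 2 <= f x ^+ 2.
  have [->|[-> _]] := uP n x; first by rewrite subr0.
  by rewrite subrr expr0n/= sqr_ge0.
have cvu : {ae mu, forall x, u n x @[n --> \oo] --> f x}.
  apply: aeW => x; apply: cvg_near_cst.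
  have [n nx] : exists n : nat, Num.max `|x| `|f x| < n%:R.
    exists (Num.bound (Num.max `|x| `|f x|)); apply: archi_boundP.
    by rewrite le_max normr_ge0.
  exists n => // m /= nm; rewrite /u patchE ifT// inE /A; split; rewrite /= in_itv/= -ler_norml.
    apply: le_trans (_ : `|x| <= n%:R) _; last by rewrite ler_nat (leq_trans nm).
    by apply: le_trans (ltW nx); rewrite le_max lexx.
  apply: le_trans (_ : `|f x| <= n%:R) _; last by rewrite ler_nat (leq_trans nm).
  by apply: le_trans (ltW nx); rewrite le_max lexx orbT.
have [n Hn] := dct_sq mu_ mf if2 domu cvu e0.
exists (u n), n.+1%:R; split; split=> //.
- exact: (mu_ n).
- by move=> x; have [->|[-> [_ ->]]] := uP n x; rewrite ?normr0.
- by move=> x nx; have [->//|[_ [xn _]]] := uP n x; move: nx; rewrite ltNge xn.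
- split; first exact: (mu_ n).
  apply: (@itgb_le _ _ _ (fun x => f x ^+ 2)) => //.
    exact: measurable_funX.
  move=> x _; rewrite ger0_norm ?sqr_ge0//.
  by have [->|[-> _]] := uP n x; rewrite ?expr0n/= ?sqr_ge0.
Qed.

Lemma seg_bound h M x y : x <= y -> itgb `[x, y] h -> (forall t, x <= t <= y -> `|h t| <= M) ->
  `|\int[mu]_(t in `[x, y]) h t| <= M * (y - x).
Proof.
rewrite le_eqVlt => /predU1P[->|xy] ih hM.
  by rewrite set_itv1 Rintegral_set1 normr0 subrr mulr0.
have ic : itgb `[x, y] (fun=> 1 : R) by apply: cont_itgb => t; exact: cvg_cst.
rewrite -Rint1_seg// -RintegralZl//.
apply: (le_trans (le_normr_Rintegral _ ih)) => //.
apply: le_Rintegral => //; first exact: itgb_norm.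
  exact: itgbZ.
by move=> t; rewrite /= in_itv/= mulr1 => /hM.
Qed.

(** Steklov means: [phi n] is a difference quotient of the primitive [H]. It is Lipschitz because
    [H] is, and it tends to [h] almost everywhere by Lebesgue's differentiation theorem. *)
Lemma mollify_approx h M e : 0 < M -> measurable_fun setT h -> (forall x, `|h x| <= M) ->
  (forall x, M < `|x| -> h x = 0) -> L2r h -> 0 < e ->
  exists phi, [/\ blip phi, csupp phi & \int[mu]_x (h x - phi x) ^+ 2 <= e].
Proof.
move=> M0 mh hM hs [_ ih2] e0.
have ih : itgb setT h.
  apply: (@supp_itgb _ (- M) M) => //.
    by move=> t; rewrite -ler_norml -ltNge => /hs.
  by apply: (@seg_bounded_itgb _ _ _ _ M) => //; exact: measurable_funTS.
pose H x := \int[mu]_(t in `]-oo, x]) h t.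
have Hd x y : x <= y -> H y - H x = \int[mu]_(t in `[x, y]) h t.
  move=> xy; rewrite /H (@Rintegral_itvB R h (BInfty _ true) (BRight y) x)//.
  - apply: Rintegral_itv_obnd_cbnd; exact: itgb_sub ih.
  - exact: itgb_sub ih.
have HL x y : `|H x - H y| <= M * `|x - y|.
  wlog xy : x y / x <= y => [W|].
    by have [/W//|/ltW/W] := leP x y; rewrite distrC [`|y - x|]distrC.
  rewrite distrC Hd// [`|x - y|]distrC [`|y - x|]ger0_norm ?subr_ge0//.
  by apply: seg_bound => //; exact: itgb_seg.
pose phi (n : nat) x := n.+1%:R * (H (x + n.+1%:R^-1) - H x).
have n0 (n : nat) : 0 < n.+1%:R :> R by rewrite ltr0n.
have phiM n x : `|phi n x| <= M.
  rewrite /phi normrM [`|n.+1%:R|]ger0_norm ?ler0n//.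
  apply: (@le_trans _ _ (n.+1%:R * (M * n.+1%:R^-1))).
    rewrite ler_pM2l//; apply: (le_trans (HL _ _)).
    by rewrite addrAC subrr add0r ger0_norm// invr_ge0 ltW.
  by rewrite mulrCA mulfV ?gt_eqF// mulr1.
have phi_blip n : blip (phi n).
  exists M, (n.+1%:R * (M + M)); split=> //.
  - exact: ltW.
  - by rewrite mulr_ge0 ?ltW// addr_gt0.
  - move=> x y; rewrite /phi -mulrBr normrM [`|n.+1%:R|]ger0_norm ?ler0n// -mulrA ler_pM2l//.
    have -> : H (x + n.+1%:R^-1) - H x - (H (y + n.+1%:R^-1) - H y) =
      (H (x + n.+1%:R^-1) - H (y + n.+1%:R^-1)) - (H x - H y) by ring.
    rewrite mulrDl (le_trans (ler_normB _ _))// lerD//.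
    by apply: (le_trans (HL _ _)); rewrite opprD addrACA subrr addr0.
have phi0 n x : M + 1 < `|x| -> phi n x = 0.
  move=> Mx; rewrite /phi Hd ?lerDl ?invr_ge0 ?ltW//.
  rewrite (@eq_Rintegral _ _ _ _ _ (fun=> 0)).
    by rewrite Rintegral_cst// mul0r mulr0.
  have i1 : n.+1%:R^-1 <= 1 :> R by rewrite invf_le1// ler1n.
  have far (c t : R) : c <= 1 -> x <= t -> t <= x + c -> M < `|t|.
    move=> c1 xt tx; rewrite ltNge; apply/negP; rewrite ler_norml => /andP[h1 h2].
    by move: Mx; rewrite ltNge => /negP; apply; rewrite ler_norml; apply/andP; split; lra.
  by move=> t /set_mem; rewrite /= in_itv/= => /andP[xt tx]; apply/hs/(far _ _ i1).
(* A common majorant of all the squared errors: the means look at most distance 1 ahead, so they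
   vanish outside [[-(M+1), M+1]]. *)
pose G x : R := if `|x| <= M + 1 then (M + M) ^+ 2 else 0.
have mG : measurable_fun setT G.
  rewrite (_ : G = (fun=> (M + M) ^+ 2) \_ (`[(- (M + 1)), M + 1]%classic : set (measurableTypeR R))).
    by apply/measurable_restrict => //; exact: measurable_cst.
  by apply/funext => x; rewrite /G patchE mem_setE in_itv/= ler_norml.
have iG : itgb setT G.
  apply: (@supp_itgb _ (- (M + 1)) (M + 1)) => //.
    by move=> t; rewrite -ler_norml /G => /negbTE ->.
  apply: (@seg_bounded_itgb _ _ _ _ ((M + M) ^+ 2)); first exact: measurable_funTS.
  move=> x _; rewrite /G; case: ifP => _; last by rewrite normr0 sqr_ge0.
  by rewrite ger0_norm// sqr_ge0.
have cv : {ae mu, forall x, phi n x @[n --> \oo] --> h x}.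
  have loc : locally_integrable setT h.
    have := @integrable_locally R h setT measurableT ih.
    by rewrite patch_setT.
  have iNy y : itgb `]-oo, y] h by exact: itgb_sub ih.
  have := FTC1Ny iNy loc; apply: filterS; first exact: (ae_filter_ringOfSetsType mu).
  move=> x [dx dxE].
  have hl : r^-1 *: ((H \o shift x) (r *: 1) - H x) @[r --> 0^'] --> 'D_1 H x := dx.
  rewrite -derive1E dxE in hl.
  have t0 : (forall n : nat, n.+1%:R^-1 != 0 :> R) /\ (n.+1%:R^-1 : R) @[n --> \oo] --> (0 : R).
    split; first by move=> n; rewrite invr_eq0 pnatr_eq0.
    exact: cvg_harmonic.
  move/cvgr_dnbhsP : hl => /(_ _ t0).
  apply: cvg_trans; apply: near_eq_cvg; apply: nearW => n.
  by rewrite /phi /= invrK /GRing.scale/= mulr1; congr (_ * (H _ - _)); rewrite addrC.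
have mphi n : measurable_fun setT (phi n).
  by apply: continuous_measurable_fun; exact: blip_cont.
have dom n x : (h x - phi n x) ^+ 2 <= G x.
  rewrite /G; case: ifPn => [_|].
    have -> : (h x - phi n x) ^+ 2 = `|h x - phi n x| ^+ 2 by rewrite real_normK// num_real.
    have h1 : `|h x - phi n x| <= M + M.
      by apply: (le_trans (ler_normB _ _)); rewrite lerD.
    by rewrite !expr2 ler_pM.
  rewrite -ltNge => Mx; rewrite phi0// hs ?subrr ?expr0n//.
  by apply: lt_trans Mx; rewrite ltrDl.
have [n Hn] := dct_sq mphi mh iG dom cv e0.
exists (phi n); split=> //; exists (M + 1); split=> //.
  by rewrite addr_gt0.
exact: phi0.
Qed.

Lemma L2_density f e : L2r f -> 0 < e ->
  exists phi, [/\ blip phi, csupp phi & \int[mu]_x (f x - phi x) ^+ 2 <= e].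
Proof.
move=> f2 e0; have e4 : 0 < e / 4 by rewrite divr_gt0.
have [h [M [[M0 mh hM] [hs h2 fh]]]] := truncate_approx f2 e4.
have [phi [b c hphi]] := mollify_approx M0 mh hM hs h2 e4.
exists phi; split=> //.
apply: (le_trans (int_sqB_le f2 (L2r_blip b c) h2)).
by lra.
Qed.

End Density.

(** * The window criterion *)

Section Reduction.
Context {R : realType}.
Implicit Types (f phi : R -> R) (A B : R).
Notation mu := (@lebesgue_measure R).
Variables (g : R -> R) (Cg : R).
Hypothesis cg : continuous g.
Hypothesis gle : forall x, `|g x| <= Cg * gauss_fun x.

(** The frame sum enters only through its finite boxes: [Qle] bounds all of them, and [Qge] puts [A]
    times the energy below every such bound, hence below their supremum. *)
Definition Qle a b f Bd := forall K L, bsum K (fun k => bsum L (fun l => GQ g a b f k l)) <= Bd.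
Definition Qge a b f A := forall Bd, Qle a b f Bd -> A * \int[mu]_t f t ^+ 2 <= Bd.
Definition real_frame a b := exists A B : R, [/\ 0 < A, 0 < B &
  forall f, L2r f -> Qle a b f (B * \int[mu]_t f t ^+ 2) /\ Qge a b f A].

Variables (a b : R).
Hypotheses (a0 : 0 < a) (b0 : 0 < b).

Lemma GQ_le2 f phi k l : L2r f -> L2r phi ->
  GQ g a b phi k l <= 2 * GQ g a b f k l + 2 * GQ g a b (fun x => f x - phi x) k l.
Proof.
move=> f2 p2; have fp2 := L2rB f2 p2.
have EC : GC g a b (fun x => f x - phi x) k l = GC g a b f k l - GC g a b phi k l.
  rewrite /GC -RintegralB//; [|exact: (GC_itgb cg gle)..].
  by apply: eq_Rintegral => t _; ring.
have ES : GS g a b (fun x => f x - phi x) k l = GS g a b f k l - GS g a b phi k l.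
  rewrite /GS -RintegralB//; [|exact: (GS_itgb cg gle)..].
  by apply: eq_Rintegral => t _; ring.
rewrite /GQ EC ES.
set x := GC _ _ _ f _ _; set y := GC _ _ _ phi _ _.
set z := GS _ _ _ f _ _; set w := GS _ _ _ phi _ _.
by have := sqr_ge0 (2 * x - y); have := sqr_ge0 (2 * z - w); nra.
Qed.

Lemma density_arith (A0 B0 If Ip D Bd e : R) : A0 * Ip <= 2 * Bd + 2 * (B0 * e) ->
  A0 * If <= A0 * (2 * Ip + 2 * D) -> A0 * D <= A0 * e ->
  A0 / 4 * If <= Bd + (A0 / 2 + B0) * e.
Proof. by nra. Qed.

(** The upper bound, already known for all of L^2, controls the frame sum of the error [f - phi];
    two uses of the factor 2 in squaring a sum turn [A] into [A / 4]. *)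
Lemma frame_from_dense A : 0 < A ->
  (forall phi, blip phi -> csupp phi -> Qge a b phi A) -> real_frame a b.
Proof.
move=> A0 HA; have [B B0 HB] := upper_bound cg gle a0 b0.
exists (A / 4), B; split=> //; first by rewrite divr_gt0.
move=> f f2; split; first by move=> K L; exact: HB.
move=> Bd QBd; apply/ler_addgt0Pr => e e0.
(* The total loss in [density_arith] is [(A / 2 + B) * e'], made equal to [e]. *)
pose e' := e / (A / 2 + B).
have AB0 : 0 < A / 2 + B by rewrite addr_gt0// divr_gt0.
have e'0 : 0 < e' by rewrite divr_gt0.
have [phi [bp cp fp]] := L2_density f2 e'0.
have p2 := L2r_blip bp cp.
have H1 : Qle a b phi (2 * Bd + 2 * (B * e')).
  move=> K L.
  apply: (@le_trans _ _ (2 * bsum K (fun k => bsum L (fun l => GQ g a b f k l)) +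
     2 * bsum K (fun k => bsum L (fun l => GQ g a b (fun x => f x - phi x) k l)))).
    rewrite -!bsumZ -bsumD; apply: le_bsum => k.
    by rewrite -!bsumZ -bsumD; apply: le_bsum => l; exact: GQ_le2.
  have h1 := QBd K L; have h2 := HB _ K L (L2rB f2 p2).
  have h3 : B * \int[mu]_x (f x - phi x) ^+ 2 <= B * e' by rewrite ler_pM2l.
  by apply: lerD; rewrite ler_wpM2l//; exact: le_trans h2 h3.
have H2 := HA _ bp cp _ H1.
have [_ if2] := f2; have [_ ip2] := p2; have [_ ifp2] := L2rB f2 p2.
have H3 : \int[mu]_t f t ^+ 2 <= 2 * \int[mu]_t phi t ^+ 2 + 2 * \int[mu]_t (f t - phi t) ^+ 2.
  rewrite -!RintegralZl// -RintegralD//; [|exact: itgbZ..].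
  apply: le_Rintegral => //; first by apply: itgbD => //; exact: itgbZ.
  by move=> x _; have := sqr_ge0 (f x - 2 * phi x); nra.
have ee : e = (A / 2 + B) * e' by rewrite /e' mulrCA mulfV ?mulr1// gt_eqF.
have H4 : A * \int[mu]_t f t ^+ 2 <= A * (2 * \int[mu]_t phi t ^+ 2 + 2 * \int[mu]_t (f t - phi t) ^+ 2).
  by rewrite ler_pM2l.
have H5 : A * \int[mu]_t (f t - phi t) ^+ 2 <= A * e' by rewrite ler_pM2l.
by rewrite ee; exact: density_arith H2 H4 H5.
Qed.

End Reduction.

Section CaseI.
Context {R : realType}.
Implicit Types (f phi u : R -> R) (x t : R).
Notation mu := (@lebesgue_measure R).

Lemma Rint_seg_shift (h x y : R) u : continuous u ->
  \int[mu]_(t in `[x + h, y + h]) u t = \int[mu]_(t in `[x, y]) u (t + h).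
Proof.
move=> cu; rewrite [LHS]Rintegral_mkcond [RHS]Rintegral_mkcond.
have mI : measurable (`[x + h, y + h]%classic : set (measurableTypeR R)) by exact: measurable_itv.
have iu : itgb setT (u \_ `[x + h, y + h]).
  apply: (@supp_itgb _ _ (x + h) (y + h)).
  - apply/measurable_restrict => //; apply: measurable_funTS.
    exact: continuous_measurable_fun.
  - move=> t tn; rewrite patchE ifF//; apply/negbTE; move: tn; apply: contra.
    by rewrite mem_setE in_itv.
  - have := cont_itgb (x + h) (y + h) cu.
    rewrite /itgb; apply: eq_integrable => // t tI.
    by rewrite /= patchE tI.
rewrite -(Rint_shift h iu); apply: eq_Rintegral => t _.
by rewrite !patchE !mem_setE !in_itv/= !lerD2r.
Qed.

Lemma Rint_sq_mono (s : set (measurableTypeR R)) u : measurable s -> itgb setT (fun t => u t ^+ 2) ->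
  \int[mu]_(t in s) u t ^+ 2 <= \int[mu]_t u t ^+ 2.
Proof.
move=> ms iu; rewrite -lee_fin -!itgb_fin//; last exact: itgb_sub iu.
apply: ge0_subset_integral => //.
- by apply/measurable_EFinP; exact: itgb_mfun iu.
- by move=> x _; rewrite lee_fin sqr_ge0.
Qed.

(** Expanding the nonnegative sum of [eps m * (z m - A)^2], with [A] the weighted sum itself, gives
    S - 2 A^2 + A^2 / 2 >= 0, where S is the sum on the right; hence 2/3. The weights may vanish
    here, as [eps 0] does, unlike in [weighted_CS]. *)
Lemma eps_CS N (eps z : int -> R) : (forall m, 0 <= eps m) -> bsum N eps <= 2^-1 ->
  bsum N (fun m => eps m * z m) ^+ 2 <= 2 / 3 * bsum N (fun m => eps m * z m ^+ 2).
Proof.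
move=> e0 e2.
set A := bsum N (fun m => _ * z m).
have : 0 <= bsum N (fun m => eps m * (z m - A) ^+ 2).
  by apply: bsum_ge0 => m; rewrite mulr_ge0 ?sqr_ge0.
rewrite (@eq_bsum _ N _ (fun m => eps m * z m ^+ 2 + (- (2 * A)) * (eps m * z m) + A ^+ 2 * eps m)); last first.
  by move=> m; ring.
rewrite !bsumD !bsumZ -/A.
have : A ^+ 2 * bsum N eps <= A ^+ 2 * 2^-1 by rewrite ler_wpM2l ?sqr_ge0.
by move=> *; nra.
Qed.

Lemma seg_arith (r x nx u a t : R) : r + nx <= u -> x <= nx -> - x <= nx -> 0 < a ->
  - r <= t <= r -> x - u <= t <= x + (u + a).
Proof. by move=> ? ? ? ? /andP[? ?]; apply/andP; split; lra. Qed.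

Lemma bsum_rem0 N (F : int -> R) :
  bsum N F = F 0 + bsum N (fun m => if m == 0 then 0 else F m).
Proof.
elim: N => [|n IH]; first by rewrite /bsum !big_ord1 /= subrr addr0.
by rewrite !bsumS IH /= !addrA.
Qed.

Lemma bsum_term N (F : int -> R) k : (forall l, 0 <= F l) -> (`|k| <= N)%N ->
  F k <= bsum N F.
Proof.
move=> F0 kN; have iN : (`|(k + N%:Z)%R| < N.*2.+1)%N by lia.
rewrite /bsum (bigD1 (Ordinal iN))//=.
have -> : (`|(k + N%:Z)%R|%N : int) - N%:Z = k by lia.
by rewrite lerDl sumr_ge0.
Qed.

Variables (g : R -> R) (Cg : R).
Hypothesis bg : blip g.
Hypothesis gle : forall x, `|g x| <= Cg * gauss_fun x.
Variables (a b : R).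
Hypotheses (a0 : 0 < a) (b0 : 0 < b) (ab1 : a <= b^-1).
Variables (X kap : R) (eps : int -> R).
Hypothesis kap0 : 0 < kap.
Hypothesis eps_ge0 : forall m, 0 <= eps m.
Hypothesis eps0 : eps 0 = 0.
Hypothesis eps_sum : forall N, bsum N eps <= 2^-1.
Hypothesis window : forall x, X <= x <= X + a -> kap <= `|g x|.
Hypothesis alias : forall m x, m != 0 -> X <= x <= X + a ->
  `|g (x + m%:~R / b)| <= eps m * `|g x|.

Let cg : continuous g. Proof. exact: blip_cont. Qed.
Let P := b^-1.
Let P0 : 0 < P. Proof. by rewrite invr_gt0. Qed.

(** A truncated periodization with period [1/b]; for [f] of compact support and [N] large it
    captures every nonzero term. *)
Let Fk f N k t := bsum N (fun m => f (t + m%:~R * P) * g (t + m%:~R * P - a * k%:~R)).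

Let Fk_blip f N k : blip f -> blip (Fk f N k).
Proof.
move=> bf; apply: blip_sum => i; apply: blipM; first exact: blip_shift.
under eq_fun do rewrite -addrA.
exact: blip_shift.
Qed.

(** On the [k]-th window the unshifted term dominates: |Fk| >= |g x| (|f t| - Bq), where [Bq]
    gathers the aliases. Then (|f| - Bq)^2 >= f^2 / 2 - Bq^2, which is (|f| - 2 Bq)^2 >= 0, and
    [eps_CS] bounds [Bq^2]. If the left side is nonpositive there is nothing to do. *)
Let Fk_low f N k t : X + a * k%:~R <= t <= X + a * k%:~R + a ->
  kap ^+ 2 * (2^-1 * f t ^+ 2 - 2 / 3 * bsum N (fun m => eps m * f (t + m%:~R * P) ^+ 2)) <= Fk f N k t ^+ 2.
Proof.
move=> tI; pose x := t - a * k%:~R.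
have xI : X <= x <= X + a by rewrite /x; lra.
set S := bsum N _.
pose z m := `|f (t + m%:~R * P)|.
have SE : S = bsum N (fun m => eps m * z m ^+ 2).
  by apply: eq_bsum => m; rewrite /z real_normK// num_real.
have S0 : 0 <= S by apply: bsum_ge0 => m; rewrite mulr_ge0 ?sqr_ge0.
pose Bq := bsum N (fun m => eps m * z m).
have Bq0 : 0 <= Bq by apply: bsum_ge0 => m; rewrite mulr_ge0 /z.
have HB : Bq ^+ 2 <= 2 / 3 * S by rewrite SE; apply: eps_CS.
have gx0 := window xI.
have [fS|fS] := leP (2^-1 * f t ^+ 2) (2 / 3 * S).
  apply: le_trans (sqr_ge0 _).
  by rewrite mulr_ge0_le0 ?sqr_ge0// subr_le0.
have FE : Fk f N k t = f t * g x + bsum N (fun m => if m == 0 then 0 else f (t + m%:~R * P) * g (x + m%:~R * P)).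
  rewrite /Fk.
  rewrite bsum_rem0 mul0r addr0; congr (_ + _); apply: eq_bsum => m.
  by case: ifP => // _; rewrite /x addrAC.
have rem : `|bsum N (fun m => if m == 0 then 0 else f (t + m%:~R * P) * g (x + m%:~R * P))| <= `|g x| * Bq.
  apply: (le_trans (ler_norm_sum _ _ _)); rewrite -bsumZ.
  apply: ler_sum => i _; set m := (i%:Z - N%:Z).
  case: eqP => [->|/eqP m0]; first by rewrite normr0 eps0 mul0r mulr0.
  rewrite normrM; have := alias m0 xI; rewrite -/P => h.
  apply: (le_trans (ler_wpM2l (normr_ge0 _) h)).
  by rewrite -/(z m) le_eqVlt; apply/orP; left; apply/eqP; ring.
have low : `|g x| * (`|f t| - Bq) <= `|Fk f N k t|.
  rewrite FE; set r := bsum N _ in rem *.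
  have := ler_normB (f t * g x + r) r; rewrite addrK normrM => h.
  by lra.
have fB : Bq < `|f t|.
  rewrite ltNge; apply/negP => h.
  have : `|f t| ^+ 2 <= Bq ^+ 2 by rewrite lerXn2r ?nnegrE.
  by rewrite real_normK ?num_real//; nra.
rewrite -[leRHS]real_normK ?num_real//.
apply: (@le_trans _ _ ((kap * (`|f t| - Bq)) ^+ 2)); last first.
  rewrite lerXn2r ?nnegrE ?mulr_ge0 ?subr_ge0 ?(ltW kap0) ?(ltW fB)//.
  by apply: le_trans low; rewrite ler_wpM2r// subr_ge0 ltW.
rewrite exprMn ler_wpM2l ?sqr_ge0//.
have := sqr_ge0 (`|f t| - 2 * Bq); rewrite -[f t ^+ 2]real_normK ?num_real//.
by nra.
Qed.

(** The two inequalities say that the tiles cover the support of [f]. Folding them onto one period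
    leaves the trigonometric factor unchanged, so Gabor coefficients are Fourier coefficients of
    [Fk]. Stated for an abstract [trig] to serve cosine and sine. *)
Let coefE f N k l r (trig : R -> R) : blip f -> (forall x, r < `|x| -> f x = 0) ->
  continuous trig -> (forall x, `|trig x| <= 1) ->
  (forall x (m : int), trig (x + 2 * pi * m%:~R) = trig x) ->
  X + a * k%:~R - N%:R * P <= - r -> r <= X + a * k%:~R + N.+1%:R * P ->
  \int[mu]_t (f t * g (t - a * k%:~R) * trig (2 * pi * b * l%:~R * t)) =
  \int[mu]_(t in `[X + a * k%:~R, X + a * k%:~R + P])
    (Fk f N k t * trig (2 * pi / P * l%:~R * t)).
Proof.
move=> bf fr ct t1 tz h1 h2; have f2 : L2r f.
  apply: L2r_blip bf _; exists (Num.max r 1); split; first by rewrite lt_max ltr01 orbT.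
  by move=> x; rewrite gt_max => /andP[/fr].
have ctl : continuous (fun t => trig (2 * pi * b * l%:~R * t)).
  move=> x; apply: continuous_comp; last exact: ct.
  by apply: cvgM; [exact: cvg_cst|exact: cvg_id].
set h := fun t => _.
have ih : itgb setT h.
  by apply: (bounded_itgbM (fg_itgb cg gle _ f2)) => // x; exact: t1.
have ch : continuous h.
  move=> x; apply: cvgM; last exact: ctl.
  apply: cvgM; first exact: blip_cont.
  apply: continuous_comp; last exact: cg.
  by apply: cvgB; [exact: cvg_id|exact: cvg_cst].
set t0 := X + a * k%:~R in h1 h2 *.
rewrite (@supp_Rint _ h (t0 - N%:R * P) (t0 + N.+1%:R * P)); last first.
  move=> t tn; rewrite /h fr ?mul0r//; move: tn; apply: contraR.
  by rewrite -leNgt ler_norml => /andP[? ?]; apply/andP; split; lra.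
rewrite tile_sum//; last by move=> x y; exact: itgb_seg.
rewrite (@eq_bsum _ N _ (fun m => \int[mu]_(t in `[t0, t0 + P]) h (t + m%:~R * P))); last first.
  by move=> m; rewrite -Rint_seg_shift// (addrAC t0).
rewrite /bsum -Rint_sum//; last first.
  move=> i _; apply: cont_itgb => x.
  apply: (@continuous_comp _ _ _ (fun x => x + (i%:Z - N%:Z)%:~R * P) h); last exact: ch.
  by apply: cvgD; [exact: cvg_id|exact: cvg_cst].
apply: eq_Rintegral => t _; rewrite /Fk /bsum mulr_suml.
apply: eq_bigr => i _; set m := (i%:Z - N%:Z); rewrite /h.
congr (_ * _).
rewrite -(tz (2 * pi / P * l%:~R * t) (l * m)); congr trig.
by rewrite intrM /P; field; rewrite gt_eqF.
Qed.

Theorem caseI : real_frame g a b.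
Proof.
have kap20 : 0 < kap ^+ 2 by rewrite exprn_gt0.
(* 1/6 is 1/2 - (2/3) (1/2): the main term of [Fk_low] minus the aliases, whose total weight is at
   most 1/2. *)
apply: (@frame_from_dense _ _ _ cg gle _ _ a0 b0 (P * (kap ^+ 2 / 6))).
  by rewrite mulr_gt0// divr_gt0.
move=> f bf cf Bd QB; have f2 := L2r_blip bf cf; have [mf if2] := f2.
have [r [r0 fr]] := cf.
pose q k L := bsum L (fun l => GQ g a b f k l).
have GQ0 k l : 0 <= GQ g a b f k l by rewrite addr_ge0 ?sqr_ge0.
have q0 k L : 0 <= q k L by apply: bsum_ge0.
have qB k L : q k L <= Bd.
  by apply: le_trans (QB `|k|%N L); apply: (bsum_term (F := q ^~ L)).
have qnd k : nondecreasing_seq (q k).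
  by apply/nondecreasing_seqP => L; rewrite /q bsumS -addrA lerDl addr_ge0.
(* Parseval for a fixed [k] needs all frequencies, so [L] goes to infinity before the sum over [k]
   is estimated. *)
have qcv k : cvg (q k n @[n --> \oo]).
  by apply: nondecreasing_is_cvgn => //; exists Bd => _ [L _ <-].
have qlim k L : q k L <= limn (q k) by exact: nondecreasing_cvgn_le.
have sumlim K : bsum K (fun k => limn (q k)) <= Bd.
  have cv : bsum K (fun k => q k L) @[L --> \oo] --> bsum K (fun k => limn (q k)).
    by apply: cvg_bigsum => i; exact: qcv.
  by apply: (cvgr_to_le cv); apply: nearW => L; exact: QB.
have arch (x : R) : exists n : nat, x <= n%:R.
  by exists (Num.bound `|x|); rewrite (le_trans (ler_norm x))// ltW// archi_boundP.
(* [K] makes the windows with |k| <= K cover the support of [f]; [N] makes the tiles around each of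
   these windows cover it too. *)
have [K HK] := arch ((r + `|X|) / a).
have [N HN] := arch ((r + `|X| + a * K%:R) / P).
have {}HK : r + `|X| <= K%:R * a by rewrite -ler_pdivrMr.
have {}HN : r + `|X| + a * K%:R <= N%:R * P by rewrite -ler_pdivrMr.
have X1 := ler_norm X; have X2 := ler_norm (- X); rewrite normrN in X2.
pose T k := X + a * k%:~R.
have inr (k : int) : (`|k| <= K)%N -> - (a * K%:R) <= a * k%:~R <= a * K%:R.
  move=> kK; rewrite -mulrN !ler_pM2l// [K%:R]pmulrn -rmorphN/= !ler_int.
  by move: kK; clear; lia.
have step1 (k : int) : (`|k| <= K)%N ->
    P * \int[mu]_(t in `[T k, T k + P]) Fk f N k t ^+ 2 <= limn (q k).
  move=> kK; have /andP[k1 k2] := inr k kK.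
  have [M [Lp [M0 L0 HM HL]]] := Fk_blip N k bf.
  have NP : 0 <= P by exact: ltW.
  have N1 : N.+1%:R * P = N%:R * P + P by rewrite -natr1 mulrDl mul1r.
  apply: (@parseval_lower _ (T k) P P0 _ M Lp) => //.
    by apply: measurable_funTS; apply: continuous_measurable_fun; exact/blip_cont/Fk_blip.
  move=> L; apply: le_trans (qlim k L); rewrite /q.
  apply: le_bsum => l; rewrite /GQ /GC /GS.
  rewrite (@coefE f N k l r cos)//; first rewrite (@coefE f N k l r sin)//.
  - exact: continuous_sin.
  - by move=> x; exact: sin_max.
  - by move=> x m; exact: sinz.
  - by lra.
  - by lra.
  - exact: continuous_cos.
  - by move=> x; exact: cos_max.
  - by move=> x m; exact: cosz.
  - by lra.
  - by lra.
pose u t := kap ^+ 2 * (2^-1 * f t ^+ 2 - 2 / 3 * bsum N (fun m => eps m * f (t + m%:~R * P) ^+ 2)).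
have ifs m : itgb setT (fun t => f (t + m%:~R * P) ^+ 2).
  exact: (@itgb_shift _ (m%:~R * P) _ if2).
have iS : itgb setT (fun t => bsum N (fun m => eps m * f (t + m%:~R * P) ^+ 2)).
  by apply: itgb_sum => // i _; exact: itgbZ.
have iu : itgb setT u by apply: itgbZ => //; apply: itgbB => //; exact: itgbZ.
have step2 k : \int[mu]_(t in `[X + k%:~R * a, X + k%:~R * a + a]) u t <=
    \int[mu]_(t in `[T k, T k + P]) Fk f N k t ^+ 2.
  have iF : itgb `[T k, T k + P] (fun t => Fk f N k t ^+ 2).
    by apply: cont_itgb => x; apply: cvgM; exact/blip_cont/Fk_blip.
  rewrite [k%:~R * a]mulrC -/(T k).
  (* The only place where [a <= 1/b] matters: a window fits in one period. *)
  have sub : `[T k, T k + a] `<=` `[T k, T k + P].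
    by apply: subset_itvl; rewrite bnd_simp lerD2l.
  apply: (@le_trans _ _ (\int[mu]_(t in `[T k, T k + a]) Fk f N k t ^+ 2)).
    apply: le_Rintegral => //; first exact: itgb_seg.
      exact: itgb_sub iF.
    by move=> t; rewrite /= in_itv/= => tI; exact: Fk_low.
  rewrite -lee_fin -!itgb_fin//; last exact: itgb_sub iF.
  apply: ge0_subset_integral => //.
  - by apply/measurable_EFinP; exact: itgb_mfun iF.
  - by move=> x _; rewrite lee_fin sqr_ge0.
have step3 : P * \int[mu]_(t in `[X - K%:R * a, X + K.+1%:R * a]) u t <= Bd.
  rewrite tile_sum//; last by move=> x y; exact: itgb_seg.
  rewrite -bsumZ; apply: le_trans (sumlim K).
  apply: ler_sum => i _; set k := (i%:Z - K%:Z).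
  have kK : (`|k| <= K)%N by rewrite /k; case: i {k} => i /= iK; move: iK; clear; lia.
  by apply: le_trans (step1 k kK); rewrite ler_pM2l//; exact: step2.
apply: le_trans step3; rewrite -mulrA ler_pM2l//.
set W := `[_, _]%classic.
have mW : measurable (W : set (measurableTypeR R)) by exact: measurable_itv.
have isub h : itgb setT h -> itgb W h by move=> ih; apply: itgb_sub ih.
have -> : \int[mu]_(t in W) u t = kap ^+ 2 * (2^-1 * \int[mu]_(t in W) f t ^+ 2 -
   2 / 3 * bsum N (fun m => eps m * \int[mu]_(t in W) f (t + m%:~R * P) ^+ 2)).
  rewrite RintegralZl//; last by apply: isub; apply: itgbB => //; exact: itgbZ.
  rewrite RintegralB//; [|by apply: isub; exact: itgbZ|by apply: isub; exact: itgbZ].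
  rewrite RintegralZl//; last exact: isub.
  rewrite RintegralZl//; last exact: isub.
  rewrite /bsum Rint_sum//; last by move=> i _; apply: isub; exact: itgbZ.
  congr (_ * (_ - _ * _)); apply: eq_bigr => i _.
  by rewrite RintegralZl//; exact: isub.
have -> : \int[mu]_(t in W) f t ^+ 2 = \int[mu]_t f t ^+ 2.
  apply/esym/supp_Rint => t tn; rewrite fr ?expr0n//; move: tn; apply: contraR.
  have K1 : K.+1%:R * a = K%:R * a + a by rewrite -natr1 mulrDl mul1r.
  by rewrite K1 -leNgt ler_norml => tr; exact: seg_arith HK X1 X2 a0 tr.
set I2 := \int[mu]_t f t ^+ 2.
have I20 : 0 <= I2 by apply: Rintegral_ge0 => x _; exact: sqr_ge0.
(* A shifted copy has at most the full energy in [W], whereas the unshifted one has exactly the full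
   energy there. *)
have S2 : bsum N (fun m => eps m * \int[mu]_(t in W) f (t + m%:~R * P) ^+ 2) <= 2^-1 * I2.
  apply: (@le_trans _ _ (bsum N (fun m => I2 * eps m))).
    apply: le_bsum => m; rewrite mulrC ler_wpM2r//.
    apply: (le_trans (Rint_sq_mono mW (ifs m))).
    by rewrite (@Rint_shift _ (m%:~R * P) (fun t => f t ^+ 2)).
  by rewrite bsumZ mulrC ler_wpM2r.
rewrite -mulrA ler_pM2l//.
by lra.
Qed.

End CaseI.

(** * Fourier transform and exchange of the lattice parameters *)

Section TrigLip.
Context {R : realType}.
Implicit Types (x y c : R) (f : R -> R).

Lemma cos_lip x y : `|cos x - cos y| <= `|x - y|.
Proof.
wlog xy : x y / y <= x => [W|].
  by have [/W//|/ltW/W] := leP y x; rewrite distrC [`|y - x|]distrC.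
have [c _ ->] := @df_MVT R cos (fun z => - sin z) _ _ xy (fun z _ => is_derive_cos z).
by rewrite normrM normrN ler_piMl// sin_max.
Qed.

Lemma sin_lip x y : `|sin x - sin y| <= `|x - y|.
Proof. by rewrite -!cosBpihalf; apply: (le_trans (cos_lip _ _)); rewrite opprB addrA subrK. Qed.

Lemma blip_cos c : blip (fun t : R => cos (c * t)).
Proof.
exists 1, `|c|; split=> //; first by move=> x; exact: cos_max.
by move=> x y; apply: (le_trans (cos_lip _ _)); rewrite -mulrBr normrM.
Qed.

Lemma blip_sin c : blip (fun t : R => sin (c * t)).
Proof.
exists 1, `|c|; split=> //; first by move=> x; exact: sin_max.
by move=> x y; apply: (le_trans (sin_lip _ _)); rewrite -mulrBr normrM.
Qed.

Lemma bsum_mono N M (F : int -> R) : (forall l, 0 <= F l) -> (N <= M)%N -> bsum N F <= bsum M F.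
Proof.
move=> F0 /subnK <-; elim: (M - N)%N => [|n IH]; first by rewrite add0n.
by apply: (le_trans IH); rewrite addSn bsumS -addrA lerDl addr_ge0.
Qed.

Lemma bsum_le_lim N (F : int -> R) : (forall l, 0 <= F l) -> cvgn (bsum ^~ F) ->
  bsum N F <= limn (bsum ^~ F).
Proof.
move=> F0 c; apply: (nondecreasing_cvgn_le _ c) => m n; exact: bsum_mono.
Qed.

(** Only the even part of the summand counts over a symmetric range. This is the form in which cross
    terms between cosine and sine coefficients are discarded. *)
Lemma bsum_sym N (F G : int -> R) : (forall l, F l + F (- l) = 2 * G l) ->
  bsum N F = bsum N G.
Proof.
move=> FG; have : 2 * bsum N F = 2 * bsum N G.
  by rewrite -(bsumZ N 2 G) -(eq_bsum N FG) bsumD -bsum_opp; ring.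
by move=> h; lra.
Qed.

Notation mu := (@lebesgue_measure R).

Lemma wide_itgb (u : R -> R) t0 p B : 0 < p -> continuous u -> (forall x, 0 <= u x) ->
  (forall N : nat, \int[mu]_(x in `[t0 - N%:R * p, t0 + N.+1%:R * p]) u x <= B) ->
  itgb setT u.
Proof.
move=> p0 cu u0 HB.
pose I (N : nat) : set (measurableTypeR R) := `[t0 - N%:R * p, t0 + N.+1%:R * p]%classic.
have mI N : measurable (I N) by exact: measurable_itv.
pose fN (N : nat) x : \bar R := ((u \_ (I N)) x)%:E.
have mu_ : measurable_fun setT u by exact: continuous_measurable_fun.
have mfN N : measurable_fun setT (fN N).
  apply/measurable_EFinP; apply/measurable_restrict => //; first exact: mI.
  by rewrite setTI; exact: measurable_funS mu_.
apply/integrableP; split; first exact/measurable_EFinP.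
have -> : (\int[mu]_x `|(EFin \o u) x| = \int[mu]_x limn_einf (fN ^~ x))%E.
  apply: eq_integral => x _; rewrite /= ger0_norm//.
  have c : fN ^~ x @ \oo --> (u x)%:E.
    apply: cvg_near_cst.
    have [n nx] : exists n : nat, `|x - t0| / p < n%:R.
      by exists (Num.bound (`|x - t0| / p)); apply: archi_boundP; rewrite divr_ge0// ltW.
    exists n => // m /= nm; rewrite /fN patchE ifT// inE /I/= in_itv/=.
    have : `|x - t0| <= m%:R * p.
      by rewrite -ler_pdivrMr//; apply: (le_trans (ltW nx)); rewrite ler_nat.
    rewrite ler_norml -natr1 mulrDl mul1r => /andP[]; lra.
  by rewrite is_cvg_limn_einfE; [apply/esym/cvg_lim|apply/cvg_ex; exists (u x)%:E].
apply: (@le_lt_trans _ _ B%:E); last exact: ltry.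
apply: (le_trans (fatou mu measurableT mfN _)).
  by move=> N x _; rewrite /fN lee_fin patchE; case: ifP.
apply: limn_einf_ub => N.
have -> : (\int[mu]_x fN N x = \int[mu]_(x in I N) (u x)%:E)%E.
  by rewrite [RHS]integral_mkcond; apply: eq_integral => x _; rewrite /fN !patchE; case: ifP.
by rewrite itgb_fin ?lee_fin//; [exact: HB|exact: cont_itgb].
Qed.

End TrigLip.

(** * Plancherel's inequality for Lipschitz functions of compact support *)

Section FourierTransform.
Context {R : realType}.
Implicit Types (x t om : R).
Notation mu := (@lebesgue_measure R).
Variable f : R -> R.
Hypotheses (bf : blip f) (cf : csupp f).

(** For real [f], the Fourier transform at [om] is [Cw om - i Sw om]. *)
Definition Cw om := \int[mu]_t (f t * cos (2 * pi * om * t)).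
Definition Sw om := \int[mu]_t (f t * sin (2 * pi * om * t)).

Let f2 : L2r f. Proof. exact: L2r_blip. Qed.
Let fc : continuous f. Proof. exact: blip_cont. Qed.

Lemma f_itgb : itgb setT f.
Proof.
have [r [r0 fr]] := cf; apply: (@supp_itgb _ f (- r) r).
- exact: continuous_measurable_fun.
- by move=> t; rewrite -ler_norml -ltNge => /fr.
- exact: cont_itgb.
Qed.

Let wave_blip (trig : R -> R) : (forall x y, `|trig x - trig y| <= `|x - y|) ->
  (forall x, `|trig x| <= 1) -> blip (fun om => \int[mu]_t (f t * trig (2 * pi * om * t))).
Proof.
move=> tl t1; have [r [r0 fr]] := cf; have [M [K [M0 K0 HM HL]]] := bf.
have ctrig : continuous trig.
  move=> x; apply/cvgrPdist_lt => e e0; near=> y.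
  by apply: (le_lt_trans (tl _ _)); near: y; exact: cvgr_dist_lt.
have cft om : continuous (fun t => f t * trig (2 * pi * om * t)).
  move=> x; apply: cvgM; first exact: fc.
  apply: (@continuous_comp _ _ _ (fun t => 2 * pi * om * t) trig); last exact: ctrig.
  by apply: cvgM; [exact: cvg_cst|exact: cvg_id].
have E om : \int[mu]_t (f t * trig (2 * pi * om * t)) =
    \int[mu]_(t in `[(- r), r]) (f t * trig (2 * pi * om * t)).
  by apply: supp_Rint => t; rewrite -ler_norml -ltNge => /fr ->; rewrite mul0r.
have rr : - r <= r by rewrite ge0_cp// ltW.
have r2 : 0 <= r - - r by rewrite subr_ge0.
have pi0 := @pi_gt0 R.
exists (M * (r - - r)), (M * (2 * pi * r) * (r - - r)); split.
- by rewrite mulr_ge0.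
- by rewrite !mulr_ge0// ltW.
- move=> om; rewrite E; apply: seg_bound => //; first exact: cont_itgb.
  by move=> t _; rewrite normrM -[leRHS]mulr1 ler_pM.
- move=> x y; rewrite !E -RintegralB//; [|exact: cont_itgb..].
  have -> : M * (2 * pi * r) * (r - - r) * `|x - y| = M * (2 * pi * r) * `|x - y| * (r - - r) by ring.
  apply: seg_bound => //.
    by apply: itgbB => //; exact: cont_itgb.
  move=> t; rewrite -ler_norml => tr.
  have -> : M * (2 * pi * r) * `|x - y| = M * ((2 * pi * r) * `|x - y|) by ring.
  rewrite -mulrBr normrM ler_pM//.
  apply: (le_trans (tl _ _)); rewrite -mulrBl -mulrBr 2!normrM ger0_norm; last by rewrite mulr_ge0// ltW.
  by rewrite mulrAC ler_wpM2r// ler_wpM2l// mulr_ge0// ltW.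
Unshelve. all: by end_near. Qed.

Lemma Cw_blip : blip Cw. Proof. exact: wave_blip cos_lip (@cos_max R). Qed.
Lemma Sw_blip : blip Sw. Proof. exact: wave_blip sin_lip (@sin_max R). Qed.

(* Periodizing the energy of the transform gives, for each shift theta, the energy of
   Fourier coefficients of [f] modulated by theta. *)
Lemma plancherel : [/\ L2r Cw, L2r Sw &
  \int[mu]_t f t ^+ 2 <= \int[mu]_x Cw x ^+ 2 + \int[mu]_x Sw x ^+ 2].
Proof.
have [r [r0 fr]] := cf.
pose P := 2 * r; have P0 : 0 < P by rewrite mulr_gt0.
have P0' : P != 0 by rewrite gt_eqF.
have rP : - r + P = r by rewrite /P; ring.
pose I2 := \int[mu]_t f t ^+ 2.
have I20 : 0 <= I2 by apply: Rintegral_ge0 => x _; exact: sqr_ge0.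
pose F1 th t := f t * cos (2 * pi * th * t).
pose F2 th t := f t * sin (2 * pi * th * t).
have bF1 th : blip (F1 th) by apply: blipM => //; exact: blip_cos.
have bF2 th : blip (F2 th) by apply: blipM => //; exact: blip_sin.
pose D : set (measurableTypeR R) := `[(- r), (- r + P)]%classic.
have mD : measurable D by exact: measurable_itv.
have mblip u : blip u -> measurable_fun D u.
  by move=> bu; apply: measurable_funTS; apply: continuous_measurable_fun; exact: blip_cont.
have iblip u : blip u -> itgb D u by move=> bu; apply: cont_itgb; exact: blip_cont.
have iblip2 u : blip u -> itgb D (fun t => u t ^+ 2).
  by move=> bu; apply: iblip; exact: blipM.
have supp u : \int[mu]_t (f t * u t) = \int[mu]_(t in D) (f t * u t).
  rewrite /D rP; apply: supp_Rint => t; rewrite -ler_norml -ltNge => /fr ->.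
  by rewrite mul0r.
pose U x := Cw x ^+ 2 + Sw x ^+ 2.
pose cc th l := Cf (- r) P (F1 th) l ^+ 2 + Sf (- r) P (F1 th) l ^+ 2.
pose ss th l := Cf (- r) P (F2 th) l ^+ 2 + Sf (- r) P (F2 th) l ^+ 2.
pose qN (N : nat) th := bsum N (fun l => U (th + l%:~R * P^-1)).
have qE N th : qN N th = bsum N (fun l => cc th l + ss th l).
  have CwE l : Cw (th + l%:~R * P^-1) = Cf (- r) P (F1 th) l - Sf (- r) P (F2 th) l.
    rewrite /Cw supp /Cf /Sf -RintegralB//; last 2 first.
    - by apply: iblip; apply: blipM => //; exact: blip_cos.
    - by apply: iblip; apply: blipM => //; exact: blip_sin.
    apply: eq_Rintegral => t _.
    have -> : 2 * pi * (th + l%:~R * P^-1) * t = 2 * pi * th * t + 2 * pi / P * l%:~R * t by field.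
    by rewrite cosD /F1 /F2; ring.
  have SwE l : Sw (th + l%:~R * P^-1) = Sf (- r) P (F1 th) l + Cf (- r) P (F2 th) l.
    rewrite /Sw supp /Cf /Sf -RintegralD//; last 2 first.
    - by apply: iblip; apply: blipM => //; exact: blip_sin.
    - by apply: iblip; apply: blipM => //; exact: blip_cos.
    apply: eq_Rintegral => t _.
    have -> : 2 * pi * (th + l%:~R * P^-1) * t = 2 * pi * th * t + 2 * pi / P * l%:~R * t by field.
    by rewrite sinD /F1 /F2; ring.
  apply: bsum_sym => l; rewrite /U !CwE !SwE !CfN !SfN//; try exact: mblip; try exact: iblip2.
  by rewrite /cc /ss; ring.
have intF th : P * \int[mu]_(t in D) F1 th t ^+ 2 + P * \int[mu]_(t in D) F2 th t ^+ 2 = P * I2.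
  rewrite -mulrDr -RintegralD//; [|exact: iblip2..].
  congr (_ * _); rewrite /I2.
  rewrite (@eq_Rintegral _ _ _ mu setT (fun t => f t * f t)); last by move=> t _; rewrite expr2.
  rewrite supp; apply: eq_Rintegral => t _; rewrite /F1 /F2 !exprMn -mulrDr cos2Dsin2 mulr1.
  by rewrite expr2.
have qle N th : qN N th <= P * I2.
  rewrite qE bsumD -(intF th); apply: lerD.
    by have [] := @bessel R (- r) P P0 _ N (mblip _ (bF1 th)) (iblip2 _ (bF1 th)).
  by have [] := @bessel R (- r) P P0 _ N (mblip _ (bF2 th)) (iblip2 _ (bF2 th)).
have cc0 th l : 0 <= cc th l by rewrite addr_ge0 ?sqr_ge0.
have ss0 th l : 0 <= ss th l by rewrite addr_ge0 ?sqr_ge0.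
have qnd th : nondecreasing_seq (qN ^~ th).
  move=> m n mn; rewrite !qE; apply: bsum_mono => // l.
  exact: addr_ge0 (cc0 th l) (ss0 th l).
have qcv th : cvg (qN n th @[n --> \oo]).
  by apply: nondecreasing_is_cvgn => //; exists (P * I2) => _ [N _ <-].
have qge th : P * I2 <= limn (qN ^~ th).
  have cvc : cvg (bsum n (cc th) @[n --> \oo]).
    apply: nondecreasing_is_cvgn.
      by move=> m n; exact: bsum_mono.
    exists (P * I2) => _ [N _ <-]; apply: le_trans (qle N th).
    by rewrite qE; apply: le_bsum => l; rewrite lerDl.
  have cvs : cvg (bsum n (ss th) @[n --> \oo]).
    apply: nondecreasing_is_cvgn.
      by move=> m n; exact: bsum_mono.
    exists (P * I2) => _ [N _ <-]; apply: le_trans (qle N th).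
    by rewrite qE; apply: le_bsum => l; rewrite lerDr.
  have -> : limn (qN ^~ th) = limn (bsum ^~ (cc th)) + limn (bsum ^~ (ss th)).
    apply/cvg_lim => //; under eq_fun do rewrite qE bsumD.
    exact: (cvgD cvc cvs).
  rewrite -(intF th); apply: lerD.
    have [M [K [M0 K0 HM HL]]] := bF1 th.
    apply: (@parseval_lower _ (- r) P P0 _ M K) => //; first exact: mblip.
    move=> N; exact: (bsum_le_lim N (cc0 th) cvc).
  have [M [K [M0 K0 HM HL]]] := bF2 th.
  apply: (@parseval_lower _ (- r) P P0 _ M K) => //; first exact: mblip.
  move=> N; exact: (bsum_le_lim N (ss0 th) cvs).
pose p := P^-1; have p0 : 0 < p by rewrite invr_gt0.
have cU : continuous U.
  by move=> x; apply: cvgD; apply: cvgM; apply: blip_cont; (exact: Cw_blip || exact: Sw_blip).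
have U0 x : 0 <= U x by rewrite addr_ge0 ?sqr_ge0.
have cUs l : continuous (fun th => U (th + l%:~R * p)).
  move=> x; apply: (@continuous_comp _ _ _ (fun x => x + l%:~R * p) U); last exact: cU.
  by apply: cvgD; [exact: cvg_id|exact: cvg_cst].
have iqN N : itgb `[0, p] (qN N).
  by apply: itgb_sum => // i _; apply: cont_itgb; exact: cUs.
have wide N : \int[mu]_(x in `[0 - N%:R * p, 0 + N.+1%:R * p]) U x =
    \int[mu]_(th in `[0, p]) qN N th.
  rewrite tile_sum//; last by move=> x y; exact: cont_itgb.
  have mp : measurable (`[0, p]%classic : set (measurableTypeR R)) by exact: measurable_itv.
  rewrite /qN /bsum Rint_sum; [|exact: mp|by move=> i _; apply: cont_itgb; exact: cUs].
  apply: eq_bigr => i _; rewrite -Rint_seg_shift//; congr (\int[mu]_(x in _) _).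
  by rewrite !add0r [_ * p + p]addrC.
have c1 : itgb `[0, p] (fun=> 1 : R) by apply: cont_itgb => x; exact: cvg_cst.
have intc c : \int[mu]_(x in `[0, p]) c = c * p.
  transitivity (c * \int[mu]_(x in `[0, p]) 1).
    by rewrite -RintegralZl//; apply: eq_Rintegral => x _; rewrite mulr1.
  by rewrite Rint1_seg// subr0.
have wideB N : \int[mu]_(x in `[0 - N%:R * p, 0 + N.+1%:R * p]) U x <= I2.
  rewrite wide; have -> : I2 = \int[mu]_(x in `[0, p]) (P * I2).
    by rewrite intc mulrAC /p mulfV// mul1r.
  have ic : itgb `[0, p] (fun=> P * I2) by apply: cont_itgb => x; exact: cvg_cst.
  by apply: le_Rintegral => //; do ?[exact: iqN|exact: ic|by move=> x _; exact: qle].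
have iU : itgb setT U by exact: wide_itgb wideB.
have mC : measurable_fun setT Cw by apply: continuous_measurable_fun; exact/blip_cont/Cw_blip.
have mS : measurable_fun setT Sw by apply: continuous_measurable_fun; exact/blip_cont/Sw_blip.
have iC : itgb setT (fun x => Cw x ^+ 2).
  apply: (@itgb_le _ _ _ U) => //; first exact: measurable_funX.
  by move=> x _; rewrite ger0_norm ?sqr_ge0// /U lerDl sqr_ge0.
have iS : itgb setT (fun x => Sw x ^+ 2).
  apply: (@itgb_le _ _ _ U) => //; first exact: measurable_funX.
  by move=> x _; rewrite ger0_norm ?sqr_ge0// /U lerDr sqr_ge0.
split=> //.
rewrite -RintegralD//.
(* Bessel from above and Parseval from below pin the limit to the constant [P * I2] for every shift.
   Fatou over one dual period [[0, p]] then yields the inequality between energies. *)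
have qlim th : qN n th @[n --> \oo] --> P * I2.
  have -> : P * I2 = limn (qN ^~ th); last exact: qcv.
  apply/eqP; rewrite eq_le qge/=; apply: limr_le => //.
  by apply: nearW => n; exact: qle.
rewrite -/I2; have -> : I2 = \int[mu]_(x in `[0, p]) (P * I2).
  by rewrite intc mulrAC /p mulfV// mul1r.
have mI : measurable (`[0, p]%classic : set (measurableTypeR R)) by exact: measurable_itv.
rewrite -lee_fin -itgb_fin//; last by apply: cont_itgb => x; exact: cvg_cst.
have -> : (\int[mu]_(x in `[0%R, p]) (P * I2)%:E =
   \int[mu]_(th in `[0%R, p]) limn_einf (fun N => (qN N th)%:E))%E.
  apply: eq_integral => th _.
  have c2 : (qN n th)%:E @[n --> \oo] --> (P * I2)%:E.
    by apply: cvg_EFin; [exact: nearW|exact: qlim].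
  by rewrite is_cvg_limn_einfE; [apply/esym/cvg_lim|apply/cvg_ex; exists (P * I2)%:E].
apply: (le_trans (fatou mu mI _ _)).
- by move=> N; apply/measurable_EFinP; exact: itgb_mfun (iqN N).
- by move=> N x _; rewrite lee_fin; apply: bsum_ge0 => l; exact: U0.
apply: limn_einf_ub => N; rewrite itgb_fin// lee_fin -wide.
rewrite -lee_fin -!itgb_fin//; last exact: itgb_seg.
apply: ge0_subset_integral => //.
- by apply/measurable_EFinP; exact: itgb_mfun iU.
- by move=> x _; rewrite lee_fin; exact: U0.
Qed.

End FourierTransform.

(** * Gabor coefficients on the Fourier side *)

Section Swap.
Context {R : realType}.
Implicit Types (f G : R -> R) (x t om al : R).
Notation mu := (@lebesgue_measure R).

Lemma fubini_trig f G (trig phase : R -> R) : itgb setT f -> itgb setT G ->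
  continuous trig -> (forall x, `|trig x| <= 1) -> continuous phase ->
  \int[mu]_t (f t * \int[mu]_om (G om * trig (2 * pi * om * t - phase om))) =
  \int[mu]_om (G om * \int[mu]_t (f t * trig (2 * pi * om * t - phase om))).
Proof.
move=> fi Gi ct t1 cph.
have mf := itgb_mfun fi; have mG := itgb_mfun Gi.
have mt : measurable_fun setT trig by exact: continuous_measurable_fun.
have mp : measurable_fun setT phase by exact: continuous_measurable_fun.
pose T (z : measurableTypeR R * measurableTypeR R) : R := trig (2 * pi * z.2 * z.1 - phase z.2).
have mT : measurable_fun setT T.
  apply: measurableT_comp => //; apply: measurable_funB; last exact: measurableT_comp.
  by do 2 apply: measurable_funM => //.
pose h (z : measurableTypeR R * measurableTypeR R) : R := f z.1 * (G z.2 * T z).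
have T1 z : `|T z| <= 1 by exact: t1.
have mTl c : measurable_fun setT (fun t => T (t, c)).
  exact: (measurableT_comp mT (measurable_pair2 c)).
have mTr c : measurable_fun setT (fun om => T (c, om)).
  exact: (measurableT_comp mT (measurable_pair1 c)).
have mh : measurable_fun setT h.
  apply: measurable_funM; first exact: (measurableT_comp mf measurable_fst).
  apply: measurable_funM; first exact: (measurableT_comp mG measurable_snd).
  exact: mT.
have mh' : measurable_fun setT (EFin \o h) by exact/measurable_EFinP.
have iG t : itgb setT (fun om => G om * T (t, om)).
  apply: (@itgb_le _ _ _ (fun x => `|G x|)) => //.
  - exact: (measurable_funM mG (mTr t)).
  - by move=> x _; rewrite normrM ler_piMr.
  - exact: itgb_norm.
have iF om : itgb setT (fun t => f t * T (t, om)).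
  apply: (@itgb_le _ _ _ (fun x => `|f x|)) => //.
  - exact: (measurable_funM mf (mTl om)).
  - by move=> x _; rewrite normrM ler_piMr.
  - exact: itgb_norm.
have ih : (mu \x mu)%E.-integrable setT (EFin \o h).
  apply/(integrable12ltyP mu mu mh').
  apply: (@le_lt_trans _ _ (\int[mu]_x (`|f x| * \int[mu]_y `|G y|)%:E)%E).
    apply: ge0_le_integral => //.
    - by move=> x _; apply: integral_ge0.
    - have mh2 : measurable_fun setT (fun z => `|(EFin \o h) z|)%E by exact: measurableT_comp.
      exact: (measurable_fun_fubini_tonelli_F _ mh2 (fun _ => abse_ge0 _)).
    - apply/measurable_EFinP; apply: measurable_funM; last exact: measurable_cst.
      exact: (measurableT_comp (@normr_measurable R setT) mf).
    move=> x _; rewrite EFinM -(itgb_fin measurableT (itgb_norm Gi)).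
    rewrite -ge0_integralZl//; last first.
      by apply/measurable_EFinP; exact: (measurableT_comp (@normr_measurable R setT) mG).
    apply: ge0_le_integral => //.
    - apply/measurable_EFinP; apply: (measurableT_comp (@normr_measurable R setT)).
      exact: (measurableT_comp mh (measurable_pair1 x)).
    - under eq_fun do rewrite -EFinM.
      apply/measurable_EFinP; apply: measurable_funM; first exact: measurable_cst.
      exact: (measurableT_comp (@normr_measurable R setT) mG).
    move=> y _; rewrite /h /= lee_fin !normrM ler_wpM2l// ler_piMr//.
  have /integrableP[_] : itgb setT (fun x => `|f x| * \int[mu]_y `|G y|).
    by apply: itgbZr => //; exact: itgb_norm.
  apply: le_lt_trans; rewrite le_eqVlt; apply/orP; left; apply/eqP.
  have I0 : 0 <= \int[mu]_y `|G y| by apply: Rintegral_ge0.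
  by apply: eq_integral => x _; rewrite /= [X in _ = X%:E]ger0_norm// mulr_ge0.
have H := Fubini ih.
transitivity (fine (\int[mu]_x \int[mu]_y (EFin \o h) (x, y))%E).
  congr fine; apply: eq_integral => x _.
  rewrite /h /= EFinM -(itgb_fin measurableT (iG x)).
  under [RHS]eq_integral do rewrite EFinM.
  by rewrite integralZl//; exact: iG.
rewrite H; congr fine; apply: eq_integral => y _.
rewrite /h /= EFinM -(itgb_fin measurableT (iF y)) -integralZl//; last exact: iF.
by apply: eq_integral => x _; rewrite -EFinM; congr EFin; rewrite /T/=; ring.
Qed.

Variables (g : R -> R) (Cg : R).
Hypothesis cg : continuous g.
Hypothesis gle : forall x, `|g x| <= Cg * gauss_fun x.
(** A real form of the eigenvalue relation: [eig] says that the inverse Fourier transform of [g] is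
    e^(i kappa) g, tested against all phases [al]. *)
Variable kappa : R.
Hypothesis eig : forall x al,
  g x * cos al = \int[mu]_om (g om * cos (2 * pi * om * x + (al - kappa))).
Variables (a b : R).
Hypotheses (a0 : 0 < a) (b0 : 0 < b).

Let gshift_itgb c : itgb setT (fun t => g (t - c)).
Proof. by apply: (itgb_shift (- c)); exact: (g_itgb cg gle). Qed.

Section Fixed.
Variable f : R -> R.
Hypotheses (bf : blip f) (cf : csupp f).

Let fi : itgb setT f. Proof. exact: f_itgb. Qed.
Let C2 : L2r (Cw f). Proof. by have [] := plancherel bf cf. Qed.
Let S2 : L2r (Sw f). Proof. by have [] := plancherel bf cf. Qed.

Let psi0 (k l : int) : R := kappa - 2 * pi * a * b * k%:~R * l%:~R.

(* Phase of the Fourier transform of the atom; [al] selects its cosine or sine part. *)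
Let psi k l al om : R := 2 * pi * a * k%:~R * om + psi0 k l - al.

Let cpsi k l al : continuous (psi k l al).
Proof. by apply: (@df_cont _ _ (fun om => 2 * pi * a * k%:~R)) => om; rewrite /psi; deriv; ring. Qed.

(** Inserting [eig] for the translate of [g] and exchanging the integrals makes the translation by
    [a k] a modulation and the modulation by [b l] a translation. A free [al] gives the cosine
    coefficient at 0 and the sine coefficient at - pi / 2. *)
Let atom k l al : \int[mu]_t (f t * g (t - a * k%:~R) * cos (2 * pi * b * l%:~R * t + al)) =
  \int[mu]_om (g (om - b * l%:~R) *
     (Cw f om * cos (psi k l al om) + Sw f om * sin (psi k l al om))).
Proof.
transitivity (\int[mu]_t (f t * \int[mu]_om (g (om - b * l%:~R) * cos (2 * pi * om * t - psi k l al om)))).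
  apply: eq_Rintegral => t _; rewrite -mulrA eig; congr (_ * _).
  have i : itgb setT (fun om => g om * cos (2 * pi * om * (t - a * k%:~R) + (2 * pi * b * l%:~R * t + al - kappa))).
    apply: bounded_itgbM; first exact: (g_itgb cg gle).
      apply: (@df_cont _ _ (fun om => - sin (2 * pi * om * (t - a * k%:~R) + (2 * pi * b * l%:~R * t + al - kappa)) *
        (2 * pi * (t - a * k%:~R)))) => om.
      by deriv; ring.
    by move=> om; exact: cos_max.
  rewrite -(@Rint_shift _ (- (b * l%:~R)) _ i); apply: eq_Rintegral => om _.
  by congr (_ * cos _); rewrite /psi /psi0; ring.
have cc : continuous (@cos R) by exact: continuous_cos.
rewrite fubini_trig; [|exact: fi|exact: gshift_itgb|exact: cc|exact: (@cos_max R)|exact: cpsi].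
apply: eq_Rintegral => om _; congr (_ * _).
rewrite /Cw /Sw.
have ic : itgb setT (fun t => f t * cos (2 * pi * om * t)).
  by apply: bounded_itgbM => //; [exact: cosl_cont|move=> x; exact: cos_max].
have is_ : itgb setT (fun t => f t * sin (2 * pi * om * t)).
  by apply: bounded_itgbM => //; [exact: sinl_cont|move=> x; exact: sin_max].
rewrite ![(\int[mu]_t _) * _]mulrC -!RintegralZl// -RintegralD//; [|exact: itgbZ..].
by apply: eq_Rintegral => t _; rewrite cosB; ring.
Qed.

Let c1 k l := GC g b a (Cw f) l k.
Let s1 k l := GS g b a (Cw f) l k.
Let c2 k l := GC g b a (Sw f) l k.
Let s2 k l := GS g b a (Sw f) l k.

Let combine k l (p q r s : R) :
  \int[mu]_om (g (om - b * l%:~R) *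
     (Cw f om * (cos (2 * pi * a * k%:~R * om) * p + sin (2 * pi * a * k%:~R * om) * q)
    + Sw f om * (cos (2 * pi * a * k%:~R * om) * r + sin (2 * pi * a * k%:~R * om) * s))) =
  c1 k l * p + s1 k l * q + c2 k l * r + s2 k l * s.
Proof.
have ic1 := GC_itgb cg gle b a l k C2; have is1 := GS_itgb cg gle b a l k C2.
have ic2 := GC_itgb cg gle b a l k S2; have is2 := GS_itgb cg gle b a l k S2.
rewrite /c1 /s1 /c2 /s2 /GC /GS.
rewrite -(RintegralZr _ measurableT ic1) -(RintegralZr _ measurableT is1).
rewrite -(RintegralZr _ measurableT ic2) -(RintegralZr _ measurableT is2).
rewrite -!RintegralD//; do ?[apply: itgbZr => //|apply: itgbD => //].
by apply: eq_Rintegral => om _; ring.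
Qed.

(** The pair ([GC], [GS]) is an isometric image of ([c1 + s2], [c2 - s1]), with angle [psi0 k l], so
    the phase disappears from the sum of squares. *)
Let GQ_swap k l : GQ g a b f k l =
  (c1 k l + s2 k l) ^+ 2 + (c2 k l - s1 k l) ^+ 2.
Proof.
have EC : GC g a b f k l = (c1 k l + s2 k l) * cos (psi0 k l) + (c2 k l - s1 k l) * sin (psi0 k l).
  rewrite /GC; transitivity (\int[mu]_t (f t * g (t - a * k%:~R) * cos (2 * pi * b * l%:~R * t + 0))).
    by apply: eq_Rintegral => t _; rewrite addr0.
  rewrite atom.
  transitivity (c1 k l * cos (psi0 k l) + s1 k l * - sin (psi0 k l) +
     c2 k l * sin (psi0 k l) + s2 k l * cos (psi0 k l)); last by ring.
  rewrite -combine; apply: eq_Rintegral => om _.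
  by rewrite /psi subr0; move: (psi0 k l) => p0; rewrite cosD sinD; ring.
have ES : GS g a b f k l = (c2 k l - s1 k l) * cos (psi0 k l) - (c1 k l + s2 k l) * sin (psi0 k l).
  rewrite /GS; transitivity (\int[mu]_t (f t * g (t - a * k%:~R) * cos (2 * pi * b * l%:~R * t + - (pi / 2)))).
    by apply: eq_Rintegral => t _; rewrite cosBpihalf.
  rewrite atom.
  transitivity (c1 k l * - sin (psi0 k l) + s1 k l * - cos (psi0 k l) +
     c2 k l * cos (psi0 k l) + s2 k l * - sin (psi0 k l)); last by ring.
  rewrite -combine; apply: eq_Rintegral => om _.
  by rewrite /psi opprK cosDpihalf sinDpihalf; move: (psi0 k l) => p0; rewrite cosD sinD; ring.
have alg (C S p q : R) : C ^+ 2 + S ^+ 2 = 1 ->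
    (p * C + q * S) ^+ 2 + (q * C - p * S) ^+ 2 = p ^+ 2 + q ^+ 2.
  by move=> h; transitivity ((p ^+ 2 + q ^+ 2) * (C ^+ 2 + S ^+ 2)); [ring|rewrite h mulr1].
by rewrite /GQ EC ES; apply: alg; exact: cos2Dsin2.
Qed.

(** Expanding [GQ_swap] leaves the cross terms 2 (c1 s2 - c2 s1); they are odd in [k] and cancel
    over the symmetric range. *)
Lemma box_swap K L : bsum K (fun k => bsum L (fun l => GQ g a b f k l)) =
  bsum L (fun l => bsum K (fun k => GQ g b a (Cw f) l k)) +
  bsum L (fun l => bsum K (fun k => GQ g b a (Sw f) l k)).
Proof.
rewrite exchange_bsum -bsumD; apply: eq_bsum => l; rewrite -bsumD.
apply: bsum_sym => k; rewrite !GQ_swap /GQ.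
have CN u : GC g b a u l (- k) = GC g b a u l k.
  rewrite /GC; apply: eq_Rintegral => t _; congr (_ * _).
  by rewrite mulrNz mulrN mulNr cosN.
have SN u : L2r u -> GS g b a u l (- k) = - GS g b a u l k.
  move=> u2; rewrite /GS -[RHS]mulN1r -RintegralZl//; last exact: (GS_itgb cg gle).
  by apply: eq_Rintegral => t _; rewrite mulrNz mulrN mulNr sinN; ring.
rewrite /c1 /c2 /s1 /s2 !CN (SN _ C2) (SN _ S2).
move: (GC g b a (Cw f) l k) (GS g b a (Cw f) l k) (GC g b a (Sw f) l k) (GS g b a (Sw f) l k).
by move=> p q r s; ring.
Qed.

End Fixed.

(** Only the lower bound has to be transferred, by [box_swap] and Plancherel for the two real parts
    of the transform; [frame_from_dense] supplies the upper one. *)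
Theorem swap_frame : real_frame g b a -> real_frame g a b.
Proof.
move=> [A [B [A0 B0 HF]]].
apply: (@frame_from_dense _ _ _ cg gle _ _ a0 b0 A A0) => f bf cf Bd QB.
have [C2 S2 Pl] := plancherel bf cf.
have [_ HC] := HF _ C2; have [_ HS] := HF _ S2.
have mono u N M N' M' : (N <= N')%N -> (M <= M')%N ->
    bsum M (fun l => bsum N (fun k => GQ g b a u l k)) <= bsum M' (fun l => bsum N' (fun k => GQ g b a u l k)).
  have Q0 l k : 0 <= GQ g b a u l k by rewrite addr_ge0 ?sqr_ge0.
  move=> nn mm; apply: (@le_trans _ _ (bsum M' (fun l => bsum N (fun k => GQ g b a u l k)))).
    by apply: bsum_mono => // l; exact: bsum_ge0.
  by apply: le_bsum => l; exact: bsum_mono.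
apply: (@le_trans _ _ (A * \int[mu]_x Cw f x ^+ 2 + A * \int[mu]_x Sw f x ^+ 2)).
  by rewrite -mulrDr ler_wpM2l// ltW.
(* The two lower bounds are used one after the other, each against the other's box sum as a
   constant; a common larger box bounds both, as for the supremum of a sum of two increasing
   families. *)
rewrite addrC -lerBrDr; apply: HS => M N.
rewrite lerBrDl -lerBrDr; apply: HC => M' N'.
rewrite lerBrDr.
apply: (le_trans _ (QB (maxn N N') (maxn M M'))); rewrite (box_swap bf cf).
by apply: lerD; apply: mono; rewrite ?leq_maxl ?leq_maxr.
Qed.

End Swap.

(** * Hermite functions *)

Section HermiteFunctions.
Context {R : realType}.
Implicit Types (x y om al eps : R) (n : nat).
Notation mu := (@lebesgue_measure R).

Definition gam : R := Num.sqrt (2 * pi).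

Lemma gam_gt0 : 0 < gam.
Proof. by rewrite sqrtr_gt0 mulr_gt0// pi_gt0. Qed.

Lemma gam2 : gam ^+ 2 = 2 * pi.
Proof. by rewrite sqr_sqrtr// mulr_ge0// pi_ge0. Qed.

(** Carries H_n together with H_(n-1), as the three-term recurrence requires. The 0 at the start
    stands for H_(-1) and is multiplied by 0 in the next step. *)
Fixpoint hpair n x : R * R :=
  if n is m.+1 then
    let p := hpair m x in (2 * gam * x * p.1 - 2 * m%:R * p.2, p.1)
  else (1, 0).

(* [hpoly n x] is the physicists' Hermite polynomial H_n at [gam * x]. *)
Definition hpoly n x := (hpair n x).1.
Definition hg n x := hpoly n x * expR (- (pi * x ^+ 2)).

Lemma hpolyS n x : hpoly n.+1 x = 2 * gam * x * hpoly n x - 2 * n%:R * hpoly n.-1 x.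
Proof. by case: n => [|n] //; rewrite /hpoly /= !mulr0n !mulr0 !mul0r. Qed.

Lemma df_hpoly n x : is_derive x 1 (hpoly n) (2 * gam * n%:R * hpoly n.-1 x).
Proof.
have [m] := ubnP n; elim: m n x => // m IH [|n] x nm.
  by apply: df_eq (dfC x 1) _; rewrite mulr0 mul0r.
have -> : hpoly n.+1 = fun x => 2 * gam * x * hpoly n x - 2 * n%:R * hpoly n.-1 x.
  by apply/funext => y; exact: hpolyS.
have d1 := IH n x ltac:(lia); have d2 := IH n.-1 x ltac:(lia).
deriv; case: n {IH nm d1 d2} => [|n]; first by rewrite !mulr0 !mul0r mulr1; ring.
rewrite [n.+1.-1]/= hpolyS -![in RHS]natr1; ring.
Qed.

Lemma df_hg n x : is_derive x 1 (hg n) (gam * n%:R * hg n.-1 x - gam / 2 * hg n.+1 x).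
Proof.
have d := df_hpoly n x; rewrite /hg; deriv.
rewrite hpolyS; have -> : pi = gam ^+ 2 / 2 by rewrite gam2 mulrC mulKf.
by field.
Qed.

Lemma hgS n x : hg n.+1 x = 2 * gam * x * hg n x - 2 * n%:R * hg n.-1 x.
Proof. by rewrite /hg hpolyS; ring. Qed.

Lemma hpolyN n x : hpoly n (- x) = (-1) ^+ n * hpoly n x.
Proof.
have [m] := ubnP n; elim: m n => // m IH [|n] nm; first by rewrite mul1r.
rewrite !hpolyS (IH n); last by lia.
rewrite (IH n.-1); last by lia.
by case: n {nm} => [|n]; [rewrite !expr1 expr0|rewrite /= !exprS]; ring.
Qed.

Lemma hg_abs_even n x : `|hg n (- x)| = `|hg n x|.
Proof. by rewrite /hg hpolyN sqrrN !normrM normrX normrN1 expr1n mul1r. Qed.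

Lemma hpoly_le n eps : 0 < eps ->
  exists2 K : R, 0 <= K & forall x, `|hpoly n x| <= K * expR (eps * x ^+ 2).
Proof.
have [m] := ubnP n; elim: m n eps => // m IH [|n] eps nm e0.
  exists 1 => // x; rewrite mul1r normr1.
  by rewrite -expR0 ler_expR mulr_ge0 ?sqr_ge0// ltW.
have e2 : 0 < eps / 2 by rewrite divr_gt0.
have [K1 K10 H1] := IH n (eps / 2) ltac:(lia) e2.
have [K2 K20 H2] := IH n.-1 eps ltac:(lia) e0.
have xle x : `|x| <= (1 + 2 / eps) * expR (eps / 2 * x ^+ 2).
  apply: (@le_trans _ _ ((1 + 2 / eps) * (1 + eps / 2 * x ^+ 2))); last first.
    by rewrite ler_wpM2l ?expR_ge1Dx// addr_ge0// divr_ge0// ltW.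
  have -> : (1 + 2 / eps) * (1 + eps / 2 * x ^+ 2) =
     1 + x ^+ 2 + 2 / eps + eps / 2 * x ^+ 2 by field; rewrite gt_eqF.
  have h1 : 0 <= 2 / eps by rewrite divr_ge0// ltW.
  have h2 : 0 <= eps / 2 * x ^+ 2 by rewrite mulr_ge0 ?sqr_ge0// ltW.
  have := sqr_ge0 (`|x| - 1); rewrite -(real_normK (num_real x)).
  by have := normr_ge0 x; nra.
have g0 := gam_gt0.
exists (2 * gam * (1 + 2 / eps) * K1 + 2 * n%:R * K2).
  by rewrite addr_ge0// !mulr_ge0 ?addr_ge0 ?divr_ge0// ltW.
move=> x; rewrite hpolyS; apply: (le_trans (ler_normB _ _)); rewrite [leRHS]mulrDl; apply: lerD.
  rewrite !normrM [`|2|]ger0_norm// [`|gam|]gtr0_norm// -!mulrA.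
  rewrite ler_wpM2l//; apply: ler_wpM2l; first exact: ltW.
  have -> : (1 + 2 / eps) * (K1 * expR (eps * x ^+ 2)) =
    ((1 + 2 / eps) * expR (eps / 2 * x ^+ 2)) * (K1 * expR (eps / 2 * x ^+ 2)).
    have -> : eps * x ^+ 2 = eps / 2 * x ^+ 2 + eps / 2 * x ^+ 2 by field.
    by rewrite expRD; ring.
  by rewrite ler_pM.
rewrite !normrM [`|2|]ger0_norm// [`|_%:R|]ger0_norm// -!mulrA.
by rewrite ler_wpM2l// ler_wpM2l.
Qed.

(** The polynomial is absorbed by e^(x^2), and pi >= 2 leaves e^(- x^2) of the Gaussian factor. *)
Lemma hg_gauss n : exists2 K : R, 0 <= K & forall x, `|hg n x| <= K * gauss_fun x.
Proof.
have [K K0 HK] := hpoly_le n (@ltr01 R); exists K => // x.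
rewrite /hg normrM [`|expR _|]gtr0_norm ?expR_gt0//.
apply: (@le_trans _ _ (K * expR (1 * x ^+ 2) * expR (- (pi * x ^+ 2)))).
  by rewrite ler_wpM2r ?expR_ge0.
rewrite -mulrA ler_wpM2l// -expRD /gauss_fun ler_expR mul1r.
by have := @pi_ge2 R; have := sqr_ge0 x; nra.
Qed.

Lemma hg_cont n : continuous (hg n).
Proof. exact: df_cont (df_hg n). Qed.

Lemma hg_itgb n : itgb setT (hg n).
Proof. by have [K _ HK] := hg_gauss n; exact: (g_itgb (@hg_cont n) HK). Qed.

Lemma hg_bounded n : exists2 K : R, 0 <= K & forall x, `|hg n x| <= K.
Proof.
have [K K0 HK] := hg_gauss n; exists K => // x; exact: (g_bounded HK).
Qed.

Lemma hg_blip n : blip (hg n).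
Proof.
have [K K0 HK] := hg_bounded n; have [K1 K10 HK1] := hg_bounded n.-1.
have [K2 K20 HK2] := hg_bounded n.+1; have g0 := gam_gt0.
exists K, (gam * n%:R * K1 + gam / 2 * K2); split=> //.
  by rewrite addr_ge0// !mulr_ge0// ltW.
move=> x y; wlog xy : x y / y <= x => [W|].
  by have [/W//|/ltW/W] := leP y x; rewrite distrC [`|y - x|]distrC.
have [c _ ->] := df_MVT xy (fun z _ => df_hg n z).
rewrite normrM ler_wpM2r//; apply: (le_trans (ler_normB _ _)).
have h1 : 0 <= gam * n%:R by rewrite mulr_ge0// ltW.
have h2 : 0 <= gam / 2 by rewrite divr_ge0// ltW.
by rewrite (normrM (gam * _)) (normrM (gam / 2)) (ger0_norm h1) (ger0_norm h2); apply: lerD; rewrite ler_wpM2l.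
Qed.

(* A polynomial vanishing on a half-line has all its derivatives vanishing there. *)
Lemma hpoly_neq0 n y : exists2 x, y < x & hpoly n x != 0.
Proof.
apply: contrapT => H; have {H} Z x : y < x -> hpoly n x = 0.
  by move=> yx; apply: contrapT => /eqP h; apply: H; exists x.
elim: n Z => [|n IH] Z.
  by have /eqP := Z (y + 1) ltac:(by rewrite ltrDl); rewrite oner_eq0.
apply: IH => x yx; have d := df_hpoly n.+1 x.
have d0 : is_derive x 1 (hpoly n.+1) 0.
  apply: near_eq_is_derive (dfC x 0); near=> z; rewrite Z//; near: z.
  exact: lt_nbhsr.
have [_ e1] := d; have [_ e0] := d0; move: e1; rewrite e0 => /esym/eqP.
rewrite !mulf_eq0 pnatr_eq0 (gt_eqF gam_gt0) pnatr_eq0/= => /eqP; exact.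
Unshelve. all: by end_near. Qed.

Lemma derive_gauss n : derive1n n (fun s : R => expR (- (2 * pi * s ^+ 2))) =
  fun x => (- gam) ^+ n * hpoly n x * expR (- (2 * pi * x ^+ 2)).
Proof.
elim: n => [|n IH].
  by rewrite derive1n0; apply/funext => x; rewrite /hpoly/= !mul1r.
rewrite derive1nS IH; apply/funext => x; rewrite derive1E.
have d := df_hpoly n x.
have D : is_derive x 1 (fun x => (- gam) ^+ n * hpoly n x * expR (- (2 * pi * x ^+ 2)))
    ((- gam) ^+ n.+1 * hpoly n.+1 x * expR (- (2 * pi * x ^+ 2))).
  by deriv; rewrite hpolyS [(- gam) ^+ n.+1]exprS -gam2; ring.
exact: derive_val.
Qed.

Lemma hermite_rawE n x : hermite_raw n x = gam ^+ n * hg n x.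
Proof.
rewrite /hermite_raw derive_gauss /hg.
have -> : expR (- (pi * x ^+ 2)) = expR (pi * x ^+ 2) * expR (- (2 * pi * x ^+ 2)).
  by rewrite -expRD; congr expR; ring.
have -> : (-1) ^+ n * expR (pi * x ^+ 2) * ((- gam) ^+ n * hpoly n x * expR (- (2 * pi * x ^+ 2))) =
  ((-1) ^+ n * (- gam) ^+ n) * (expR (pi * x ^+ 2) * (hpoly n x * expR (- (2 * pi * x ^+ 2)))) by ring.
rewrite -exprMn mulN1r opprK; ring.
Qed.

Lemma gauss_pi_int : \int[mu]_x expR (- (pi * x ^+ 2)) = 1.
Proof.
have p0 := @pi_gt0 R; pose s : R := (Num.sqrt (2 * pi))^-1.
have s0 : s != 0 by rewrite invr_eq0 gt_eqF// gam_gt0.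
have s2 : s ^+ 2 = (2 * pi)^-1 by rewrite exprVn gam2.
have := @integral_normal_pdf R 0 s.
rewrite /normal_pdf (negbTE s0) => H.
rewrite /Rintegral -[RHS]/(fine 1%E) -H; congr fine; apply: eq_integral => x _.
rewrite /normal_peak /normal_fun s2 subr0.
have pn : 2 * pi != 0 :> R by rewrite mulf_neq0// lt0r_neq0.
rewrite -mulrnAr -[pi *+ 2]mulr_natl mulVf//.
rewrite sqrtr1 invr1 mul1r; congr (expR _)%:E.
have -> : (2 * pi)^-1 *+ 2 = pi^-1 :> R.
  by rewrite -[_^-1 *+ 2]mulr_natl invfM mulrA mulfV// mul1r.
by rewrite invrK mulNr mulrC.
Qed.

Lemma Rint_derive (F f : R -> R) : (forall x, is_derive x 1 F (f x)) -> itgb setT f -> continuous f ->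
  (exists K, forall x, `|F x| <= K * gauss_fun x) -> \int[mu]_x f x = 0.
Proof.
move=> dF fi cf [K HK]; have K0 : 0 <= K := Cg_ge0 HK.
have H := @Rint_wide R 0 1 f ltr01 fi.
have bound (N : nat) : `|\int[mu]_(x in `[0 - N%:R * 1, 0 + N.+1%:R * 1]) f x| <= (2 * K) * N.+1%:R^-1.
  have n1 : 0 < (N.+1%:R : R) by rewrite ltr0n.
  have ab : 0 - N%:R * 1 < 0 + N.+1%:R * 1 :> R.
    by rewrite !mulr1 sub0r add0r (@le_lt_trans _ _ 0)// oppr_le0.
  rewrite (Rint_FTC ab dF cf); apply: (le_trans (ler_normB _ _)).
  have -> : 2 * K / N.+1%:R = K * N.+1%:R^-1 + K * N.+1%:R^-1 by ring.
  have n0 : 0 <= (N%:R : R) by rewrite ler0n.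
  have dec x : N%:R <= `|x| -> `|F x| <= K * N.+1%:R^-1.
    move=> Nx; apply: (le_trans (g_decay HK x)); rewrite ler_wpM2l// lef_pV2 ?posrE//; last first.
      by rewrite ltr_pwDl// sqr_ge0.
    rewrite -natr1 addrC lerD2l -(real_normK (num_real x)).
    case: N {ab n1 n0} Nx => [|N] Nx; first exact: sqr_ge0.
    apply: (le_trans Nx); rewrite expr2 ler_peMl//; apply: le_trans Nx.
    by rewrite ler1n.
  apply: lerD; apply: dec; rewrite mulr1.
    by rewrite add0r ger0_norm ?ler_nat ?ler0n.
  by rewrite sub0r normrN ger0_norm.
have Z : (fun N : nat => \int[mu]_(x in `[0 - N%:R * 1, 0 + N.+1%:R * 1]) f x) @ \oo --> (0 : R).
  apply/cvgr0Pnorm_lt => e e0; near=> N; apply: (le_lt_trans (bound N)).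
  rewrite ltr_pdivrMr ?ltr0n// -ltr_pdivrMl//.
  near: N; exists (Num.bound (e^-1 * (2 * K))) => // N /= HN.
  apply: (@lt_le_trans _ _ (Num.bound (e^-1 * (2 * K)))%:R).
    by apply: archi_boundP; rewrite mulr_ge0 ?mulr_ge0// invr_ge0 ltW.
  by rewrite ler_nat ltnW.
exact: (cvg_unique _ H Z).
Unshelve. all: by end_near. Qed.

Let J n om al := \int[mu]_x (hg n x * cos (2 * pi * om * x + al)).

Let cos_cont om al : continuous (fun x => cos (2 * pi * om * x + al)).
Proof.
apply: (@df_cont _ _ (fun x => - sin (2 * pi * om * x + al) * (2 * pi * om))) => x.
by deriv; ring.
Qed.

Let J_itgb n om al : itgb setT (fun x => hg n x * cos (2 * pi * om * x + al)).
Proof.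
apply: bounded_itgbM; [exact: hg_itgb|exact: cos_cont|by move=> x; exact: cos_max].
Qed.

(** Integration by parts: the derivative of [hg n] times the cosine integrates to 0 by Gaussian
    decay, and [df_hg] expresses it through the neighbours [n.-1] and [n.+1]. *)
Let J_rec n om al : J n.+1 om al = 2 * n%:R * J n.-1 om al - 2 * gam * om * J n om (al - pi / 2).
Proof.
have g0 := gam_gt0.
have Z : \int[mu]_x (gam * n%:R * (hg n.-1 x * cos (2 * pi * om * x + al)) -
    gam / 2 * (hg n.+1 x * cos (2 * pi * om * x + al)) -
    2 * pi * om * (hg n x * cos (2 * pi * om * x + (al - pi / 2)))) = 0.
  apply: (@Rint_derive (fun x => hg n x * cos (2 * pi * om * x + al))).
  - move=> x; have d := df_hg n x; deriv.
    by rewrite addrA cosBpihalf; ring.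
  - by apply: itgbB => //; [apply: itgbB => //|]; apply: itgbZ.
  - have c k b : continuous (fun x => hg k x * cos (2 * pi * om * x + b)).
      by move=> x; apply: cvgM; [exact: hg_cont|exact: cos_cont].
    by move=> x; apply: cvgB; [apply: cvgB|]; (apply: cvgM; [exact: cvg_cst|exact: c]).
  - have [K K0 HK] := hg_gauss n; exists K => x.
    by rewrite normrM; apply: le_trans (HK x); rewrite ler_piMr// cos_max.
move: Z; rewrite RintegralB//; first last.
- exact: itgbZ.
- by apply: itgbB => //; apply: itgbZ.
rewrite RintegralB//; [|exact: itgbZ..].
do 3 (rewrite RintegralZl; [|by []|exact: J_itgb]).
rewrite -/(J n.-1 om al) -/(J n.+1 om al) -/(J n om (al - pi / 2)) -gam2 => Z.
have -> : J n.+1 om al = (gam / 2 * J n.+1 om al) * (2 / gam).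
  by field; rewrite gt_eqF.
have -> : gam / 2 * J n.+1 om al = gam * n%:R * J n.-1 om al - gam ^+ 2 * om * J n om (al - pi / 2).
  by move: Z; move: (J _ _ _) (J _ _ _) (J _ _ _) => ? ? ? ?; lra.
by field; rewrite gt_eqF.
Qed.

Let J0_deriv al om : is_derive om 1 (fun om => J 0 om al) (- (2 * pi * om) * J 0 om al).
Proof.
pose f om y : R := hg 0 y * cos (2 * pi * om * y + al).
have df y om' : is_derive om' 1 (fun om => f om y) (- (gam / 2) * (hg 1 y * cos (2 * pi * om' * y + (al - pi / 2)))).
  rewrite hgS mulr0n mulr0 mul0r subr0 addrA cosBpihalf.
  have -> : - (gam / 2) * (2 * gam * y * hg 0 y * sin (2 * pi * om' * y + al)) =
     - gam ^+ 2 * y * hg 0 y * sin (2 * pi * om' * y + al) by field.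
  by rewrite /f gam2; deriv; ring.
have d1E om' y : partial1of2 f om' y = - (gam / 2) * (hg 1 y * cos (2 * pi * om' * y + (al - pi / 2))).
  by rewrite partial1of2E; have [_] := df y om'.
have g0 := gam_gt0.
have [K K0 HK] := hg_gauss 1.
have omI : `]om - 1, om + 1[%classic om by rewrite /= in_itv/=; apply/andP; split; lra.
have i1 x : `]om - 1, om + 1[%classic x -> itgb setT (f x) by move=> _; exact: J_itgb.
have i2 x y : `]om - 1, om + 1[%classic x -> setT y -> derivable (f ^~ y) x 1.
  by move=> _ _; have [] := df y x.
have G0 y : 0 <= gam / 2 * (K * gauss_fun y).
  by rewrite !mulr_ge0 ?divr_ge0 ?gauss_fun_ge0// ltW.
have iG : itgb setT (fun y : R => gam / 2 * (K * gauss_fun y)).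
  by do 2 apply: itgbZ => //; exact: integrableT_gauss.
have Gub x y : `]om - 1, om + 1[%classic x -> setT y -> `|partial1of2 f x y| <= gam / 2 * (K * gauss_fun y).
  have h : 0 <= gam / 2 by rewrite divr_ge0// ltW.
  move=> _ _; rewrite d1E normrM normrN (ger0_norm h); apply: (ler_wpM2l h).
  rewrite normrM; apply: le_trans (HK y).
  by rewrite ler_piMr// cos_max.
have D := derivable_under_integral measurableT omI i1 i2 G0 iG Gub.
have E := differentiation_under_integral measurableT omI i1 i2 G0 iG Gub.
have -> : - (2 * pi * om) * J 0 om al = \int[mu]_y partial1of2 f om y.
  under eq_Rintegral do rewrite d1E.
  rewrite RintegralZl; [|by []|exact: J_itgb].
  rewrite -/(J 1 om _) J_rec mulr0n mulr0 mul0r sub0r.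
  have -> : J 0 om (al - pi / 2 - pi / 2) = - J 0 om al.
    rewrite /J -[RHS]mulN1r -RintegralZl; [|by []|exact: J_itgb].
    apply: eq_Rintegral => y _.
    rewrite -addrA -opprD -splitr addrA cosB cospi sinpi; ring.
  by rewrite -gam2; field.
rewrite -E derive1E; exact: DeriveDef.
Qed.

(** By [J0_deriv], [J 0] solves the differential equation of the Gaussian, so its product with e^(pi
    om^2) is constant; the value at 0 is the Gaussian integral. *)
Let J0E om al : J 0 om al = hg 0 om * cos al.
Proof.
have H0 : J 0 0 al = cos al.
  rewrite /J; under eq_Rintegral do rewrite mulr0 mul0r add0r.
  under eq_Rintegral do rewrite mulrC.
  rewrite RintegralZl//; last exact: hg_itgb.
  under eq_Rintegral do rewrite /hg /hpoly/= mul1r.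
  by rewrite gauss_pi_int mulr1.
pose F x := J 0 x al * expR (pi * x ^+ 2).
have dF x : is_derive x 1 F 0.
  have d := J0_deriv al; rewrite /F; deriv; ring.
have : F om = F 0.
  have [p|/ltW p] := leP 0 om.
    have [c _] := df_MVT p (fun x _ => dF x).
    by rewrite mul0r => /eqP; rewrite subr_eq0 => /eqP.
  have [c _] := df_MVT p (fun x _ => dF x).
  by rewrite mul0r => /eqP; rewrite subr_eq0 => /eqP.
rewrite /F H0 expr0n mulr0 expR0 mulr1 => <-.
rewrite /hg /hpoly/= mul1r mulrCA -expRD addrC subrr.
by rewrite expR0 mulr1.
Qed.

(** [J_rec] is the recurrence [hgS] with the phase moved by a quarter turn at each order, so
    induction yields the eigenvalue as the phase [n * pi / 2]. *)
Lemma hg_fourier n om al : J n om al = hg n om * cos (al + n%:R * (pi / 2)).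
Proof.
have [m] := ubnP n; elim: m n al => // m IH [|n] al nm.
  by rewrite J0E mul0r addr0.
rewrite J_rec (IH n)//.
have -> : al + n.+1%:R * (pi / 2) = al - pi / 2 + n%:R * (pi / 2) + pi by rewrite -natr1; field.
rewrite cosDpi hgS.
case: n nm => [|n] nm; first by rewrite !mul0r !mulr0 !mul0r; ring.
rewrite (IH n _ ltac:(lia)) /=.
have -> : al - pi / 2 + n.+1%:R * (pi / 2) = al + n%:R * (pi / 2) by rewrite -natr1; field.
ring.
Qed.

Lemma hg_eig n x al :
  hg n x * cos al = \int[mu]_om (hg n om * cos (2 * pi * om * x + (al - n%:R * (pi / 2)))).
Proof.
have -> : hg n x * cos al = J n x (al - n%:R * (pi / 2)) by rewrite hg_fourier subrK.
by apply: eq_Rintegral => om _; congr (_ * cos (_ + _)); ring.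
Qed.

End HermiteFunctions.

(** * Solutions of the harmonic oscillator equation *)

Section Oscillator.
Context {R : realType}.
Implicit Types (x y z t : R).
Variables (u v : R -> R) (T : R).
Hypothesis T0 : 0 <= T.
Hypothesis du : forall y, is_derive y 1 u (v y).
Hypothesis dv : forall y, is_derive y 1 v ((y ^+ 2 - T ^+ 2) * u y).
Hypothesis tail : forall e a : R, 0 < e ->
  exists y, [/\ a < y, `|u y * v y| <= e & y ^+ 2 * u y ^+ 2 <= e].

(** Beyond [T] the derivative of [u v] is v^2 + (y^2 - T^2) u^2 >= 0, and [u v] becomes arbitrarily
    small along the points given by [tail]. *)
Lemma uv_le0 y : T <= y -> u y * v y <= 0.
Proof.
move=> Ty; apply/ler_addgt0Pr => e e0; rewrite add0r.
have [z [yz uv _]] := tail y e0.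
apply: (le_trans _ (le_trans (ler_norm _) uv)).
apply: (@df_ge _ (fun y => u y * v y) (fun y => v y ^+ 2 + (y ^+ 2 - T ^+ 2) * u y ^+ 2) _ _ (ltW yz)).
  by move=> x _; deriv; ring.
move=> x /andP[yx _]; apply: addr_ge0; first exact: sqr_ge0.
apply: mulr_ge0; last exact: sqr_ge0.
by rewrite subr_ge0 ler_sqr ?nnegrE ?(le_trans T0)//; apply: le_trans yx.
Qed.

(** The difference of the two sides decreases, with derivative - 2 y u^2, and at the points of
    [tail] it is at least - y^2 u^2. *)
Lemma v_ge y : 0 <= y -> (y ^+ 2 - T ^+ 2) * u y ^+ 2 <= v y ^+ 2.
Proof.
move=> y0; rewrite -subr_ge0; apply/ler_addgt0Pr => e e0.
have [z [yz _ zu]] := tail y e0.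
have H : v z ^+ 2 - (z ^+ 2 - T ^+ 2) * u z ^+ 2 <= v y ^+ 2 - (y ^+ 2 - T ^+ 2) * u y ^+ 2.
  apply: (@df_le _ (fun y => v y ^+ 2 - (y ^+ 2 - T ^+ 2) * u y ^+ 2) (fun y => - (2 * y * u y ^+ 2)) _ _ (ltW yz)).
    by move=> x _; deriv; ring.
  move=> x /andP[yx _]; rewrite oppr_le0; apply: mulr_ge0; last exact: sqr_ge0.
  by rewrite mulr_ge0// (le_trans y0).
rewrite -lerBlDr sub0r; apply: le_trans H; rewrite lerNl opprB mulrBl.
have := sqr_ge0 (v z); have := mulr_ge0 (sqr_ge0 T) (sqr_ge0 (u z)).
by lra.
Qed.

(** [v_ge] gives (u v)^2 >= (phi u^2)^2 and [uv_le0] fixes the sign, so u v <= - phi u^2: exactly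
    what makes u^2 e^(2 Phi) decrease. [Phi] is any phase with slope at most sqrt (y^2 - T^2). *)
Lemma decay (Phi phi : R -> R) y0 y1 : T <= y0 <= y1 ->
  (forall y, is_derive y 1 Phi (phi y)) ->
  (forall y, y0 <= y <= y1 -> 0 <= phi y /\ phi y ^+ 2 <= y ^+ 2 - T ^+ 2) ->
  `|u y1| * expR (Phi y1) <= `|u y0| * expR (Phi y0).
Proof.
move=> /andP[Ty y01] dP phi0.
rewrite -ler_sqr ?nnegrE ?mulr_ge0 ?expR_ge0// !exprMn !(real_normK (num_real _)).
apply: (@df_le _ (fun y => u y ^+ 2 * expR (Phi y) ^+ 2)
  (fun y => 2 * expR (Phi y) ^+ 2 * (u y * v y + phi y * u y ^+ 2)) _ _ y01).
  by move=> x _; deriv; ring.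
move=> y yy; have [p0 pq] := phi0 _ yy; move: yy => /andP[y0y _].
apply: mulr_ge0_le0; first by rewrite mulr_ge0// sqr_ge0.
have Ty' : T <= y := le_trans Ty y0y.
have uv := uv_le0 Ty'; have vy := v_ge (le_trans T0 Ty').
have H : (phi y * u y ^+ 2) ^+ 2 <= (- (u y * v y)) ^+ 2.
  rewrite sqrrN [leRHS]exprMn.
  have -> : (phi y * u y ^+ 2) ^+ 2 = u y ^+ 2 * (phi y ^+ 2 * u y ^+ 2) by ring.
  apply: ler_wpM2l; first exact: sqr_ge0.
  by apply: le_trans vy; apply: ler_wpM2r => //; exact: sqr_ge0.
have h0 : 0 <= - (u y * v y) by rewrite oppr_ge0.
have h1 : 0 <= phi y * u y ^+ 2 by rewrite mulr_ge0// sqr_ge0.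
move: H; rewrite ler_sqr ?nnegrE//.
by lra.
Qed.

Lemma decay_gauss y0 y1 : T <= y0 <= y1 ->
  `|u y1| <= `|u y0| * expR (- (((y1 - T) ^+ 2 - (y0 - T) ^+ 2) / 2)).
Proof.
move=> yy; have /andP[Ty0 y01] := yy.
have dP y : is_derive y 1 (fun y => (y - T) ^+ 2 / 2) (y - T) by deriv; field.
rewrite -(ler_pM2r (expR_gt0 ((y1 - T) ^+ 2 / 2))) -[leRHS]mulrA -expRD.
have -> : - (((y1 - T) ^+ 2 - (y0 - T) ^+ 2) / 2) + (y1 - T) ^+ 2 / 2 = (y0 - T) ^+ 2 / 2 by field.
apply: (decay yy dP).
move=> y /andP[yy0 _]; split; first by rewrite subr_ge0 (le_trans Ty0).
have : 0 <= T * (y - T) by rewrite mulr_ge0// subr_ge0 (le_trans Ty0).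
have -> : y ^+ 2 - T ^+ 2 = (y - T) ^+ 2 + 2 * (T * (y - T)) by ring.
by lra.
Qed.

Lemma decay_exp k y0 y1 : 0 <= k -> k ^+ 2 <= y0 ^+ 2 - T ^+ 2 -> T <= y0 <= y1 ->
  `|u y1| <= `|u y0| * expR (- (k * (y1 - y0))).
Proof.
move=> k0 kT yy; have /andP[Ty0 y01] := yy.
have dP y : is_derive y 1 (fun y => k * y) k by deriv; ring.
rewrite -(ler_pM2r (expR_gt0 (k * y1))) -[leRHS]mulrA -expRD.
have -> : - (k * (y1 - y0)) + k * y1 = k * y0 by ring.
apply: (decay yy dP).
move=> y /andP[yy0 _]; split=> //; apply: (le_trans kT).
by rewrite lerD2r ler_sqr ?nnegrE// (le_trans T0)// (le_trans Ty0).
Qed.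

Lemma u_decr y0 y1 : T <= y0 <= y1 -> `|u y1| <= `|u y0|.
Proof.
move=> yy; apply: (le_trans (decay_gauss yy)); rewrite ler_piMr//.
rewrite -expR0 ler_expR oppr_le0 divr_ge0// subr_ge0.
by case/andP: yy => a b; rewrite ler_sqr ?nnegrE ?subr_ge0 ?lerD2r// (le_trans a).
Qed.

Variable c : R.
Hypothesis c1 : 1 <= c.
Hypothesis Tc : T = c ^+ 3.
Hypothesis uT : 0 < u T.

Let c0 : 0 < c. Proof. exact: lt_le_trans c1. Qed.

Let c0w : 0 <= c. Proof. exact: ltW. Qed.
Let ci : 0 < c^-1. Proof. by rewrite invr_gt0. Qed.
Let uTw : 0 <= u T. Proof. exact: ltW. Qed.

Let cT : c <= T.
Proof. by rewrite Tc -[leLHS]expr1; apply: ler_weXn2l. Qed.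

Lemma u_pos y : T <= y -> 0 <= u y.
Proof.
move=> Ty; rewrite leNgt; apply/negP => uy.
have [z zT z0] : exists2 z, z \in `[T, y] & u z = 0.
  apply: IVT => //; first exact: (df_within (fun x _ => du x)).
  by rewrite ge_min le_max (ltW uy) (ltW uT) orbT.
move: zT; rewrite in_itv/= => zT.
have := u_decr (y0 := z) (y1 := y) zT.
by rewrite z0 normr0 normr_le0 => /eqP u0; rewrite u0 ltxx in uy.
Qed.

Lemma u_le y : T <= y -> u y <= u T.
Proof.
move=> Ty; have := @u_decr T y; rewrite lexx => /(_ Ty).
by rewrite !ger0_norm// ?u_pos.
Qed.

Lemma v_mono y : T <= y -> v T <= v y.
Proof.
move=> Ty; apply: (df_ge Ty (fun x _ => dv x)) => x /andP[Tx _].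
by rewrite mulr_ge0 ?u_pos// subr_ge0 ler_sqr ?nnegrE// (le_trans T0).
Qed.

(** Over the length 1/c beyond [T], [u] stays nonnegative, so somewhere its slope is at least - c
    u(T); on the way from [T] to that point the slope gains at most 3 c^2 u(T) / c, since y^2 - T^2
    <= 3 c^2 there. *)
Lemma vT_ge : - (4 * c * u T) <= v T.
Proof.
have TT : T <= T + c^-1 by rewrite lerDl ltW.
have [z zz e] := df_MVT TT (fun x _ => du x).
have zT : T <= z by case/andP: zz.
have [w ww e2] := df_MVT zT (fun x _ => dv x).
have wT : T <= w by case/andP: ww.
have wc : w - T <= c^-1 by case/andP: zz; case/andP: ww; lra.
have zc : z - T <= c^-1 by case/andP: zz; lra.
have uw := u_le wT; have uw0 := u_pos wT; have un := u_pos TT.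
have wq : w ^+ 2 - T ^+ 2 <= 3 * c ^+ 2.
  have -> : w ^+ 2 - T ^+ 2 = (w - T) * (w + T) by ring.
  have ci1 : c^-1 <= 1 by rewrite invf_le1.
  have ciT : c^-1 <= T := le_trans ci1 (le_trans c1 cT).
  apply: (@le_trans _ _ (c^-1 * (3 * T))).
    by apply: ler_pM; rewrite ?subr_ge0//; lra.
  by have -> : c^-1 * (3 * T) = 3 * c ^+ 2 by rewrite Tc; field; rewrite gt_eqF.
have wq0 : 0 <= w ^+ 2 - T ^+ 2 by rewrite subr_ge0 ler_sqr ?nnegrE// (le_trans T0).
have h : (w ^+ 2 - T ^+ 2) * u w * (z - T) <= 3 * c ^+ 2 * u T * c^-1.
  apply: ler_pM => //; [exact: mulr_ge0|by rewrite subr_ge0|].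
  exact: ler_pM.
have hE : 3 * c ^+ 2 * u T * c^-1 = 3 * c * u T by field; rewrite gt_eqF.
have zE : (T + c^-1 - T) = c^-1 by ring.
move: e; rewrite zE => e.
have : - (c * u T) <= v z.
  rewrite -(ler_pM2r ci) -e; have -> : - (c * u T) * c^-1 = - u T by field; rewrite gt_eqF.
  by lra.
by lra.
Qed.

(** A slope of at least - 4 c u(T) over a length 1 / (8 c) loses at most half of u(T). *)
Lemma u_half y : T <= y <= T + (8 * c)^-1 -> u T / 2 <= u y.
Proof.
move=> /andP[Ty yT]; have [z /andP[Tz _] e] := df_MVT Ty (fun x _ => du x).
have vz := le_trans vT_ge (v_mono Tz).
have h : - (4 * c * u T) * (8 * c)^-1 <= v z * (y - T).
  have [p|n] := leP 0 (v z).
    apply: (@le_trans _ _ 0); last by rewrite mulr_ge0// subr_ge0.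
    by rewrite mulNr oppr_le0 !mulr_ge0 ?invr_ge0 ?mulr_ge0// ltW.
  have n0 : 0 <= - v z by rewrite oppr_ge0 ltW.
  have n1 : - v z <= 4 * c * u T by lra.
  have n2 : 0 <= y - T by rewrite subr_ge0.
  have n3 : y - T <= (8 * c)^-1 by lra.
  by have := ler_pM n0 n2 n1 n3; lra.
have hE : - (4 * c * u T) * (8 * c)^-1 = - (u T / 2) by field; rewrite gt_eqF.
by lra.
Qed.

Lemma cauchy_q y : T - c^-1 <= y <= T -> `|c ^+ 2 + y ^+ 2 - T ^+ 2| <= c ^+ 2.
Proof.
move=> /andP[yl yT].
have ci1 : c^-1 <= 1 by rewrite invf_le1.
have ciT : c^-1 <= T := le_trans ci1 (le_trans c1 cT).
have y0 : 0 <= y by lra.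
have h : (T - y) * (T + y) <= c^-1 * (2 * T) by apply: ler_pM; lra.
have hE : c^-1 * (2 * T) = 2 * c ^+ 2 by rewrite Tc; field; rewrite gt_eqF.
have h0 : 0 <= (T - y) * (T + y) by apply: mulr_ge0; lra.
have -> : c ^+ 2 + y ^+ 2 - T ^+ 2 = c ^+ 2 - (T - y) * (T + y) by ring.
by rewrite ler_norml; apply/andP; split; lra.
Qed.

(** Energy for the layer [[T - 1/c, T]], where [s] degenerates: the frequency is frozen at [c]. Its
    logarithmic derivative is at most [c], so crossing the layer costs at most a factor e. *)
Let G y := c ^+ 2 * u y ^+ 2 + v y ^+ 2.
Let G' y := 2 * (u y * v y) * (c ^+ 2 + y ^+ 2 - T ^+ 2).

Let dG y : is_derive y 1 G (G' y).
Proof. by rewrite /G /G'; deriv; ring. Qed.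

Let G'_le y : T - c^-1 <= y <= T -> `|G' y| <= c * G y.
Proof.
move=> /cauchy_q h; rewrite /G' normrM.
apply: (@le_trans _ _ (`|2 * (u y * v y)| * c ^+ 2)); first by rewrite ler_wpM2l.
rewrite /G !normrM ger0_norm//.
have h1 := sqr_ge0 (c * `|u y| - `|v y|).
rewrite -[u y ^+ 2](real_normK (num_real _)) -[v y ^+ 2](real_normK (num_real _)).
have -> : 2 * (`|u y| * `|v y|) * c ^+ 2 = c * (2 * (c * `|u y|) * `|v y|) by ring.
rewrite ler_pM2l//; lra.
Qed.

Let G_mono y : T - c^-1 <= y <= T ->
  G y <= expR 1 * G T /\ G T <= expR 1 * G y.
Proof.
move=> yy; have /andP[yl yT] := yy.
have Gx x : y <= x <= T -> `|G' x| <= c * G x.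
  by move=> /andP[yx xT]; apply: G'_le; rewrite (le_trans yl).
have e1 : expR (c * (T - y)) <= expR 1.
  by rewrite ler_expR -ler_pdivlMl// mulr1; lra.
have G0 x : 0 <= G x by apply: addr_ge0; rewrite ?sqr_ge0// mulr_ge0 ?sqr_ge0.
split.
  have H : G y * expR (c * y) <= G T * expR (c * T).
    apply: (@df_ge _ (fun x => G x * expR (c * x)) (fun x => (G' x + c * G x) * expR (c * x)) _ _ yT).
      by move=> x _; have d := dG x; deriv; ring.
    move=> x /Gx; rewrite ler_norml => /andP[h _].
    by rewrite mulr_ge0 ?expR_ge0//; lra.
  rewrite -(ler_pM2r (expR_gt0 (c * y))); apply: (le_trans H).
  have -> : expR (c * T) = expR (c * (T - y)) * expR (c * y) by rewrite -expRD; congr expR; ring.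
  rewrite mulrA ler_pM2r ?expR_gt0// mulrC ler_wpM2r//.
have H : G T * expR (- (c * T)) <= G y * expR (- (c * y)).
  apply: (@df_le _ (fun x => G x * expR (- (c * x))) (fun x => (G' x - c * G x) * expR (- (c * x))) _ _ yT).
    by move=> x _; have d := dG x; deriv; ring.
  move=> x /Gx; rewrite ler_norml => /andP[_ h].
  by rewrite mulr_le0_ge0 ?expR_ge0//; lra.
rewrite -(ler_pM2r (expR_gt0 (- (c * T)))); apply: (le_trans H).
have -> : expR (- (c * y)) = expR (c * (T - y)) * expR (- (c * T)) by rewrite -expRD; congr expR; ring.
by rewrite mulrA ler_pM2r ?expR_gt0// mulrC ler_wpM2r.
Qed.

Let GT : c ^+ 2 * u T ^+ 2 <= G T <= 17 * c ^+ 2 * u T ^+ 2.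
Proof.
rewrite /G lerDl sqr_ge0/=.
have v0 : v T <= 0.
  have := uv_le0 (lexx T); rewrite pmulr_rle0//.
have := vT_ge => h; have : (- v T) ^+ 2 <= (4 * c * u T) ^+ 2.
  have n1 : 0 <= - v T by rewrite oppr_ge0.
  have n2 : 0 <= 4 * c * u T by rewrite !mulr_ge0.
  by rewrite ler_sqr ?nnegrE//; lra.
by rewrite sqrrN => h2; lra.
Qed.

(* Squared modulus of the WKB amplitude, with its first-order correction. *)
Let s y := Num.sqrt (T ^+ 2 - y ^+ 2).
Let E y := s y * u y ^+ 2 + v y ^+ 2 / s y.
Let E2 y := E y - y / s y ^+ 3 * (u y * v y).

Let inside y : 0 <= y <= T - c^-1 ->
  [/\ (T - y) * T <= s y ^+ 2, c <= s y & s y ^+ 2 = T ^+ 2 - y ^+ 2].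
Proof.
move=> /andP[y0 yT]; have ci' := ci.
have s2 : s y ^+ 2 = T ^+ 2 - y ^+ 2.
  by rewrite sqr_sqrtr// subr_ge0 ler_sqr ?nnegrE//; lra.
have h : (T - y) * T <= s y ^+ 2.
  rewrite s2; have : 0 <= (T - y) * y by apply: mulr_ge0; lra.
  by have -> : T ^+ 2 - y ^+ 2 = (T - y) * T + (T - y) * y; [ring|lra].
split=> //; have s0 : 0 <= s y by exact: sqrtr_ge0.
rewrite -ler_sqr ?nnegrE//; apply: le_trans h.
have -> : c ^+ 2 = c^-1 * T by rewrite Tc; field; rewrite gt_eqF.
by rewrite ler_wpM2r//; lra.
Qed.

(** Since s >= c, s^3 >= c^3 = T >= y, so the correction has a coefficient at most 1, and |u v| <= E
    / 2 by AM-GM. *)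
Let E2_dev y : 0 <= y <= T - c^-1 -> E y / 2 <= E2 y <= 3 / 2 * E y /\
  `|u y * v y| <= E y / 2.
Proof.
move=> yy; have [h1 h2 h3] := inside yy; have s0 : 0 < s y by apply: lt_le_trans h2.
have uvE : `|u y * v y| <= E y / 2.
  have : 0 <= (s y * `|u y| - `|v y|) ^+ 2 / s y by rewrite divr_ge0 ?sqr_ge0// ltW.
  rewrite normrM /E -[u y ^+ 2](real_normK (num_real _)) -[v y ^+ 2](real_normK (num_real _)).
  have -> : (s y * `|u y| - `|v y|) ^+ 2 / s y =
    s y * `|u y| ^+ 2 + `|v y| ^+ 2 / s y - 2 * (`|u y| * `|v y|) by field; rewrite gt_eqF.
  by lra.
split=> //; have y3 : `|y / s y ^+ 3| <= 1.
  have s0w := ltW s0; case/andP: yy => y0 yT; rewrite ger0_norm; last first.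
    by rewrite divr_ge0// exprn_ge0.
  rewrite ler_pdivrMr ?exprn_gt0// mul1r; apply: (@le_trans _ _ T); first by have ci' := ci; lra.
  by rewrite Tc lerXn2r ?nnegrE.
have : `|y / s y ^+ 3 * (u y * v y)| <= E y / 2.
  by rewrite normrM; apply: le_trans uvE; rewrite ler_piMl.
by rewrite /E2 ler_norml => /andP[? ?]; apply/andP; split; lra.
Qed.

(** The correction is chosen for this: E' = (y / s^3) (v^2 - s^2 u^2) = (y / s^3) (u v)', so in [E2]
    only the derivative of the slowly varying coefficient y / s^3 survives. *)
Let dE2 y : 0 <= y <= T - c^-1 ->
  is_derive y 1 E2 (- ((s y ^+ 3)^-1 + 3 * y ^+ 2 / s y ^+ 5) * (u y * v y)).
Proof.
move=> yy; have [h1 h2 h3] := inside yy; have s0 : 0 < s y by apply: lt_le_trans h2.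
have ds : is_derive y 1 s (- (y / s y)).
  rewrite /s; deriv; first by rewrite -sqrtr_gt0.
  by rewrite -/(s y); field; rewrite gt_eqF.
rewrite /E2 /E; have s00 : s y != 0 by rewrite gt_eqF.
deriv; rewrite ?expf_neq0//.
have -> : y ^+ 2 - T ^+ 2 = - s y ^+ 2 by rewrite h3; ring.
by field.
Qed.

(** The rate 3 / (c (T - y)^2) is integrable up to [T - 1/c], with total at most 3; this bounds the
    growth of [E2] over the whole oscillatory zone by e^3. *)
Let dE2_le y : 0 <= y <= T - c^-1 ->
  `|- ((s y ^+ 3)^-1 + 3 * y ^+ 2 / s y ^+ 5) * (u y * v y)| <= 3 / (c * (T - y) ^+ 2) * E2 y.
Proof.
move=> yy; have [h1 h2 h3] := inside yy; have s0 : 0 < s y by apply: lt_le_trans h2.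
have [/andP[E2l _] uvE] := E2_dev yy; case/andP: (yy) => y0 yT.
have ci' := ci; have zT : 0 < T - y by lra.
have zTw := ltW zT; have s0w := ltW s0.
have p0 : 0 <= (s y ^+ 3)^-1 + 3 * y ^+ 2 / s y ^+ 5.
  by rewrite addr_ge0 ?invr_ge0 ?divr_ge0 ?mulr_ge0 ?exprn_ge0 ?sqr_ge0.
rewrite normrM normrN (ger0_norm p0).
apply: ler_pM => //.
  have -> : (s y ^+ 3)^-1 + 3 * y ^+ 2 / s y ^+ 5 = (s y ^+ 2 + 3 * y ^+ 2) / (s y ^+ 2 * s y ^+ 2 * s y).
    by field; rewrite gt_eqF.
  rewrite ler_pdivrMr ?mulr_gt0// mulrAC ler_pdivlMr ?mulr_gt0//.
  apply: (@le_trans _ _ (3 * T ^+ 2 * (c * (T - y) ^+ 2))).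
    apply: ler_wpM2r; first by rewrite mulr_ge0 ?sqr_ge0.
    rewrite h3.
    have : y ^+ 2 <= T ^+ 2 by rewrite ler_sqr ?nnegrE//; lra.
    by move=> h; lra.
  have -> : 3 * T ^+ 2 * (c * (T - y) ^+ 2) = 3 * (((T - y) * T) * ((T - y) * T) * c) by ring.
  rewrite ler_wpM2l//; apply: ler_pM => //; first by rewrite !mulr_ge0.
  by apply: ler_pM => //; rewrite mulr_ge0.
by lra.
Qed.

Let y1 : R := T - c^-1.

(** Matching point of the two energies: at distance 1/c from [T] one has c <= s <= 2 c, so [E] and
    [G / c] agree up to a factor 2. The 17 is 1 + 4^2 from [vT_ge]. *)
Let E_y1 : (2 * c * expR 1)^-1 * (c ^+ 2 * u T ^+ 2) <= E y1 <= 2 / c * (expR 1 * (17 * c ^+ 2 * u T ^+ 2)).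
Proof.
have ci1 : c^-1 <= 1 by rewrite invf_le1.
have y10 : 0 <= y1 by rewrite subr_ge0; exact: le_trans ci1 (le_trans c1 cT).
have yy : 0 <= y1 <= T - c^-1 by rewrite y10/=.
have [h1 h2 h3] := inside yy; have s0 : 0 < s y1 by apply: lt_le_trans h2.
have s0w := ltW s0.
have yG : T - c^-1 <= y1 <= T by rewrite lexx/= /y1 lerBlDr lerDl ltW.
have [g1 g2] := G_mono yG; have /andP[g3 g4] := GT.
have s2 : s y1 <= 2 * c.
  rewrite -ler_sqr ?nnegrE ?mulr_ge0// h3 /y1.
  have -> : T ^+ 2 - (T - c^-1) ^+ 2 = 2 * c ^+ 2 - c^-1 ^+ 2 by rewrite Tc; field; rewrite gt_eqF.
  by have := sqr_ge0 c^-1; have := sqr_ge0 c; lra.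
have u2 := sqr_ge0 (u y1); have v2 := sqr_ge0 (v y1).
have e1 := expR_gt0 (1 : R).
have si1 : (s y1)^-1 <= c^-1 by rewrite lef_pV2.
have si2 : (2 * c)^-1 <= (s y1)^-1 by rewrite lef_pV2// posrE mulr_gt0.
apply/andP; split.
  apply: (@le_trans _ _ (G y1 / (2 * c))).
    rewrite ler_pdivlMr ?mulr_gt0//.
    have -> : (2 * c * expR 1)^-1 * (c ^+ 2 * u T ^+ 2) * (2 * c) = (expR 1)^-1 * (c ^+ 2 * u T ^+ 2).
      by field; rewrite ?gt_eqF.
    by rewrite ler_pdivrMl//; apply: le_trans g3 g2.
  have -> : G y1 / (2 * c) = c / 2 * u y1 ^+ 2 + v y1 ^+ 2 / (2 * c) by rewrite /G; field; rewrite gt_eqF.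
  rewrite /E; apply: lerD; last by rewrite ler_wpM2l.
  by rewrite ler_wpM2r//; lra.
apply: (@le_trans _ _ (2 / c * G y1)); last first.
  apply: ler_wpM2l; first by rewrite divr_ge0.
  by apply: (le_trans g1); rewrite ler_pM2l.
have -> : 2 / c * G y1 = 2 * c * u y1 ^+ 2 + 2 * (v y1 ^+ 2 / c) by rewrite /G; field; rewrite gt_eqF.
have v2' : 0 <= v y1 ^+ 2 / c by rewrite divr_ge0.
rewrite /E; apply: lerD; first by rewrite ler_wpM2r.
by apply: (@le_trans _ _ (v y1 ^+ 2 / c)); [rewrite ler_wpM2l|lra].
Qed.

(** Gronwall with the explicit primitive [Q] of the rate in [dE2_le], which equals 3 at [y1]. *)
Let E2_mono y : 0 <= y <= y1 -> E2 y <= expR 3 * E2 y1 /\ E2 y1 <= expR 3 * E2 y.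
Proof.
move=> yy; have /andP[y0 yy1] := yy; have ci' := ci.
pose Q x : R := 3 / (c * (T - x)).
have inn x : y <= x <= y1 -> 0 <= x <= T - c^-1 by move=> /andP[? ->]; rewrite (le_trans y0).
have dQ x : y <= x <= y1 -> is_derive x 1 Q (3 / (c * (T - x) ^+ 2)).
  move=> /inn /andP[_ h]; have z0 : T - x != 0 by rewrite gt_eqF//; lra.
  rewrite /Q; deriv; first by rewrite mulf_neq0 // gt_eqF.
  by field; rewrite z0 gt_eqF.
have Q1 : Q y1 = 3.
  rewrite /Q /y1; have -> : T - (T - c^-1) = c^-1 by ring.
  by rewrite divff ?gt_eqF// divr1.
have Q0 : 0 <= Q y <= 3.
  have z : c^-1 <= T - y by rewrite /y1 in yy1; lra.
  have z0 : 0 < T - y by lra.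
  rewrite /Q divr_ge0 ?mulr_ge0 ?(ltW z0)//= ler_pdivrMr ?mulr_gt0//.
  rewrite -[leLHS]mulr1 ler_pM2l// -ler_pdivrMl// mulr1//.
have E20 x : 0 <= x <= y1 -> 0 <= E2 x.
  move=> xx; have [/andP[h _] k] := E2_dev xx; have := normr_ge0 (u x * v x); lra.
have y10 : 0 <= y1 <= y1 by rewrite lexx (le_trans y0).
split.
  have H : E2 y * expR (Q y) <= E2 y1 * expR (Q y1).
    apply: (@df_ge _ (fun x => E2 x * expR (Q x)) (fun x => (- ((s x ^+ 3)^-1 + 3 * x ^+ 2 / s x ^+ 5) * (u x * v x) + 3 / (c * (T - x) ^+ 2) * E2 x) * expR (Q x)) _ _ yy1).
      by move=> x xx; have d1 := dE2 (inn _ xx); have d2 := dQ _ xx; deriv; ring.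
    move=> x /inn xx; have := dE2_le xx; rewrite ler_norml => /andP[h _].
    by rewrite mulr_ge0 ?expR_ge0//; lra.
  rewrite mulrC -Q1; apply: le_trans H; rewrite ler_peMr ?E20//.
  by rewrite -expR0 ler_expR; case/andP: Q0.
have H : E2 y1 * expR (- Q y1) <= E2 y * expR (- Q y).
  apply: (@df_le _ (fun x => E2 x * expR (- Q x)) (fun x => (- ((s x ^+ 3)^-1 + 3 * x ^+ 2 / s x ^+ 5) * (u x * v x) - 3 / (c * (T - x) ^+ 2) * E2 x) * expR (- Q x)) _ _ yy1).
    by move=> x xx; have d1 := dE2 (inn _ xx); have d2 := dQ _ xx; deriv; ring.
  move=> x /inn xx; have := dE2_le xx; rewrite ler_norml => /andP[_ h].
  by rewrite mulr_le0_ge0 ?expR_ge0//; lra.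
rewrite -ler_pdivrMl ?expR_gt0// -expRN mulrC -Q1; apply: (le_trans H).
rewrite ler_piMr ?E20// -expR0 ler_expR oppr_le0.
by case/andP: Q0.
Qed.

(** 102 = 2 (3/2) 34: passing from [E] to [E2] and back costs 2 and 3/2, and [E_y1] contributes 34
    e; e^3 is the growth of [E2]. *)
Definition Cosc : R := 102 * (expR 1 * expR 3).

Lemma Cosc_gt0 : 0 < Cosc.
Proof. by rewrite !mulr_gt0 ?expR_gt0. Qed.

Lemma energy y : 0 <= y <= T - c^-1 ->
  (6 * (expR 1 * expR 3))^-1 * (c * u T ^+ 2) <=
  Num.sqrt (T ^+ 2 - y ^+ 2) * u y ^+ 2 + v y ^+ 2 / Num.sqrt (T ^+ 2 - y ^+ 2)
  <= Cosc * (c * u T ^+ 2).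
Proof.
move=> yy; rewrite -/(s y) -/(E y); have [/andP[h1 h2] _] := E2_dev yy.
have y10 : 0 <= y1 <= T - c^-1 by case/andP: yy => a b; rewrite lexx (le_trans a).
have [/andP[k1 k2] _] := E2_dev y10; have [m1 m2] := E2_mono yy.
have /andP[n1 n2] := E_y1.
have e1 := expR_gt0 (1 : R); have e3 := expR_gt0 (3 : R).
have X0 : 0 <= c * u T ^+ 2 by rewrite mulr_ge0 ?sqr_ge0.
have n2' : E y1 <= 34 * expR 1 * (c * u T ^+ 2).
  by apply: (le_trans n2); rewrite le_eqVlt; apply/orP; left; apply/eqP; field; rewrite gt_eqF.
have n1' : (2 * expR 1)^-1 * (c * u T ^+ 2) <= E y1.
  by apply: le_trans n1; rewrite le_eqVlt; apply/orP; left; apply/eqP; field; rewrite !gt_eqF.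
apply/andP; split.
  rewrite ler_pdivrMl ?mulr_gt0//.
  have : E y1 / 2 <= expR 3 * (3 / 2 * E y).
    by apply: (le_trans k1); apply: (le_trans m2); rewrite ler_pM2l.
  move: n1'; rewrite ler_pdivrMl ?mulr_gt0// => n1'' h.
  have : 2 * expR 1 * E y1 <= 2 * expR 1 * (2 * (expR 3 * (3 / 2 * E y))).
    by rewrite ler_pM2l ?mulr_gt0//; lra.
  by lra.
have h3 : expR 3 * E2 y1 <= expR 3 * (3 / 2 * (34 * expR 1 * (c * u T ^+ 2))).
  by rewrite ler_pM2l//; lra.
by rewrite /Cosc; lra.
Qed.

Hypothesis even : forall y, `|u (- y)| = `|u y|.

(** Evenness brings [p] to the positive side; the term in [v] of the energy is dropped and s^2 >= (T
    - |p|) T >= t T. *)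
Lemma inside_upper p t : c^-1 <= t -> `|p| <= T - t ->
  u p ^+ 2 * Num.sqrt (t * T) <= Cosc * (c * u T ^+ 2).
Proof.
move=> ct pt.
have -> : u p ^+ 2 = u `|p| ^+ 2.
  rewrite -(real_normK (num_real (u p))) -(real_normK (num_real (u `|p|))).
  by case: (ger0P p) => // _; rewrite even.
have pp : 0 <= `|p| <= T - c^-1 by rewrite normr_ge0/=; lra.
have [h1 h2 h3] := inside pp; have /andP[_ h] := energy pp.
apply: le_trans h; rewrite -/(s _) mulrC -[leLHS]addr0; apply: lerD; last first.
  by rewrite divr_ge0 ?sqr_ge0// sqrtr_ge0.
apply: ler_wpM2r; first exact: sqr_ge0.
rewrite /s ler_wsqrtr// -h3; apply: le_trans h1; rewrite ler_wpM2r//; lra.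
Qed.

End Oscillator.

(** * Windows for oscillator solutions *)

Section Sums.
Context {R : realType}.
Implicit Types (f : nat -> R) (F : int -> R).

Lemma bsumE N F : bsum N F = F 0 + \sum_(i < N) (F i.+1%:Z + F (- i.+1%:Z)).
Proof.
elim: N => [|N IH]; first by rewrite /bsum big_ord0 addr0 big_ord1.
by rewrite bsumS IH big_ord_recr/= !addrA.
Qed.

Lemma sum_inv_sq N : \sum_(i < N) (i.+1%:R ^+ 2)^-1 <= 2 :> R.
Proof.
case: N => [|N]; first by rewrite big_ord0.
suff : \sum_(i < N.+1) (i.+1%:R ^+ 2)^-1 <= 2 - N.+1%:R^-1 :> R.
  by move=> h; apply: (le_trans h); rewrite gerBl invr_ge0.
elim: N => [|N IH]; first by rewrite big_ord1 expr1n invr1; lra.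
rewrite big_ord_recr/=; apply: (le_trans (lerD IH (lexx _))).
have p : 0 < (N.+1%:R : R) by rewrite ltr0n.
rewrite -[N.+2%:R]natr1; move: (N.+1%:R : R) p => x p.
rewrite -subr_ge0.
have -> : 2 - (x + 1)^-1 - (2 - x^-1 + ((x + 1) ^+ 2)^-1) = (x * (x + 1) ^+ 2)^-1.
  by field; rewrite !gt_eqF// addr_gt0.
by rewrite invr_ge0 mulr_ge0 ?sqr_ge0// ltW.
Qed.

Lemma sum_inv_sqrt N : \sum_(i < N) (Num.sqrt i.+1%:R)^-1 <= 2 * Num.sqrt N%:R :> R.
Proof.
elim: N => [|N IH]; first by rewrite big_ord0 sqrtr0 mulr0.
rewrite big_ord_recr/=; apply: (le_trans (lerD IH (lexx _))).
have p : 0 < Num.sqrt (N.+1%:R : R) by rewrite sqrtr_gt0 ltr0n.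
rewrite -lerBrDl -mulrBr -div1r ler_pdivrMr//.
have a2 : Num.sqrt (N.+1%:R : R) ^+ 2 = N.+1%:R by rewrite sqr_sqrtr// ler0n.
have b2 : Num.sqrt (N%:R : R) ^+ 2 = N%:R by rewrite sqr_sqrtr// ler0n.
have : Num.sqrt (N.+1%:R : R) ^+ 2 = Num.sqrt N%:R ^+ 2 + 1 by rewrite a2 b2 natr1.
have := sqr_ge0 (Num.sqrt (N.+1%:R : R) - Num.sqrt N%:R).
move: (Num.sqrt _) (Num.sqrt _) => x y; lra.
Qed.

Lemma sum_widen f K N : (forall i, 0 <= f i) -> (K <= N)%N ->
  \sum_(i < K) f i <= \sum_(i < N) f i.
Proof.
move=> f0 /subnK <-; elim: (N - K)%N => [|n IH]; first by rewrite add0n.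
by rewrite addSn big_ord_recr/=; apply: (le_trans IH); rewrite lerDl.
Qed.

Lemma sum_shift f M N : (forall i, 0 <= f i) ->
  \sum_(i < N) (if (M <= i)%N then f (i - M)%N else 0) <= \sum_(i < N) f i.
Proof.
move=> f0; apply: le_trans (sum_widen f0 (leq_subr M N)).
rewrite le_eqVlt; apply/orP; left; apply/eqP.
elim: N => [|N IH]; first by rewrite sub0n !big_ord0.
rewrite big_ord_recr/= IH; case: leqP => h; first by rewrite subSn// big_ord_recr.
by rewrite addr0; have -> : (N.+1 - M = N - M)%N by lia.
Qed.

Lemma sum_trunc f K N : (forall i, 0 <= f i) ->
  \sum_(i < N) (if (i < K)%N then f i else 0) <= \sum_(i < K) f i.
Proof.
move=> f0; apply: le_trans (sum_widen f0 (geq_minr N K)).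
rewrite le_eqVlt; apply/orP; left; apply/eqP.
elim: N => [|N IH]; first by rewrite min0n !big_ord0.
rewrite big_ord_recr/= IH; case: ltnP => h.
  by rewrite (_ : minn N.+1 K = N.+1) ?big_ord_recr//; lia.
by rewrite addr0 (_ : minn N.+1 K = K)//; lia.
Qed.

Lemma sum_point (x : R) (M N : nat) : 0 <= x -> \sum_(i < N) (if (i.+1 == M)%N then x else 0) <= x.
Proof.
move=> x0; have -> : \sum_(i < N) (if (i.+1 == M)%N then x else 0) = if (0 < M <= N)%N then x else 0.
  elim: N => [|N IH]; first by rewrite big_ord0; case: M.
  rewrite big_ord_recr/= IH; case: eqP => h.
    rewrite (_ : (0 < M <= N)%N = false); last by lia.
    by rewrite (_ : (0 < M <= N.+1)%N = true) ?add0r//; lia.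
  by rewrite (_ : (0 < M <= N.+1)%N = (0 < M <= N)%N) ?addr0//; lia.
by case: ifP.
Qed.

Lemma sum_rev_sqrt K : \sum_(i < K) (Num.sqrt (K - i)%:R)^-1 = \sum_(i < K) (Num.sqrt i.+1%:R)^-1 :> R.
Proof.
rewrite (reindex_inj rev_ord_inj)/=; apply: eq_bigr => i _.
by congr (Num.sqrt _%:R)^-1; have := ltn_ord i; lia.
Qed.

Lemma expRN_le_inv (x : R) : 0 < x -> expR (- x) <= x^-1.
Proof.
move=> x0; rewrite expRN lef_pV2 ?posrE ?expR_gt0//.
by apply: le_trans (expR_ge1Dx x); rewrite lerDr.
Qed.

End Sums.

Section Windows.
Context {R : realType}.
Implicit Types (x y z t D A X : R).
Variables (u : R -> R).

(** The hypotheses of [caseI] in the variable rescaled by [gam]: [D] is [gam / b] and [A] is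
    [gam * a]. *)
Definition good_window D X A := exists (kap : R) (eps : int -> R),
  [/\ 0 < kap, (forall m, 0 <= eps m), eps 0 = 0, (forall N, bsum N eps <= 2^-1) &
      (forall y, X <= y <= X + A -> kap <= `|u y|) /\
      (forall m y, m != 0 -> X <= y <= X + A -> `|u (y + m%:~R * D)| <= eps m * `|u y|)].

Variables (v : R -> R) (T : R).
Hypothesis T0 : 0 <= T.
Hypothesis du : forall y, is_derive y 1 u (v y).
Hypothesis dv : forall y, is_derive y 1 v ((y ^+ 2 - T ^+ 2) * u y).
Hypothesis tail : forall e a : R, 0 < e ->
  exists y, [/\ a < y, `|u y * v y| <= e & y ^+ 2 * u y ^+ 2 <= e].
Hypothesis even : forall y, `|u (- y)| = `|u y|.

(** Reflected by evenness, a left alias sits at [j D - y]. Since y - T stays below D / 2 by the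
    margin [rho D], and 2 T <= rho D, this point is farther out than [y] itself, and Gaussian decay
    applies on both sides. *)
Lemma far_window rho D A : 0 < rho -> rho < 1 / 2 -> 0 <= A -> A <= (1 / 2 - rho) * D ->
  0 < D -> 2 * T <= rho * D -> 32 / rho <= D ^+ 2 -> u (T + A) != 0 ->
  good_window D T A.
Proof.
move=> r0 r2 A0 AD D0 TD D2 uA.
have rD : 0 < rho * D ^+ 2 by rewrite mulr_gt0 ?exprn_gt0.
(* The exponents are at least rho m^2 D^2 / 4 and e^(-x) <= 1/x. Both sides together sum to at most
   16 / (rho D^2), which is at most 1/2 by the hypothesis on [D ^+ 2]. *)
pose eps (m : int) : R := if m == 0 then 0 else 4 / (rho * D ^+ 2) / `|m|%:R ^+ 2.
have e0 m : 0 <= eps m.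
  by rewrite /eps; case: eqP => // _; rewrite !divr_ge0 ?sqr_ge0// ltW.
exists `|u (T + A)|, eps; split=> //; first by rewrite normr_gt0.
  move=> N; rewrite bsumE {1}/eps eqxx add0r.
  have -> : \sum_(i < N) (eps i.+1%:Z + eps (- i.+1%:Z)) = 8 / (rho * D ^+ 2) * \sum_(i < N) (i.+1%:R ^+ 2)^-1.
    rewrite mulr_sumr; apply: eq_bigr => i _; rewrite /eps/=.
    by move: (_^-1) (_^-1) => p q; ring.
  apply: (@le_trans _ _ (8 / (rho * D ^+ 2) * 2)).
    by rewrite ler_wpM2l ?sum_inv_sq// divr_ge0// ltW.
  rewrite mulrAC ler_pdivrMr//; move: D2; rewrite ler_pdivrMr// [D ^+ 2 * _]mulrC => h.
  by lra.
split=> [y /andP[Ty yA]|m y m0 /andP[Ty yA]].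
  by apply: (u_decr T0 du dv tail); rewrite Ty.
have key p (j : R) : 1 <= j -> T <= p -> y <= p -> rho * j ^+ 2 * D ^+ 2 / 2 <= (p - T) ^+ 2 - (y - T) ^+ 2 ->
    `|u p| <= 4 / (rho * D ^+ 2) / j ^+ 2 * `|u y|.
  move=> j1 Tp yp h; have yp' : T <= y <= p by rewrite Ty yp.
  apply: (le_trans (decay_gauss T0 du dv tail yp')); rewrite mulrC ler_wpM2r//.
  have j0 : 0 < j by apply: lt_le_trans j1.
  have q0 : 0 < rho * j ^+ 2 * D ^+ 2 / 4 by rewrite divr_gt0// !mulr_gt0 ?exprn_gt0.
  apply: (@le_trans _ _ (expR (- (rho * j ^+ 2 * D ^+ 2 / 4)))).
    by rewrite ler_expR lerN2; lra.
  apply: (le_trans (expRN_le_inv q0)); rewrite le_eqVlt; apply/orP; left; apply/eqP.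
  by field; rewrite !gt_eqF.
rewrite /eps (negbTE m0).
have yT0 : 0 <= y - T by rewrite subr_ge0.
have yT2 : y - T <= (1 / 2 - rho) * D by lra.
have j1 : 1 <= `|m|%:R :> R by rewrite ler1n absz_gt0.
have jD : D <= `|m|%:R * D by rewrite ler_peMl// ltW.
have [mp|mn] := leP 0 m.
  have em : m%:~R = `|m|%:R :> R by rewrite -[in LHS](gez0_abs mp).
  rewrite em; move: (`|m|%:R) j1 jD => j j1 jD; apply: key => //; [lra|lra|].
  have -> : (y + j * D - T) ^+ 2 - (y - T) ^+ 2 = (j * D) ^+ 2 + 2 * ((j * D) * (y - T)) by ring.
  have : 0 <= (j * D) * (y - T) by apply: mulr_ge0; lra.
  have : rho * j ^+ 2 * D ^+ 2 <= 1 * (j * D) ^+ 2.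
    by rewrite exprMn -mulrA ler_wpM2r ?mulr_ge0 ?sqr_ge0//; lra.
  have := sqr_ge0 (j * D); lra.
have em : m%:~R = - `|m|%:R :> R by rewrite -[in LHS](opprK m) -(ltz0_abs mn) mulrNz.
rewrite em -even; have -> : - (y + - `|m|%:R * D) = `|m|%:R * D - y by ring.
move: (`|m|%:R) j1 jD => j j1 jD.
have jr : 0 <= (j - 1) * D * (1 - rho) by rewrite !mulr_ge0//; lra.
have f1 : rho * (j * D) <= j * D - 2 * T - 2 * (y - T) by lra.
have rj : 0 <= rho * (j * D) by rewrite mulr_ge0//; lra.
have f2 : j * D / 2 <= j * D - 2 * T.
  have : rho * D <= 1 / 2 * D by rewrite ler_wpM2r//; lra.
  lra.
apply: key => //; [lra|lra|].
(* The factors are at least j D / 2 and rho j D by [f2] and [f1]. *)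
have -> : (j * D - y - T) ^+ 2 - (y - T) ^+ 2 = (j * D - 2 * T) * (j * D - 2 * T - 2 * (y - T)) by ring.
have := @ler_pM _ (j * D / 2) (j * D - 2 * T) (rho * (j * D)) (j * D - 2 * T - 2 * (y - T)).
have h : 0 <= j * D / 2 by lra.
move=> /(_ h rj f2 f1); lra.
Qed.

Variable c : R.
Hypothesis c1 : 1 <= c.
Hypothesis Tc : T = c ^+ 3.
Hypothesis uT : 0 < u T.

Let c0 : 0 < c. Proof. exact: lt_le_trans c1. Qed.
Let c0w : 0 <= c. Proof. exact: ltW. Qed.
Let T00 : 0 < T. Proof. by rewrite Tc exprn_gt0. Qed.
Variable B : R.
Hypotheses (B0 : 0 < B) (B2 : B ^+ 2 = Cosc).

(* AM-GM linearizes the WKB amplitude [sqrt (c / s)] so that its sum over the aliases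
   is controlled without fractional powers. *)
Lemma inside_le p t r : c^-1 <= t -> `|p| <= T - t -> 0 <= r -> (Num.sqrt (t * T))^-1 <= r ->
  `|u p| <= B / 2 * (c^-1 + c ^+ 2 * r) * u T.
Proof.
move=> ct pt r0 tr; have ci : 0 < c^-1 by rewrite invr_gt0.
have t0 : 0 < t by apply: lt_le_trans ct.
have := inside_upper T0 du dv tail c1 Tc uT even ct pt.
have w0 : 0 < Num.sqrt (t * T) by rewrite sqrtr_gt0 mulr_gt0.
rewrite -ler_pdivlMr// => h.
have rhs0 : 0 <= B / 2 * (c^-1 + c ^+ 2 * r) * u T.
  by rewrite !mulr_ge0 ?addr_ge0 ?divr_ge0 ?mulr_ge0 ?sqr_ge0// ltW.
rewrite -ler_sqr ?nnegrE// real_normK ?num_real//; apply: (le_trans h).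
apply: (@le_trans _ _ (Cosc * (c * u T ^+ 2) * r)).
  by rewrite ler_wpM2l// !mulr_ge0 ?sqr_ge0// ltW// Cosc_gt0.
rewrite !exprMn B2.
have -> : Cosc * (c * u T ^+ 2) * r = Cosc * u T ^+ 2 * (c * r) by ring.
have -> : Cosc * 2^-1 ^+ 2 * (c^-1 + c ^+ 2 * r) ^+ 2 * u T ^+ 2 =
  Cosc * u T ^+ 2 * ((c^-1 + c ^+ 2 * r) ^+ 2 / 4).
  by field; rewrite gt_eqF.
apply: ler_wpM2l; first by rewrite mulr_ge0 ?sqr_ge0// ltW// Cosc_gt0.
have -> : (c^-1 + c ^+ 2 * r) ^+ 2 / 4 = c * r + (c^-1 - c ^+ 2 * r) ^+ 2 / 4.
  by field; rewrite gt_eqF.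
by rewrite lerDl divr_ge0 ?sqr_ge0.
Qed.

Section Near.
Variables (M : nat) (kap X A D : R).
Hypotheses (kap0 : 0 < kap) (kap1 : kap <= 1).
Hypothesis Dlarge : 80 * (B + 1) / kap * c ^+ 2 <= D.
Hypothesis near : forall y, X <= y <= X + A -> `|y - T| <= D / 8 /\ kap * u T <= `|u y|.
Hypothesis MT : `|M%:R * D - 2 * T| <= D / 2.
Hypothesis nearest : (0 < M)%N -> forall y, X <= y <= X + A ->
  `|u (M%:R * D - y)| <= kap / 8 * u T.

Let k1 : 1 <= kap^-1. Proof. by rewrite invf_ge1. Qed.
Let k0w : 0 <= kap^-1. Proof. by rewrite invr_ge0 ltW. Qed.
Let c21 : 1 <= c ^+ 2. Proof. exact: exprn_ege1. Qed.

Let D80 : 80 / kap <= D.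
Proof.
apply: le_trans Dlarge.
have -> : 80 * (B + 1) / kap * c ^+ 2 = 80 / kap * ((B + 1) * c ^+ 2) by ring.
rewrite ler_peMr//; first by rewrite divr_ge0 ?ler0n// ltW.
by rewrite mulr_ege1// lerDr ltW.
Qed.

Let D0 : 0 < D.
Proof. by apply: lt_le_trans D80; rewrite divr_gt0 ?ltr0n. Qed.

Let D0w : 0 <= D. Proof. exact: ltW. Qed.

(** Aliases fall into three classes: beyond a turning point ([tailf]), the alias number [M] that is
    nearest to [-T] (1/8), and those strictly inside the oscillatory zone ([midf]). The budget of
    1/2 is split into four parts of 1/8: right tail, left tail, alias [M], inside. *)
Let tailf (i : nat) : R := 32 / (kap * D ^+ 2) / i.+1%:R ^+ 2.
(** The alias [j.+1] keeps distance at least m D / 4 from both turning points, with m the smaller of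
    [j.+1] and [M - j.+1]. Adding both inverse roots dominates that of the minimum and is summed
    without cases. *)
Let r (j : nat) : R := 2 / Num.sqrt (T * D) * ((Num.sqrt j.+1%:R)^-1 + (Num.sqrt (M.-1 - j)%:R)^-1).
Let midf (j : nat) : R := B / 2 * (c^-1 + c ^+ 2 * r j) / kap.

Let negf (j : nat) : R := (if (M <= j)%N then tailf (j - M) else 0) +
  (if (j.+1 == M)%N then 8^-1 else 0) + (if (j < M.-1)%N then midf j else 0).

Let eps (m : int) : R := match m with
  | Posz 0 => 0 | Posz j.+1 => tailf j | Negz j => negf j end.

Let r0 j : 0 <= r j.
Proof. by rewrite mulr_ge0 ?divr_ge0 ?addr_ge0 ?invr_ge0 ?sqrtr_ge0. Qed.

Let tailf0 j : 0 <= tailf j.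
Proof. by rewrite !divr_ge0 ?sqr_ge0// mulr_ge0 ?sqr_ge0// ltW. Qed.

Let midf0 j : 0 <= midf j.
Proof.
by rewrite mulr_ge0// mulr_ge0 ?divr_ge0 ?addr_ge0 ?mulr_ge0 ?invr_ge0 ?sqr_ge0// ltW.
Qed.

(** Gaussian decay from [T] over a length j D / 4, with e^(-x) <= 1/x; the 32 is 2 times 4^2. *)
Let outside p t j : 1 <= j -> j * D / 4 <= t -> T + t <= p -> `|u p| <= 32 / D ^+ 2 / j ^+ 2 * u T.
Proof.
move=> j1 jt tp; have j0 : 0 < j by apply: lt_le_trans j1.
have jD : 0 < j * D / 4 by rewrite divr_gt0// mulr_gt0.
have Tp : T <= T <= p by rewrite lexx/=; lra.
apply: (le_trans (decay_gauss T0 du dv tail Tp)).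
rewrite (gtr0_norm uT) mulrC ler_wpM2r//; first exact: ltW.
rewrite subrr expr0n subr0.
apply: (@le_trans _ _ (expR (- ((j * D / 4) ^+ 2 / 2)))).
  rewrite ler_expR lerN2 ler_wpM2r// ler_sqr ?nnegrE ?(ltW jD)//; lra.
have q0 : 0 < (j * D / 4) ^+ 2 / 2 by rewrite divr_gt0// exprn_gt0.
apply: (le_trans (expRN_le_inv q0)); rewrite le_eqVlt; apply/orP; left; apply/eqP.
by field; rewrite !gt_eqF.
Qed.

Let tail_le p t j y : X <= y <= X + A -> j.+1%:R * D / 4 <= t -> T + t <= p ->
  `|u p| <= tailf j * `|u y|.
Proof.
move=> yX jt tp; have [_ ky] := near yX.
apply: (le_trans (outside _ jt tp)); first by rewrite ler1n.
rewrite /tailf; have -> : 32 / D ^+ 2 / j.+1%:R ^+ 2 * u T =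
    32 / (kap * D ^+ 2) / j.+1%:R ^+ 2 * (kap * u T).
  by field; rewrite !gt_eqF//= ?ltr0n.
by rewrite ler_wpM2l// tailf0.
Qed.

Let mid_le j y : X <= y <= X + A -> (j.+1 < M)%N -> `|u (j.+1%:R * D - y)| <= midf j * `|u y|.
Proof.
move=> yX jM; have [yT ky] := near yX.
pose m := minn j.+1 (M.-1 - j).
have [mn1 mn2 mn3] : [/\ 0 < m, m <= j.+1 & m <= M - j.+1]%N.
  by rewrite /m; move: jM; clear; split; lia.
have m1 : 1 <= m%:R :> R by rewrite ler1n.
have mj : m%:R <= j.+1%:R :> R by rewrite ler_nat.
have mM : m%:R <= M%:R - j.+1%:R :> R by rewrite -natrB ?ler_nat// ltnW.
have m0 : 0 < (m%:R : R) by apply: lt_le_trans m1.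
have mjD : m%:R * D <= j.+1%:R * D by rewrite ler_wpM2r.
have mMD : m%:R * D <= M%:R * D - j.+1%:R * D by rewrite -mulrBl ler_wpM2r.
have D1 : D <= m%:R * D by rewrite ler_peMl.
have pt : `|j.+1%:R * D - y| <= T - m%:R * D / 4.
  move: yT MT; rewrite !ler_norml => /andP[? ?] /andP[? ?]; apply/andP; split; lra.
have ct : c^-1 <= m%:R * D / 4.
  have ci1 : c^-1 <= 1 by rewrite invf_le1.
  have : 80 <= D by apply: le_trans D80; rewrite ler_peMr.
  by lra.
have tr : (Num.sqrt (m%:R * D / 4 * T))^-1 <= r j.
  have -> : m%:R * D / 4 * T = (2^-1) ^+ 2 * (m%:R * (T * D)) by field.
  rewrite sqrtrM ?sqr_ge0// sqrtr_sqr ger0_norm// sqrtrM ?(ltW m0)//.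
  have TD0 : 0 < Num.sqrt (T * D) by rewrite sqrtr_gt0 mulr_gt0.
  have -> : (2^-1 * (Num.sqrt m%:R * Num.sqrt (T * D)))^-1 = 2 / Num.sqrt (T * D) * (Num.sqrt m%:R)^-1.
    by field; rewrite !gt_eqF// sqrtr_gt0.
  rewrite /r ler_wpM2l ?divr_ge0 ?(ltW TD0)// /m.
  case: (leqP j.+1 (M.-1 - j)) => h; first by rewrite lerDl invr_ge0 sqrtr_ge0.
  by rewrite lerDr invr_ge0 sqrtr_ge0.
apply: (le_trans (inside_le ct pt (r0 j) tr)).
rewrite /midf; set w := B / 2 * _.
have w0 : 0 <= w by rewrite mulr_ge0 ?divr_ge0 ?addr_ge0 ?mulr_ge0 ?invr_ge0 ?sqr_ge0 ?(ltW B0).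
have -> : w / kap * `|u y| = w * (`|u y| / kap) by ring.
by apply: ler_wpM2l => //; rewrite ler_pdivlMr// mulrC.
Qed.

Let tail_sum N : \sum_(i < N) tailf i <= 8^-1.
Proof.
rewrite -mulr_sumr; apply: (@le_trans _ _ (32 / (kap * D ^+ 2) * 2)).
  by rewrite ler_wpM2l ?sum_inv_sq// divr_ge0// mulr_ge0 ?sqr_ge0// ltW.
rewrite mulrAC ler_pdivrMr ?mulr_gt0 ?exprn_gt0//.
have : 80 <= kap * D by rewrite -ler_pdivrMl// mulrC.
have : 80 <= D by apply: le_trans D80; rewrite ler_peMr.
by move=> h1 h2; have := ler_pM (_ : 0 <= 80) (_ : 0 <= 80) h2 h1; rewrite !ler0n => /(_ isT isT); lra.
Qed.

(** There are at most 4 T / D inner aliases. The terms 1/c add up to 4 c^2 / D and the terms c^2 r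
    to 16 c^2 / D, so the sum is at most 10 B c^2 / (kap D); this is where the 80 in [Dlarge] comes
    from. *)
Let mid_sum : \sum_(i < M.-1) midf i <= 8^-1.
Proof.
have [M0|M0] := posnP M; first by rewrite M0 big_ord0.
have M4 : M%:R <= 4 * (T / D).
  move: MT; rewrite ler_norml => /andP[_ h].
  have M1 : D <= M%:R * D by rewrite ler_peMl// ler1n.
  by rewrite mulrA ler_pdivlMr//; lra.
have TD0 : 0 < T / D by rewrite divr_gt0.
have sT0 : 0 < Num.sqrt T by rewrite sqrtr_gt0.
have sD0 : 0 < Num.sqrt D by rewrite sqrtr_gt0.
have sM : Num.sqrt M.-1%:R <= 2 * (Num.sqrt T / Num.sqrt D).
  rewrite -ler_sqr ?nnegrE ?sqrtr_ge0 ?mulr_ge0 ?divr_ge0 ?sqrtr_ge0//.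
  rewrite sqr_sqrtr ?ler0n// !exprMn exprVn !sqr_sqrtr// ?(ltW T00)//.
  apply: (@le_trans _ _ M%:R); first by rewrite ler_nat leq_pred.
  by have -> : 2 ^+ 2 * (T / D) = 4 * (T / D) by ring.
have -> : \sum_(i < M.-1) midf i = B / 2 / kap * (c^-1 * M.-1%:R + c ^+ 2 * \sum_(i < M.-1) r i).
  have -> : c^-1 * M.-1%:R = \sum_(i < M.-1) c^-1 by rewrite sumr_const card_ord mulr_natr.
  rewrite [c ^+ 2 * _]mulr_sumr -big_split mulr_sumr.
  by apply: eq_bigr => i _; rewrite /midf/=; ring.
have rs : \sum_(i < M.-1) r i <= 16 / D.
  rewrite -mulr_sumr big_split/= sum_rev_sqrt.
  have sTD : Num.sqrt (T * D) = Num.sqrt T * Num.sqrt D by rewrite sqrtrM// ltW.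
  have h := @sum_inv_sqrt R M.-1.
  apply: (@le_trans _ _ (2 / Num.sqrt (T * D) * (2 * (2 * (2 * (Num.sqrt T / Num.sqrt D)))))).
    by rewrite ler_wpM2l ?divr_ge0 ?sqrtr_ge0//; lra.
  rewrite sTD -[D in leRHS](sqr_sqrtr D0w).
  by rewrite le_eqVlt; apply/orP; left; apply/eqP; field; rewrite !gt_eqF.
have cM : c^-1 * M.-1%:R <= 4 * c ^+ 2 / D.
  apply: (@le_trans _ _ (c^-1 * (4 * (T / D)))).
    rewrite ler_wpM2l ?invr_ge0//; apply: le_trans M4; rewrite ler_nat leq_pred//.
  by rewrite Tc le_eqVlt; apply/orP; left; apply/eqP; field; rewrite !gt_eqF.
have h : c^-1 * M.-1%:R + c ^+ 2 * \sum_(i < M.-1) r i <= 20 * c ^+ 2 / D.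
  have : c ^+ 2 * \sum_(i < M.-1) r i <= c ^+ 2 * (16 / D) by rewrite ler_wpM2l ?sqr_ge0.
  by move=> h; apply: (le_trans (lerD cM h)); rewrite le_eqVlt; apply/orP; left; apply/eqP; ring.
apply: (@le_trans _ _ (B / 2 / kap * (20 * c ^+ 2 / D))).
  by rewrite ler_wpM2l// divr_ge0 ?divr_ge0 ?(ltW B0) ?(ltW kap0).
have -> : B / 2 / kap * (20 * c ^+ 2 / D) = (80 * B / kap * c ^+ 2) / D / 8.
  by field; rewrite !gt_eqF.
rewrite ler_pdivrMr// mulVf// ler_pdivrMr// mul1r; apply: le_trans Dlarge.
rewrite ler_wpM2r ?sqr_ge0// ler_wpM2r// ler_wpM2l//; lra.
Qed.

Theorem near_window : good_window D X A.
Proof.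
exists (kap * u T), eps; split.
- exact: mulr_gt0.
- by case=> [[|j]|j] //=; rewrite !addr_ge0//; case: ifP.
- by [].
- move=> N; rewrite bsumE add0r big_split/=.
  have h1 := tail_sum N.
  have h2 : \sum_(i < N) eps (- i.+1%:Z) <= 8^-1 + 8^-1 + 8^-1.
    rewrite !big_split/=; apply: lerD; [apply: lerD|].
    - exact: le_trans (sum_shift M N tailf0) (tail_sum N).
    - by apply: sum_point; rewrite invr_ge0.
    - exact: le_trans (sum_trunc M.-1 N midf0) mid_sum.
  by apply: (le_trans (lerD h1 h2)); lra.
split=> [y yX|m y m0 yX]; first by have [] := near yX.
have [yT ky] := near yX.
have /andP[yT1 yT2] : - (D / 8) <= y - T <= D / 8 by rewrite -ler_norml.
have /andP[MT1 MT2] : - (D / 2) <= M%:R * D - 2 * T <= D / 2 by rewrite -ler_norml.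
case: m m0 => [[|j]|j] //= _.
  have jD : D <= j.+1%:R * D by rewrite ler_peMl// ler1n.
  apply: (@tail_le _ (j.+1%:R * D / 4) j y yX) => //.
  by rewrite -[(Posz j.+1)%:~R]/(j.+1%:R : R); lra.
rewrite NegzE mulrNz mulNr -even; have -> : - (y - j.+1%:~R * D) = j.+1%:R * D - y by ring.
have z0 := normr_ge0 (u y).
have n1 : 0 <= (if (M <= j)%N then tailf (j - M) else 0) by case: ifP.
have n2 : 0 <= (if (j.+1 == M)%N then 8^-1 else 0) :> R by case: ifP.
have n3 : 0 <= (if (j < M.-1)%N then midf j else 0) by case: ifP.
rewrite /negf.
have [jM|Mj|jM] := ltngtP j.+1 M.
- have -> : (M <= j)%N = false by move: jM; clear; lia.
  have -> : (j < M.-1)%N by move: jM; clear; lia.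
  by rewrite !add0r; exact: mid_le.
- have -> : (M <= j)%N by move: Mj; clear; lia.
  have -> : (j < M.-1)%N = false by move: Mj; clear; lia.
  rewrite !addr0; apply: (@tail_le _ (((j - M).+1%:R * D) / 4) (j - M) y yX) => //.
  have e : (j - M).+1%:R = j.+1%:R - M%:R :> R by rewrite -natrB; [congr _%:R; move: Mj; clear; lia|move: Mj; clear; lia].
  have i1 : D <= (j - M).+1%:R * D by rewrite ler_peMl// ler1n.
  have : (j - M).+1%:R * D = j.+1%:R * D - M%:R * D by rewrite e mulrBl.
  by lra.
- have -> : (M <= j)%N = false by move: jM; clear; lia.
  have -> : (j < M.-1)%N = false by move: jM; clear; lia.
  rewrite add0r addr0 jM; have M0 : (0 < M)%N by move: jM; clear; lia.
  (* For this alias smallness is a hypothesis, [nearest]: it depends on where the window was put. *)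
  apply: (le_trans (nearest M0 yX)); lra.
Qed.

End Near.

End Windows.

(** * The window at the turning point, or just inside it *)

Section InnerWindow.
Context {R : realType}.
Implicit Types (x y z t D A X : R).
Variables (u v : R -> R) (T : R).
Hypothesis T0 : 0 <= T.
Hypothesis du : forall y, is_derive y 1 u (v y).
Hypothesis dv : forall y, is_derive y 1 v ((y ^+ 2 - T ^+ 2) * u y).
Hypothesis tail : forall e a : R, 0 < e ->
  exists y, [/\ a < y, `|u y * v y| <= e & y ^+ 2 * u y ^+ 2 <= e].
Hypothesis even : forall y, `|u (- y)| = `|u y|.
Variable c : R.
Hypothesis c1 : 1 <= c.
Hypothesis Tc : T = c ^+ 3.
Hypothesis uT : 0 < u T.

Let c0 : 0 < c. Proof. exact: lt_le_trans c1. Qed.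
Let c0w : 0 <= c. Proof. exact: ltW. Qed.
Let T00 : 0 < T. Proof. by rewrite Tc exprn_gt0. Qed.
Variable B : R.
Hypotheses (B0 : 0 < B) (B2 : B ^+ 2 = Cosc).

(** The first half of the gap [k / c] is spent on reaching a decay rate of at least c sqrt k; the
    second half then gives the exponent k^(3/2) / 2 >= k / 2. *)
Lemma gap_decay k p : 1 <= k -> T + k / c <= p -> `|u p| <= expR (- (k / 2)) * u T.
Proof.
move=> k1 kp; have k0 : 0 < k by apply: lt_le_trans k1.
have kc : 0 < k / c by rewrite divr_gt0.
have s1 : 1 <= Num.sqrt k by rewrite -[leLHS]sqrtr1 ler_wsqrtr.
have q0 : 0 <= c * Num.sqrt k by rewrite mulr_ge0// sqrtr_ge0.
have qq : (c * Num.sqrt k) ^+ 2 <= (T + k / c / 2) ^+ 2 - T ^+ 2.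
  rewrite exprMn sqr_sqrtr ?(ltW k0)//.
  have -> : c ^+ 2 * k = T * (k / c) by rewrite Tc; field; rewrite gt_eqF.
  by have := sqr_ge0 (k / c); lra.
have yy : T <= T + k / c / 2 <= p by apply/andP; split; lra.
apply: (le_trans (decay_exp T0 du dv tail q0 qq yy)).
have h1 : `|u (T + k / c / 2)| <= u T.
  rewrite -[leRHS](gtr0_norm uT); apply: (u_decr T0 du dv tail).
  by rewrite lexx/=; lra.
rewrite mulrC; apply: ler_pM; rewrite ?expR_ge0// ler_expR lerN2.
have h2 : k / c / 2 <= p - (T + k / c / 2) by lra.
apply: (@le_trans _ _ (c * Num.sqrt k * (k / c / 2))); last by rewrite ler_wpM2l.
have -> : c * Num.sqrt k * (k / c / 2) = Num.sqrt k * (k / 2) by field; rewrite gt_eqF.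
by rewrite ler_peMl// divr_ge0// ltW.
Qed.

Section Inner.
Variables (K A D : R).
(** At depth K / c inside [T], s is at least sqrt (K) c = 16^2 Cosc c, so [inside_upper] gives |u|
    <= u(T) / 16. The 160 K in [Dlarge] is 80 / kap for the smaller of the two values 1/2 and 1 / (2
    K) of [kap] used below. *)
Hypotheses (KE : K = (16 ^+ 2 * Cosc) ^+ 2) (cK : 5 * K <= c).
Hypothesis Dlarge : 160 * K * (B + 1) * c ^+ 2 <= D.
Hypotheses (Asmall : A <= (8 * K ^+ 2 * c)^-1).

Let C16 : 16 <= Cosc :> R.
Proof.
have e1 : 1 <= expR 1 :> R by rewrite -expR0 ler_expR.
have e3 : 1 <= expR 3 :> R by rewrite -expR0 ler_expR.
by have := mulr_ege1 e1 e3; rewrite /Cosc; lra.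
Qed.

Let KC : 20 * Cosc <= K.
Proof.
have C1 := C16; rewrite KE; move: (Cosc : R) C1 => C C1.
have -> : (16 ^+ 2 * C) ^+ 2 = 20 * C + C * (16 ^+ 4 * C - 20) by ring.
have h : 16 ^+ 2 <= 16 ^+ 4 :> R by rewrite ler_weXn2l//; lra.
have h2 : 16 ^+ 2 * C <= 16 ^+ 4 * C by apply: ler_wpM2r => //; lra.
by rewrite lerDl mulr_ge0; lra.
Qed.

Let K64 : 64 <= K.
Proof. by have := C16; have := KC; lra. Qed.

Let D40 : 40 * K <= D.
Proof.
have k := K64; apply: le_trans Dlarge.
have b1 : 1 <= (B + 1) * c ^+ 2.
  by apply: mulr_ege1; [rewrite lerDr; exact: ltW|exact: exprn_ege1].
have -> : 160 * K * (B + 1) * c ^+ 2 = 40 * K + 40 * K * (4 * ((B + 1) * c ^+ 2) - 1) by ring.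
by rewrite lerDl mulr_ge0; lra.
Qed.

Let Ac : A <= c^-1 / 8.
Proof.
have k := K64; have -> : c^-1 / 8 = (8 * 1 * c)^-1 by field; rewrite gt_eqF.
apply: (le_trans Asmall).
have K2 : 1 <= K ^+ 2 by apply: exprn_ege1; lra.
have p1 : 0 < 8 * 1 * c by rewrite !mulr_gt0.
have p2 : 0 < 8 * K ^+ 2 * c by apply: mulr_gt0 => //; lra.
rewrite lef_pV2 ?posrE//; apply: ler_wpM2r => //; lra.
Qed.

Let Kc : 0 < K / c.
Proof. by have k := K64; apply: divr_gt0 => //; lra. Qed.

Let ci : c^-1 <= 1. Proof. by rewrite invf_le1. Qed.
Let ci0 : 0 < c^-1. Proof. by rewrite invr_gt0. Qed.
Let Kc1 : K / c <= 5^-1. Proof. by have h := cK; rewrite ler_pdivrMr ?c0//; lra. Qed.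
Let ciK : c^-1 <= K / c.
Proof. by have k := K64; rewrite ler_peMl ?(ltW ci0)//; lra. Qed.

Let large_of k (k1 : 80 / k <= 160 * K) : 0 < k -> 80 * (B + 1) / k * c ^+ 2 <= D.
Proof.
move=> k0; apply: le_trans Dlarge.
have -> : 80 * (B + 1) / k * c ^+ 2 = (80 / k) * ((B + 1) * c ^+ 2) by ring.
have -> : 160 * K * (B + 1) * c ^+ 2 = 160 * K * ((B + 1) * c ^+ 2) by ring.
apply: ler_wpM2r => //; apply: mulr_ge0; last exact: exprn_ge0.
by have := B0; lra.
Qed.

(** Alias [M] misses the turning point by more than K / c after allowing for the window length.
    Outside it is damped by e^(- K / 2) <= 2 / K; inside, [K] was chosen so that the amplitude is
    below u(T) / 16. *)
Lemma window_at_turning M : `|M%:R * D - 2 * T| <= D / 2 ->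
  ((0 < M)%N -> 2 * (K / c) <= `|M%:R * D - 2 * T|) -> good_window u D T A.
Proof.
move=> MT far; have k := K64; have d := D40; have a := Ac; have i1 := ci; have i0 := ci0.
have kc1 := Kc1; have kc := Kc; have ick := ciK.
have near : forall y, T <= y <= T + A -> `|y - T| <= D / 8 /\ 2^-1 * u T <= `|u y|.
  move=> y /andP[Ty yA]; split.
    by rewrite ger0_norm ?subr_ge0//; lra.
  have c8 : (8 * c)^-1 = c^-1 / 8 by field; rewrite gt_eqF.
  have yT : T <= y <= T + (8 * c)^-1 by rewrite Ty c8/=; lra.
  have h := u_half T0 du dv tail c1 Tc uT yT.
  by rewrite (ger0_norm (u_pos T0 du dv tail uT Ty)); lra.
have l := @large_of 2^-1 ltac:(lra) ltac:(lra).
have h0 : 0 < 2^-1 :> R by [].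
have h1 : 2^-1 <= 1 :> R by lra.
apply: (near_window T0 du dv tail even c1 Tc uT B0 B2 h0 h1 l near MT).
move=> M0 y /andP[Ty yA]; have -> : 2^-1 / 8 = 16^-1 :> R by field.
have MD : D <= M%:R * D by rewrite ler_peMl ?ler1n//; lra.
have [h|h] : 2 * (K / c) <= M%:R * D - 2 * T \/ M%:R * D - 2 * T <= - (2 * (K / c)).
  by move: (far M0); rewrite real_ler_normr ?num_real// => /orP[]; [left|right; lra].
  have p : T + K / c <= M%:R * D - y by lra.
  have K1 : 1 <= K by lra.
  apply: (le_trans (gap_decay K1 p)); apply: ler_wpM2r; first exact: ltW.
  have K2 : 0 < K / 2 by lra.
  apply: (le_trans (expRN_le_inv K2)); rewrite lef_pV2 ?posrE//; lra.
have pT : `|M%:R * D - y| <= T - K / c by rewrite ler_norml; apply/andP; split; lra.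
have := inside_upper T0 du dv tail c1 Tc uT even ciK pT.
have -> : K / c * T = (16 ^+ 2 * Cosc * c) ^+ 2.
  by rewrite Tc KE; field; rewrite gt_eqF.
rewrite sqrtr_sqr ger0_norm; last by rewrite !mulr_ge0 ?sqr_ge0// ltW// Cosc_gt0.
have -> : u (M%:R * D - y) ^+ 2 * (16 ^+ 2 * Cosc * c) = (Cosc * c) * (16 * u (M%:R * D - y)) ^+ 2 by ring.
rewrite mulrA ler_pM2l ?mulr_gt0 ?Cosc_gt0// => h2.
have : `|16 * u (M%:R * D - y)| <= u T.
  rewrite -ler_sqr ?nnegrE ?normr_ge0 ?(ltW uT)//.
  by rewrite real_normK ?num_real.
by rewrite normrM ger0_norm//; lra.
Qed.

Let zone y : T - (4 * K + 2) / c <= y <= T - (4 * K) / c ->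
  [/\ 0 <= y <= T - c^-1, c <= Num.sqrt (T ^+ 2 - y ^+ 2) & Num.sqrt (T ^+ 2 - y ^+ 2) <= 4 * K * c].
Proof.
move=> /andP[y1 y2]; have k := K64; have i1 := ci; have i0 := ci0.
have cT : c <= T by rewrite Tc -[leLHS]expr1; apply: ler_weXn2l.
have z1 : (4 * K + 2) / c <= 4 * K + 2 by rewrite ler_pdivrMr// ler_peMr//; lra.
have z2 : c^-1 <= 4 * K / c by rewrite mulrC ler_peMr//; lra.
have z3 : c^-1 * T = c ^+ 2 by rewrite Tc; field; rewrite gt_eqF.
have z4 : (4 * K + 2) / c * T = (4 * K + 2) * c ^+ 2 by rewrite Tc; field; rewrite gt_eqF.
have cK' := cK; have y0 : 0 <= y by lra.
have E : T ^+ 2 - y ^+ 2 = (T - y) * (T + y) by ring.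
have kk : 64 * K <= K ^+ 2 by rewrite expr2 ler_wpM2r//; lra.
split; first by rewrite y0/=; lra.
  rewrite -[leLHS]ger0_norm// -sqrtr_sqr ler_wsqrtr// E -z3.
  by apply: ler_pM => //; lra.
rewrite -[leRHS]ger0_norm; last by apply: mulr_ge0 => //; lra.
rewrite -sqrtr_sqr ler_wsqrtr// E.
apply: (@le_trans _ _ ((4 * K + 2) / c * (2 * T))); first by apply: ler_pM; lra.
have -> : (4 * K + 2) / c * (2 * T) = 2 * ((4 * K + 2) / c * T) by ring.
rewrite z4 exprMn mulrA; apply: ler_wpM2r; first exact: sqr_ge0.
by rewrite exprMn; lra.
Qed.

(** If |u| were below u(T) / K on an interval of length 1/c, the mean value theorem would give a
    point where the slope is below 2 c u(T) / K as well; there both terms of the energy are too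
    small for the lower bound in [energy]. *)
Let amplitude : exists2 y, T - (4 * K + 2) / c <= y <= T - (4 * K + 1) / c & u T / K <= `|u y|.
Proof.
have k := K64; have i0 := ci0; apply: contrapT => H.
have small y : T - (4 * K + 2) / c <= y <= T - (4 * K + 1) / c -> `|u y| < u T / K.
  by move=> yy; rewrite ltNge; apply/negP => h; apply: H; exists y.
set ya := T - (4 * K + 2) / c in small H.
have yb : T - (4 * K + 1) / c = ya + c^-1 by rewrite /ya; ring.
rewrite yb in small H.
have yab : ya <= ya + c^-1 by lra.
have [z zz e] := df_MVT yab (fun x _ => du x).
have uz := small z zz.
have u1 : `|u ya| < u T / K by apply: small; rewrite lexx.
have u2 : `|u (ya + c^-1)| < u T / K by apply: small; rewrite lexx andbT.
have vz : `|v z| <= 2 * c * (u T / K).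
  have : `|v z * c^-1| <= u T / K + u T / K.
    have -> : v z * c^-1 = u (ya + c^-1) - u ya by rewrite e; congr (_ * _); ring.
    by apply: (le_trans (ler_normB _ _)); lra.
  by rewrite normrM (gtr0_norm i0) ler_pdivrMr//; lra.
have zz' : T - (4 * K + 2) / c <= z <= T - (4 * K) / c.
  move: zz; rewrite -/ya => /andP[-> z2] /=; apply: (le_trans z2).
  by rewrite /ya !mulrDl; lra.
have [zi s1 s2] := zone zz'.
have /andP[h _] := energy T0 du dv tail c1 Tc uT zi.
set s := Num.sqrt _ in h s1 s2.
have s0 : 0 < s by apply: lt_le_trans s1.
have uT0 := ltW uT.
have uz2 : u z ^+ 2 <= (u T / K) ^+ 2.
  by rewrite -(real_normK (num_real (u z))) ler_sqr ?nnegrE ?(ltW uz)// divr_ge0//; lra.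
have vz2 : v z ^+ 2 <= (2 * c * (u T / K)) ^+ 2.
  rewrite -(real_normK (num_real (v z))) ler_sqr ?nnegrE//.
  by apply: (le_trans _ vz).
have h1 : s * u z ^+ 2 <= 4 * K * c * (u T / K) ^+ 2 by apply: ler_pM; rewrite ?sqr_ge0// ltW.
have h2 : v z ^+ 2 / s <= (2 * c * (u T / K)) ^+ 2 / c.
  apply: ler_pM; rewrite ?sqr_ge0 ?invr_ge0 ?(ltW s0)//.
  by rewrite lef_pV2.
have K0 : 0 < K by lra.
have h3 : 4 * K * c * (u T / K) ^+ 2 + (2 * c * (u T / K)) ^+ 2 / c = (4 / K + 4 / K ^+ 2) * (c * u T ^+ 2).
  by field; rewrite !gt_eqF.
have cu : 0 < c * u T ^+ 2 by rewrite mulr_gt0// exprn_gt0.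
have := le_trans h (lerD h1 h2); rewrite h3 ler_pM2r//.
have -> : (6 * (expR 1 * expR 3))^-1 = 17 / Cosc :> R.
  by rewrite /Cosc; field; rewrite !gt_eqF ?expR_gt0.
have C0 := @Cosc_gt0 R; rewrite ler_pdivrMr//.
have : 4 / K ^+ 2 <= 4 / K.
  by rewrite ler_wpM2l// lef_pV2 ?posrE ?exprn_gt0// expr2 ler_peMr ?(ltW K0)//; lra.
have : 4 / K * Cosc <= 5^-1.
  by rewrite mulrAC ler_pdivrMr//; have := KC; lra.
have := ltW C0; move: (4 / K) (4 / K ^+ 2) => p q C0' pq1 pq2 h4.
have : q * Cosc <= p * Cosc by apply: ler_wpM2r.
by lra.
Qed.

(** With the window at depth about 4 K / c and alias [M] within 2 K / c of the turning point in the
    original position, the reflected alias lies at least 2 K / c beyond [T]. The bound on [A] is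
    what keeps |u| above u(T) / (2 K) on the window, since |v| <= 4 K c u(T) there. *)
Lemma window_before_turning M : `|M%:R * D - 2 * T| <= D / 2 ->
  `|M%:R * D - 2 * T| <= 2 * (K / c) -> exists X, good_window u D X A.
Proof.
move=> MT nearM; have k := K64; have d := D40; have a := Ac; have i1 := ci; have i0 := ci0.
have K0 : 0 < K by lra.
have uT0 := ltW uT.
have [y0 /andP[yl yr] uy0] := amplitude; exists y0.
have z1 : (4 * K + 1) / c = 4 * K / c + c^-1 by ring.
have z2 : (4 * K + 2) / c = 4 * K / c + 2 * c^-1 by ring.
have inz y : y0 <= y <= y0 + A -> T - (4 * K + 2) / c <= y <= T - 4 * K / c.
  by move=> /andP[? ?]; apply/andP; split; lra.
have C4 : 4 * K * Cosc <= (4 * K) ^+ 2.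
  by rewrite exprMn; have := KC; have := ltW (@Cosc_gt0 R); nra.
have vb y : y0 <= y <= y0 + A -> `|v y| <= 4 * K * c * u T.
  move=> /inz yy; have [zi s1 s2] := zone yy.
  have /andP[_ h] := energy T0 du dv tail c1 Tc uT zi.
  set s := Num.sqrt _ in h s1 s2; have s0 : 0 < s by apply: lt_le_trans s1.
  have h1 : v y ^+ 2 / s <= Cosc * (c * u T ^+ 2).
    by apply: le_trans h; rewrite lerDr mulr_ge0 ?sqr_ge0// ltW.
  rewrite -ler_sqr ?nnegrE//; last by rewrite !mulr_ge0// ltW.
  rewrite real_normK ?num_real//; move: h1; rewrite ler_pdivrMr// => h1.
  apply: (le_trans h1).
  apply: (@le_trans _ _ (Cosc * (c * u T ^+ 2) * (4 * K * c))).
    by rewrite ler_wpM2l// !mulr_ge0 ?sqr_ge0// ltW// Cosc_gt0.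
  have -> : Cosc * (c * u T ^+ 2) * (4 * K * c) = 4 * K * Cosc * (c ^+ 2 * u T ^+ 2) by ring.
  have -> : (4 * K * c * u T) ^+ 2 = (4 * K) ^+ 2 * (c ^+ 2 * u T ^+ 2) by ring.
  by rewrite ler_wpM2r// mulr_ge0 ?sqr_ge0.
have AV : 4 * K * c * u T * A <= u T / K / 2.
  apply: (@le_trans _ _ (4 * K * c * u T * (8 * K ^+ 2 * c)^-1)).
    by rewrite ler_wpM2l// !mulr_ge0// ltW.
  by rewrite le_eqVlt; apply/orP; left; apply/eqP; field; rewrite !gt_eqF.
have near : forall y, y0 <= y <= y0 + A -> `|y - T| <= D / 8 /\ (2 * K)^-1 * u T <= `|u y|.
  move=> y yy; have /andP[w1 w2] := inz _ yy.
  have z3 : (4 * K + 2) / c <= 4 * K + 2 by rewrite ler_pdivrMr// ler_peMr//; lra.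
  have z4 : 0 <= 4 * K / c by rewrite divr_ge0//; lra.
  split; first by rewrite ler_norml; apply/andP; split; lra.
  case/andP: (yy) => yy1 yy2.
  have [z /andP[zz1 zz2] e] := df_MVT yy1 (fun x _ => du x).
  have vz : `|v z| <= 4 * K * c * u T by apply: vb; rewrite zz1 (le_trans zz2).
  have h : `|u y - u y0| <= 4 * K * c * u T * A.
    rewrite e normrM [`|y - y0|]ger0_norm ?subr_ge0//.
    by apply: ler_pM; rewrite ?normr_ge0 ?subr_ge0//; lra.
  have : `|u y0| <= `|u y| + `|u y - u y0|.
    by rewrite -{1}(subKr (u y) (u y0)) (le_trans (ler_normB _ _)).
  have -> : (2 * K)^-1 * u T = u T / K / 2 by field; rewrite gt_eqF.
  by lra.
have k0 : 0 < (2 * K)^-1 by rewrite invr_gt0 mulr_gt0.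
have k1 : (2 * K)^-1 <= 1 by rewrite invf_le1 ?mulr_gt0//; lra.
have l := @large_of (2 * K)^-1 ltac:(rewrite invrK; lra) k0.
apply: (near_window T0 du dv tail even c1 Tc uT B0 B2 k0 k1 l near MT) => M0 y yy.
have /andP[w1 w2] := inz _ yy.
have MT2 : - (2 * (K / c)) <= M%:R * D - 2 * T by move: nearM; rewrite ler_norml => /andP[].
have p : T + (2 * K) / c <= M%:R * D - y.
  have e1 : 2 * K / c = 2 * (K / c) by ring.
  have e2 : 4 * K / c = 4 * (K / c) by ring.
  by move: w2; rewrite e1 e2; lra.
have K1 : 1 <= 2 * K by lra.
apply: (le_trans (gap_decay K1 p)); apply: ler_wpM2r => //.
have -> : 2 * K / 2 = K by field.
rewrite expRN -invfM lef_pV2 ?posrE ?expR_gt0 ?mulr_gt0//.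
(* The claim is e^K >= 16 K; squaring 1 + K / 2 <= e^(K / 2) gives at least K^2 / 4, enough because
   K >= 64. *)
have e2 : expR K = expR (K / 2) ^+ 2 by rewrite expr2 -expRD -splitr.
have h0 := expR_ge1Dx (K / 2).
have : (1 + K / 2) ^+ 2 <= expR (K / 2) ^+ 2.
  by rewrite ler_sqr ?nnegrE ?expR_ge0//; lra.
rewrite -e2 => h1.
have kk : 64 * K <= K ^+ 2 by rewrite expr2 ler_wpM2r//; lra.
by move: h1; rewrite sqrrD expr1n !exprMn; lra.
Qed.

Theorem inner_window : exists X, good_window u D X A.
Proof.
have d := D40; have k := K64; have D0 : 0 < D by lra.
have x0 : 0 <= 2 * T / D + 2^-1.
  by rewrite addr_ge0// ?divr_ge0 ?mulr_ge0 ?(ltW D0).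
(* [M] is 2 T / D rounded to a nearest integer, hence the shift by 1/2 before truncation. *)
have /andP[t1 t2] := truncn_itv x0; set M := Num.truncn _ in t1 t2.
have MT : `|M%:R * D - 2 * T| <= D / 2.
  have t1' : M%:R * D <= (2 * T / D + 2^-1) * D by apply: ler_wpM2r => //; exact: ltW.
  have t2' : (2 * T / D + 2^-1) * D <= M.+1%:R * D by apply: ler_wpM2r; exact: ltW.
  have e1 : (2 * T / D + 2^-1) * D = 2 * T + D / 2 by field; rewrite gt_eqF.
  have e2 : M.+1%:R * D = M%:R * D + D by rewrite -natr1; ring.
  move: t1' t2'; rewrite e1 e2 => t1' t2'.
  by rewrite ler_norml; apply/andP; split; lra.
have [h|/ltW h] := leP (2 * (K / c)) `|M%:R * D - 2 * T|; last exact: window_before_turning MT h.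
by exists T; apply: (window_at_turning MT).
Qed.

End Inner.

End InnerWindow.

(** * From real to complex Gabor frames *)

Section Complexify.
Context {R : realType}.
Implicit Types (f : R -> R[i]) (F : int -> int -> R).
Notation mu := (@lebesgue_measure R).

Let irange N : seq int := [seq i%:Z - N%:Z | i <- index_iota 0 N.*2.+1].

Let bsum_irange N (F : int -> R) : bsum N F = \sum_(l <- irange N) F l.
Proof. by rewrite /irange big_map big_mkord. Qed.

Let irange_uniq N : uniq (irange N).
Proof. by rewrite map_inj_uniq ?iota_uniq// => i j; lia. Qed.

Let mem_irange N (l : int) : (`|l| <= N)%N -> l \in irange N.
Proof.
move=> lN; apply/mapP; exists `|(l + N%:Z)%R|%N; last by lia.
by rewrite mem_index_iota; lia.
Qed.

Let box K L : seq (int * int) := [seq (k, l) | k <- irange K, l <- irange L].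

Let box_sum F K L : (\sum_(kl \in [set` box K L]) (F kl.1 kl.2)%:E =
  (bsum K (fun k => bsum L (F k)))%:E)%E.
Proof.
have us : uniq (box K L) by apply: allpairs_uniq => // -[? ?] [? ?] _ _ [-> ->].
rewrite -fsbig_seq// sumEFin big_allpairs bsum_irange; congr EFin.
by apply: eq_bigr => k _; rewrite bsum_irange.
Qed.

Lemma esum_box_ge F K L : (forall k l, 0 <= F k l) ->
  ((bsum K (fun k => bsum L (F k)))%:E <= \esum_(kl in [set: int * int]) (F kl.1 kl.2)%:E)%E.
Proof.
move=> F0; rewrite -box_sum; apply: esum_ge; exists [set` box K L] => //.
by split => //; exact: finite_seq.
Qed.

(** Every finite set of indices lies in some box, and the terms are nonnegative. *)
Lemma esum_box_le F B : (forall k l, 0 <= F k l) ->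
  (forall K L, bsum K (fun k => bsum L (F k)) <= B) ->
  (\esum_(kl in [set: int * int]) (F kl.1 kl.2)%:E <= B%:E)%E.
Proof.
move=> F0 FB; apply: ge_ereal_sup => _ [X [finX _] <-].
have [s sX] := (finite_seqP X).1 finX.
pose N := \max_(kl <- s) (`|kl.1| + `|kl.2|)%N.
apply: (@le_trans _ _ (\sum_(kl \in [set` box N N]) (F kl.1 kl.2)%:E)%E); last first.
  by rewrite box_sum lee_fin.
apply: lee_fsum_nneg_subset => //; [exact: finite_seq| |by move=> kl _; rewrite lee_fin].
move=> [k l]; rewrite !inE sX/= => kls; apply/allpairsP; exists (k, l) => /=.
have : (`|k| + `|l| <= N)%N by exact: (@leq_bigmax_seq _ _ xpredT (fun kl : int * int => (`|kl.1| + `|kl.2|)%N) _ kls).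
by move=> h; split=> //; apply: mem_irange; lia.
Qed.

Lemma L2norm_sqE f : ((L2norm f) ^+ 2 =
  \int[mu]_t (complex.Re (f t) ^+ 2 + complex.Im (f t) ^+ 2)%:E)%E.
Proof.
have h : (2 : R) != 0 by [].
transitivity ((L2norm f) `^ 2)%E.
  rewrite /L2norm; have := @Lnorm_ge0 _ _ R mu 2%:E (EFin \o (cabs \o f)).
  case: (Lnorm _ _ _) => [r r0||_] //.
    by rewrite poweR_EFin (@powR_mulrn _ r 2).
  by rewrite poweRyr// expeS expe1 mulyy.
rewrite /L2norm poweR_Lnorm//; apply: eq_integral => t _ /=.
rewrite /cabs; case: (f t) => x y /=.
rewrite ger0_norm ?sqrtr_ge0// (@powR_mulrn _ _ 2) ?sqrtr_ge0//.
by rewrite sqr_sqrtr// addr_ge0 ?sqr_ge0.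
Qed.

Lemma L2_parts f : L2 f -> [/\ L2r (fun t => complex.Re (f t)), L2r (fun t => complex.Im (f t)) &
  (L2norm f ^+ 2 = (\int[mu]_t complex.Re (f t) ^+ 2 + \int[mu]_t complex.Im (f t) ^+ 2)%:E)%E].
Proof.
move=> [mre mim fin].
have fin2 : (\int[mu]_t (complex.Re (f t) ^+ 2 + complex.Im (f t) ^+ 2)%:E < +oo)%E.
  rewrite -L2norm_sqE; have := @Lnorm_ge0 _ _ R mu 2%:E (EFin \o (cabs \o f)).
  move: fin; rewrite /L2norm; case: (Lnorm _ _ _) => [r _ _||] //.
  by rewrite -EFin_expe ltry.
have m1 : measurable_fun setT (fun t => complex.Re (f t) ^+ 2) by exact: measurable_funX.
have m2 : measurable_fun setT (fun t => complex.Im (f t) ^+ 2) by exact: measurable_funX.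
have iS : itgb setT (fun t => complex.Re (f t) ^+ 2 + complex.Im (f t) ^+ 2).
  apply/integrableP; split; first by apply/measurable_EFinP; exact: measurable_funD.
  apply: le_lt_trans fin2; rewrite le_eqVlt; apply/orP; left; apply/eqP.
  by apply: eq_integral => t _ /=; rewrite ger0_norm// addr_ge0 ?sqr_ge0.
have i1 : itgb setT (fun t => complex.Re (f t) ^+ 2).
  apply: (itgb_le measurableT m1 _ iS) => t _.
  by rewrite ger0_norm ?sqr_ge0// lerDl sqr_ge0.
have i2 : itgb setT (fun t => complex.Im (f t) ^+ 2).
  apply: (itgb_le measurableT m2 _ iS) => t _.
  by rewrite ger0_norm ?sqr_ge0// lerDr sqr_ge0.
split=> //.
by rewrite L2norm_sqE -RintegralD// -itgb_fin.
Qed.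

Variables (g : R -> R) (Cg : R).
Hypothesis cg : continuous g.
Hypothesis gle : forall x, `|g x| <= Cg * gauss_fun x.
Variables (a b : R).

Section Fixed.
Variable f : R -> R[i].
Hypothesis f2 : L2 f.
Let f1 t := complex.Re (f t).
Let fi t := complex.Im (f t).

Let G k l := inner f (gabor_atom (fun t => (g t)%:C%C) a b k l).

Let GE k l : G k l = ((GC g a b f1 k l + GS g a b fi k l) +i* (GC g a b fi k l - GS g a b f1 k l))%C.
Proof.
have [L1 Li _] := L2_parts f2.
have ic1 := GC_itgb cg gle a b k l L1; have is1 := GS_itgb cg gle a b k l L1.
have ic2 := GC_itgb cg gle a b k l Li; have is2 := GS_itgb cg gle a b k l Li.
rewrite /G /inner /cintegral /GC /GS -RintegralD// -RintegralB//.
congr (_ +i* _)%C; apply: eq_Rintegral => t _.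
  by rewrite /gabor_atom /cis /f1 /fi; case: (f t) => x y /=; ring.
by rewrite /gabor_atom /cis /f1 /fi; case: (f t) => x y /=; ring.
Qed.

Let F k l := cabs (G k l) ^+ 2.

Let FE k l : F k l = (GC g a b f1 k l + GS g a b fi k l) ^+ 2 + (GC g a b fi k l - GS g a b f1 k l) ^+ 2.
Proof. by rewrite /F GE /cabs /= sqr_sqrtr// addr_ge0 ?sqr_ge0. Qed.

(** For real [g], real and imaginary parts of [f] interact only through products of a [GC] with a
    [GS], which are odd in [l] and cancel. Over symmetric boxes the complex frame sum therefore
    splits into two real ones. *)
Lemma box_parts K L : bsum K (fun k => bsum L (F k)) =
  bsum K (fun k => bsum L (fun l => GQ g a b f1 k l)) +
  bsum K (fun k => bsum L (fun l => GQ g a b fi k l)).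
Proof.
have [L1 Li _] := L2_parts f2.
rewrite -bsumD; apply: eq_bsum => k; rewrite -bsumD; apply: bsum_sym => l.
have CN u : GC g a b u k (- l) = GC g a b u k l.
  rewrite /GC; apply: eq_Rintegral => t _; congr (_ * _).
  by rewrite mulrNz mulrN mulNr cosN.
have SN u : L2r u -> GS g a b u k (- l) = - GS g a b u k l.
  move=> u2; rewrite /GS -[RHS]mulN1r -RintegralZl//; last exact: (GS_itgb cg gle).
  by apply: eq_Rintegral => t _; rewrite mulrNz mulrN mulNr sinN; ring.
by rewrite !FE /GQ !CN !SN//; ring.
Qed.

End Fixed.

Theorem gabor_of_real : real_frame g a b -> gabor_frame (fun t => (g t)%:C%C) a b.
Proof.
move=> [A [B [A0 B0 H]]]; exists A, B; split=> // f f2.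
have [L1 Li ->] := L2_parts f2.
have [U1 W1] := H _ L1; have [Ui Wi] := H _ Li.
set I1 := \int[mu]_t complex.Re (f t) ^+ 2 in U1 W1 *.
set Ii := \int[mu]_t complex.Im (f t) ^+ 2 in Ui Wi *.
pose F k l := cabs (inner f (gabor_atom (fun t => (g t)%:C%C) a b k l)) ^+ 2.
have F0 k l : 0 <= F k l by exact: sqr_ge0.
apply/andP; split; last first.
  rewrite -EFinM; apply: (esum_box_le F0) => K L.
  by rewrite (box_parts f2) mulrDr; apply: lerD; [exact: U1|exact: Ui].
have boxle K L := esum_box_ge K L F0.
set E := esum _ _ in boxle *.
(* An infinite sum makes the lower inequality trivial and nonnegative box sums exclude minus
   infinity. What remains is a real [r] bounding all boxes, the form [Qge] expects. *)
case: E boxle => [r||] boxle; first last.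
- by have := boxle 0%N 0%N.
- by rewrite leey.
rewrite -EFinM lee_fin.
have mono u K L K' L' : (K <= K')%N -> (L <= L')%N ->
    bsum K (fun k => bsum L (fun l => GQ g a b u k l)) <= bsum K' (fun k => bsum L' (fun l => GQ g a b u k l)).
  have Q0 k l : 0 <= GQ g a b u k l by rewrite addr_ge0 ?sqr_ge0.
  move=> kk ll; apply: (@le_trans _ _ (bsum K' (fun k => bsum L (fun l => GQ g a b u k l)))).
    by apply: bsum_mono => // k; exact: bsum_ge0.
  by apply: le_bsum => k; exact: bsum_mono.
rewrite mulrDr addrC -lerBrDr; apply: Wi => K L.
rewrite lerBrDl -lerBrDr; apply: W1 => K' L'.
rewrite lerBrDr.
have := boxle (maxn K K') (maxn L L'); rewrite lee_fin (box_parts f2); apply: le_trans.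
by apply: lerD; apply: mono; rewrite ?leq_maxl ?leq_maxr.
Qed.

End Complexify.

(** * Hermite functions as solutions of the oscillator equation, and their normalization *)

Section HermiteWindow.
Context {R : realType}.
Implicit Types (x y a b k rho : R).
Variable n : nat.
Notation gam := (@gam R).

Let g0 : 0 < gam. Proof. exact: gam_gt0. Qed.

(* In the variable [y = gam * x] the Hermite function solves [u'' = (y^2 - (2n+1)) u]. *)
Definition hu (m : nat) y : R := hg m (y / gam).
Definition hv (m : nat) y : R := m%:R * hu m.-1 y - hu m.+1 y / 2.
Definition turning : R := Num.sqrt (2 * n%:R + 1).

Lemma turning2 : turning ^+ 2 = 2 * n%:R + 1.
Proof. by rewrite sqr_sqrtr// addr_ge0// mulr_ge0 ?ler0n. Qed.

Lemma turning_gt0 : 0 < turning.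
Proof. by rewrite sqrtr_gt0 ltr_wpDl// mulr_ge0 ?ler0n. Qed.

Lemma huS m y : hu m.+1 y = 2 * y * hu m y - 2 * m%:R * hu m.-1 y.
Proof. by rewrite /hu hgS; field; rewrite gt_eqF. Qed.

Lemma d_hu m y : is_derive y 1 (hu m) (hv m y).
Proof.
have d := df_hg m (y / gam).
have d2 : is_derive y 1 (fun y => y / gam) gam^-1 by deriv; ring.
have H := @df_comp _ y (hg m) (fun y => y / gam) _ _ d d2.
apply: (df_eq H); rewrite /hv /hu; by field; rewrite gt_eqF.
Qed.

Lemma d_hv y : is_derive y 1 (hv n) ((y ^+ 2 - turning ^+ 2) * hu n y).
Proof.
have d1 := d_hu n.-1; have d2 := d_hu n.+1; rewrite /hv; deriv.
rewrite turning2 /hv/=.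
have e1 := huS n.+1 y; have e2 := huS n y; rewrite /= in e1.
(* For [n = 0] the predecessors are default values; the factor [n%:R] makes [e3] and [e4] hold in
   that case too. *)
have e3 : n%:R * hu n y = n%:R * (2 * y * hu n.-1 y - 2 * n.-1%:R * hu n.-1.-1 y).
  by case: (n) => [|m]; rewrite ?mul0r// huS.
have e4 : n%:R * hu n.-1.+1 y = n%:R * hu n y by case: (n) => [|m]; rewrite ?mul0r.
rewrite e1 e2 -[n.+1%:R]natr1.
move: e3 e4; move: (hu n.-1.+1 y) (hu n.-1.-1 y) (hu n.-1 y) (hu n y) (n%:R : R) (n.-1%:R : R).
by move=> Z X w h N N1 e3 e4; lra.
Qed.

Lemma hu_even y : `|hu n (- y)| = `|hu n y|.
Proof. by rewrite /hu mulNr hg_abs_even. Qed.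

Lemma hu_decay m : exists2 K : R, 0 <= K & forall y, 0 < y -> `|hu m y| <= K / y ^+ 2.
Proof.
have [K K0 HK] := @hg_gauss R m; exists (K * gam ^+ 2); first by rewrite mulr_ge0 ?sqr_ge0.
move=> y y0; rewrite /hu; apply: (le_trans (g_decay HK (y / gam))).
rewrite -mulrA ler_wpM2l//.
have -> : gam ^+ 2 / y ^+ 2 = ((y / gam) ^+ 2)^-1 by field; rewrite !gt_eqF.
have p : 0 < (y / gam) ^+ 2 by rewrite exprn_gt0// divr_gt0.
by rewrite lef_pV2 ?posrE// ?lerDr// ltr_wpDl.
Qed.

Lemma hu_tail e a : 0 < e ->
  exists y, [/\ a < y, `|hu n y * hv n y| <= e & y ^+ 2 * hu n y ^+ 2 <= e].
Proof.
move=> e0; have [K K0 HK] := hu_decay n; have [K1 K10 HK1] := hu_decay n.-1.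
have [K2 K20 HK2] := hu_decay n.+1.
pose V := n%:R * K1 + K2 / 2; have V0 : 0 <= V by rewrite addr_ge0 ?mulr_ge0 ?divr_ge0.
have Hv y : 0 < y -> `|hv n y| <= V / y ^+ 2.
  move=> y0; apply: (le_trans (ler_normB _ _)); rewrite /V mulrDl.
  rewrite (normrM n%:R) (normrM (hu n.+1 y)) [`|n%:R|]ger0_norm ?ler0n// [`|2^-1|]ger0_norm//.
  apply: lerD; first by rewrite -mulrA ler_wpM2l// HK1.
  by rewrite mulrAC ler_wpM2r// HK2.
pose W := (K * V + K ^+ 2) / e.
have W0 : 0 <= W by rewrite divr_ge0 ?addr_ge0 ?mulr_ge0 ?sqr_ge0// ltW.
pose y := `|a| + 1 + W; exists y.
have a0 := normr_ge0 a; have a1 := ler_norm a.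
have y1 : 1 <= y by rewrite /y; lra.
have y0 : 0 < y by apply: lt_le_trans y1.
have Wy : K * V + K ^+ 2 <= y * e by rewrite -ler_pdivrMr//; rewrite -/W /y; lra.
have y2 : y <= y ^+ 2 by rewrite expr2 ler_peMr// ltW.
have y4 : y <= y ^+ 4.
  apply: (le_trans y2); have -> : y ^+ 4 = y ^+ 2 * y ^+ 2 by ring.
  by rewrite ler_peMr ?sqr_ge0// exprn_ege1.
have KV0 : 0 <= K * V by rewrite mulr_ge0.
have K2' : 0 <= K ^+ 2 by rewrite sqr_ge0.
have ye2 : y * e <= y ^+ 2 * e by rewrite ler_wpM2r// ltW.
have ye4 : y * e <= y ^+ 4 * e by rewrite ler_wpM2r// ltW.
split.
- by rewrite /y; lra.
- rewrite normrM; apply: (@le_trans _ _ (K / y ^+ 2 * (V / y ^+ 2))).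
    by apply: ler_pM => //; [exact: HK|exact: Hv].
  have -> : K / y ^+ 2 * (V / y ^+ 2) = K * V / y ^+ 4 by field; rewrite gt_eqF.
  by rewrite ler_pdivrMr ?exprn_gt0// mulrC; lra.
have h : hu n y ^+ 2 <= (K / y ^+ 2) ^+ 2.
  rewrite -(real_normK (num_real (hu n y))) ler_sqr ?nnegrE//; first exact: HK.
  by rewrite divr_ge0 ?sqr_ge0.
apply: (@le_trans _ _ (y ^+ 2 * (K / y ^+ 2) ^+ 2)); first by rewrite ler_wpM2l ?sqr_ge0.
have -> : y ^+ 2 * (K / y ^+ 2) ^+ 2 = K ^+ 2 / y ^+ 2 by field; rewrite gt_eqF.
by rewrite ler_pdivrMr ?exprn_gt0// mulrC; lra.
Qed.

Let T0 : 0 <= turning. Proof. exact: ltW turning_gt0. Qed.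

(** Beyond the turning point |u| does not increase, so a zero would force zeros from there on,
    against [hpoly_neq0]. *)
Lemma hu_neq0 y : turning <= y -> hu n y != 0.
Proof.
move=> Ty; apply/eqP => u0; have [x xy] := hpoly_neq0 n (y / gam); apply/negP; rewrite negbK.
have yx : turning <= y <= x * gam by rewrite Ty/= -ler_pdivrMr// ltW.
have := u_decr T0 (d_hu n) d_hv hu_tail yx.
have gne : gam != 0 by rewrite gt_eqF.
rewrite u0 normr0 normr_le0 /hu (mulfK gne) => h.
by move: h; rewrite /hg mulf_eq0 (gt_eqF (expR_gt0 _)) orbF.
Qed.

Theorem window_frame k a b X : k != 0 -> 0 < a -> 0 < b -> a * b <= 1 ->
  good_window (hu n) (gam / b) X (gam * a) -> real_frame (fun x => k * hg n x) a b.
Proof.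
move=> k0 a0 b0 ab [kap [eps [kap0 e0 e00 es [w1 w2]]]].
have kn : 0 < `|k| by rewrite normr_gt0.
have [M M0 HM] := @hg_gauss R n.
have gle x : `|k * hg n x| <= (`|k| * M) * gauss_fun x.
  by rewrite normrM -mulrA ler_wpM2l.
have bg : blip (fun x => k * hg n x) by apply: blipM; [exact: blip_cst|exact: hg_blip].
have ab1 : a <= b^-1 by rewrite -[b^-1]mul1r ler_pdivlMr.
have E x : hg n x = hu n (x * gam) by rewrite /hu mulfK ?gt_eqF.
have inw x : X / gam <= x <= X / gam + a -> X <= x * gam <= X + gam * a.
  move=> /andP[x1 x2]; rewrite -ler_pdivrMr// x1/= -ler_pdivlMr//.
  by rewrite mulrDl [gam * a]mulrC mulfK ?gt_eqF.
apply: (@caseI _ _ _ bg gle a b a0 b0 ab1 (X / gam) (kap * `|k|) eps).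
- by rewrite mulr_gt0.
- exact: e0.
- exact: e00.
- exact: es.
- by move=> x /inw /w1 h; rewrite normrM mulrC ler_wpM2l// E.
- move=> m x m0 /inw xx; rewrite (normrM k (hg n (x + _))) (normrM k (hg n x)) mulrCA ler_wpM2l// !E.
  have := w2 m _ m0 xx; have -> : x * gam + m%:~R * (gam / b) = (x + m%:~R / b) * gam by field; rewrite gt_eqF.
  exact.
Qed.

Theorem swap_hg k a b : 0 < a -> 0 < b ->
  real_frame (fun x => k * hg n x) b a -> real_frame (fun x => k * hg n x) a b.
Proof.
move=> a0 b0; have [M M0 HM] := @hg_gauss R n.
have gle x : `|k * hg n x| <= (`|k| * M) * gauss_fun x.
  by rewrite normrM -mulrA ler_wpM2l.
have cg : continuous (fun x => k * hg n x).
  by move=> x; apply: cvgM; [exact: cvg_cst|exact: hg_cont].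
apply: (@swap_frame _ _ _ cg gle (n%:R * (pi / 2))) => // x al.
rewrite -mulrA hg_eig -RintegralZl//.
  by apply: eq_Rintegral => om _; rewrite mulrA.
apply: bounded_itgbM; first exact: hg_itgb.
  by apply: (@df_cont _ _ (fun om => - sin (2 * pi * om * x + (al - n%:R * (pi / 2))) * (2 * pi * x))) => om; deriv; ring.
by move=> om; exact: cos_max.
Qed.

Theorem far_frame k rho a b : k != 0 -> 0 < rho -> rho < 1 / 2 -> 0 < a -> 0 < b ->
  a * b <= 1 / 2 - rho -> 2 * turning <= rho * (gam / b) -> 32 / rho <= (gam / b) ^+ 2 ->
  real_frame (fun x => k * hg n x) a b.
Proof.
move=> k0 r0 r2 a0 b0 ab h1 h2; apply: (@window_frame _ _ _ turning) => //; first by lra.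
apply: (far_window T0 (d_hu n) d_hv hu_tail hu_even r0 r2) => //.
- by rewrite mulr_ge0// ltW.
- have -> : gam * a = (a * b) * (gam / b) by field; rewrite gt_eqF.
  by rewrite ler_wpM2r// divr_ge0// ltW.
- by rewrite divr_gt0.
- by apply: hu_neq0; rewrite lerDl mulr_ge0// ltW.
Qed.

(** [inner_window] assumes u(T) > 0. The value is nonzero by [hu_neq0], and if it is negative then
    [- u] solves the same equation with the same absolute values. *)
Theorem inner_frame (B K c : R) k a b : k != 0 -> 0 < a -> 0 < b -> a * b <= 1 ->
  0 < B -> B ^+ 2 = Cosc -> K = (16 ^+ 2 * Cosc) ^+ 2 ->
  1 <= c -> turning = c ^+ 3 -> 5 * K <= c ->
  160 * K * (B + 1) * c ^+ 2 <= gam / b -> gam * a <= (8 * K ^+ 2 * c)^-1 ->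
  real_frame (fun x => k * hg n x) a b.
Proof.
move=> k0 a0 b0 ab B0 B2 KE c1 Tc cK HD HA.
suff [X HX] : exists X, good_window (hu n) (gam / b) X (gam * a) by exact: window_frame HX.
have [p|p|z] := ltrgt0P (hu n turning).
- exact: (inner_window T0 (d_hu n) d_hv hu_tail hu_even c1 Tc p B0 B2 KE cK HD HA).
- pose u y := - hu n y; pose v y := - hv n y.
  have du y : is_derive y 1 u (v y) by have d := d_hu n; rewrite /u /v; deriv.
  have dv y : is_derive y 1 v ((y ^+ 2 - turning ^+ 2) * u y).
    by have d := d_hv; rewrite /u /v; deriv; ring.
  have tail e x : 0 < e -> exists y, [/\ x < y, `|u y * v y| <= e & y ^+ 2 * u y ^+ 2 <= e].
    by move=> /(hu_tail x)[y [y1 y2 y3]]; exists y; rewrite /u /v mulrNN sqrrN.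
  have even y : `|u (- y)| = `|u y| by rewrite !normrN hu_even.
  have p' : 0 < u turning by rewrite oppr_gt0.
  have [X [kap [eps [k1 k2 k3 k4 [k5 k6]]]]] :=
    inner_window T0 du dv tail even c1 Tc p' B0 B2 KE cK HD HA.
  exists X, kap, eps; split=> //; split=> [y yy|m y m0 yy].
    by rewrite -normrN; exact: k5.
  by rewrite -normrN -[`|hu n y|]normrN; exact: k6.
- by have := hu_neq0 (lexx turning); rewrite z eqxx.
Qed.

Lemma hg_sq_itgb : itgb setT (fun x : R => hg n x ^+ 2).
Proof.
have [K K0 HK] := @hg_bounded R n.
apply: (@itgb_le _ _ _ (fun x => K * `|hg n x|)) => //.
- by apply: measurable_funX; apply: continuous_measurable_fun; exact: hg_cont.
- by move=> x _; rewrite normrX expr2 ler_wpM2r.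
- by apply: itgbZ => //; apply: itgb_norm; exact: hg_itgb.
Qed.

Lemma hg_sq_gt0 : 0 < \int[lebesgue_measure]_x (hg n x : R) ^+ 2.
Proof.
pose x1 := turning / gam; pose k := `|hg n (x1 + 1)|.
have gne : gam != 0 by rewrite gt_eqF.
have E x : hg n x = hu n (x * gam) by rewrite /hu mulfK.
have Tx x : x1 <= x -> turning <= x * gam by rewrite ler_pdivrMr.
have k0 : 0 < k by rewrite normr_gt0 E hu_neq0// Tx// lerDl.
have x11 : x1 < x1 + 1 by rewrite ltrDl.
have c2 : continuous (fun x : R => hg n x ^+ 2).
  by move=> x; under eq_fun do rewrite expr2; apply: cvgM; exact: hg_cont.
pose D : set (measurableTypeR R) := `[x1, x1 + 1]%classic.
have mD : measurable D by exact: measurable_itv.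
have h1 := @Rint_sq_mono R D (hg n) mD hg_sq_itgb.
apply: lt_le_trans h1; apply: (@lt_le_trans _ _ (k ^+ 2)); first by rewrite exprn_gt0.
have -> : k ^+ 2 = \int[lebesgue_measure]_(x in D) (k ^+ 2 * 1).
  rewrite RintegralZl//; last by apply: cont_itgb => x; exact: cvg_cst.
  by rewrite /D Rint1_seg// addrAC subrr add0r mulr1.
apply: le_Rintegral => //.
- by apply: cont_itgb => x; exact: cvg_cst.
- by apply: cont_itgb.
move=> x; rewrite /D/= in_itv/= => /andP[x1x xx1]; rewrite mulr1 -[leRHS](real_normK (num_real _)).
have kx : k <= `|hg n x|.
  rewrite /k (E x) (E (x1 + 1)); apply: (u_decr T0 (d_hu n) d_hv hu_tail).
  by rewrite Tx// ler_pM2r.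
by rewrite ler_sqr ?nnegrE ?(ltW k0).
Qed.

(** An explicit normalizing constant shows that the set behind [xget] is nonempty, so the value
    chosen lies in it and is not the default 0. *)
Lemma hermite_cst_gt0 : 0 < @hermite_cst R n.
Proof.
suff ex : exists c : R, 0 < c /\ L2norm (fun t => (c * hermite_raw n t)%:C%C) = 1%E.
  by have [] := xgetPex 0 ex.
set I := \int[lebesgue_measure]_x (hg n x : R) ^+ 2.
have I0 : 0 < I := hg_sq_gt0.
have gn : 0 < gam ^+ n by rewrite exprn_gt0.
pose c := (gam ^+ n * Num.sqrt I)^-1.
have c0 : 0 < c by rewrite invr_gt0 mulr_gt0// sqrtr_gt0.
exists c; split=> //.
have sq : ((L2norm (fun t => (c * hermite_raw n t)%:C%C)) ^+ 2 = 1)%E.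
  rewrite L2norm_sqE/=.
  transitivity (\int[lebesgue_measure]_t ((c * gam ^+ n) ^+ 2 * hg n t ^+ 2)%:E)%E.
    apply: eq_integral => t _; congr EFin.
    by rewrite hermite_rawE expr0n addr0; ring.
  rewrite itgb_fin//; last by apply: itgbZ => //; exact: hg_sq_itgb.
  rewrite RintegralZl//; last exact: hg_sq_itgb.
  congr EFin; rewrite -/I -[X in _ * X]sqr_sqrtr ?(ltW I0)// -exprMn /c.
  have -> : (gam ^+ n * Num.sqrt I)^-1 * gam ^+ n * Num.sqrt I = 1.
    by field; rewrite !gt_eqF ?sqrtr_gt0.
  by rewrite expr1n.
have := @Lnorm_ge0 _ _ R lebesgue_measure 2%:E (EFin \o (cabs \o (fun t => (c * hermite_raw n t)%:C%C))).
move: sq; rewrite /L2norm; case: (Lnorm _ _ _) => [r||] //.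
rewrite -EFin_expe => -[] /eqP; rewrite sqrf_eq1 => /orP[/eqP -> //|/eqP ->].
by rewrite lee_fin lerNr oppr0 ler10.
Qed.

Lemma hermiteE : hermite n = fun t : R => (hermite_cst n * gam ^+ n * hg n t)%:C%C.
Proof. by apply/funext => t; rewrite /hermite hermite_rawE mulrA. Qed.

Theorem hermite_gabor_frame a b : 0 < a -> 0 < b ->
  (forall k, k != 0 -> real_frame (fun x => k * hg n x) a b) ->
  gabor_frame (@hermite R n) a b.
Proof.
move=> a0 b0 H; have [M M0 HM] := @hg_gauss R n.
pose k := @hermite_cst R n * gam ^+ n.
have k0 : k != 0 by rewrite gt_eqF// mulr_gt0 ?exprn_gt0// hermite_cst_gt0.
have gle x : `|k * hg n x| <= (`|k| * M) * gauss_fun x.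
  by rewrite (normrM k) -mulrA ler_wpM2l.
have cg : continuous (fun x => k * hg n x).
  by move=> x; apply: cvgM; [exact: cvg_cst|exact: hg_cont].
by rewrite hermiteE; exact: (gabor_of_real cg gle (H k k0)).
Qed.

End HermiteWindow.

(** * The two regions *)

Section Asymptotics.
Context {R : realType}.
Implicit Types (a b x k eta delta rho : R).

Lemma powR_large (e M : R) : 0 < e -> exists N : nat, forall n, (N <= n)%N -> M <= n%:R `^ e.
Proof.
move=> e0; pose x := `|M| + 1.
have x1 : 1 <= x by rewrite /x lerDr.
exists (Num.bound (x `^ e^-1)) => n nN.
have h : x `^ e^-1 <= n%:R.
  apply: (le_trans (ltW (archi_boundP (powR_ge0 _ _)))); by rewrite ler_nat.
apply: (@le_trans _ _ x); first by rewrite /x (le_trans (ler_norm M))// lerDl.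
have -> : x = (x `^ e^-1) `^ e.
  by rewrite -powRrM mulVf ?gt_eqF// powRr1// (le_trans ler01).
by apply: ge0_ler_powR => //; rewrite ?nnegrE ?powR_ge0// ltW.
Qed.

Lemma gam_bounds : 1 <= @gam R <= 3.
Proof.
have g0 := @gam_gt0 R; have g2 := @gam2 R; have p2 := @pi_ge2 R; have p4 := @pihalf_lt2 R.
by apply/andP; split; rewrite -ler_sqr ?nnegrE ?(ltW g0)// g2 ?expr1n; lra.
Qed.

(** [D = gam / b] is at least n^(1/2 + delta) because gam >= 1, while the turning point is at most 2
    sqrt n; so n^delta >= 4 / rho is what [far_frame] asks. *)
Lemma region2_frame delta rho : 0 < delta -> 0 < rho -> rho < 1 / 2 ->
  exists N : nat, forall n, (N <= n)%N -> forall a b k, k != 0 -> 0 < a -> 0 < b ->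
    a * b <= 1 / 2 - rho -> b <= n%:R `^ (- (1 / 2) - delta) ->
    real_frame (fun x => k * hg n x) a b.
Proof.
move=> d0 r0 r2; have [N1 H1] := powR_large (4 / rho) d0.
have [N2 H2] := powR_large (32 / rho) (@ltr01 R).
exists (maxn 1 (maxn N1 N2)) => n; rewrite !geq_max => /andP[n1 /andP[nN1 nN2]] a b k k0 a0 b0 ab bn.
have x1 : 1 <= n%:R :> R by rewrite ler1n.
have x0 : 0 < n%:R :> R by rewrite ltr0n.
have := H2 n nN2; rewrite powRr1 ?(ltW x0)// => h2.
have := H1 n nN1; set q := n%:R `^ delta => h1.
set s := Num.sqrt (n%:R : R).
have s0 : 0 < s by rewrite sqrtr_gt0.
have s2 : s ^+ 2 = n%:R by rewrite sqr_sqrtr// ltW.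
have q0 : 0 < q by rewrite powR_gt0.
have bE : b <= (s * q)^-1.
  apply: (le_trans bn); rewrite -opprD powRN powRD; last by apply/implyP => _; rewrite gt_eqF.
  by rewrite div1r -/q powR12_sqrt// ltW.
have /andP[g1 g3] := gam_bounds.
have D : s * q <= gam / b.
  rewrite ler_pdivlMr//; apply: (@le_trans _ _ 1) => //.
  by rewrite -ler_pdivlMl ?mulr_gt0// mulr1.
have T2 : turning n <= 2 * s.
  rewrite -ler_sqr ?nnegrE ?(ltW (turning_gt0 n)) ?mulr_ge0 ?(ltW s0)//.
  by rewrite turning2 exprMn s2; lra.
have q4 : 4 / rho <= q := h1.
have rq : 4 <= rho * q by rewrite mulrC -ler_pdivrMr.
have q1 : 1 <= q.
  by apply: le_trans q4; rewrite ler_pdivlMr//; lra.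
apply: (@far_frame _ _ _ rho) => //.
- apply: (@le_trans _ _ (rho * (s * q))); last by rewrite ler_pM2l.
  have : s * 4 <= s * (rho * q) by rewrite ler_pM2l.
  by lra.
- apply: (le_trans h2); rewrite -s2 ler_sqr ?nnegrE ?(ltW s0) ?divr_ge0 ?(ltW b0)//; last by lra.
  by apply: le_trans D; rewrite ler_peMr// ltW.
Qed.

Lemma region1_frame eta : 0 < eta ->
  exists N : nat, forall n, (N <= n)%N -> forall a b k, k != 0 -> 0 < a -> 0 < b -> b <= a ->
    a * b <= n%:R `^ (- (2 / 3) - eta) -> real_frame (fun x => k * hg n x) a b.
Proof.
move=> e0; have e20 : 0 < eta / 2 by rewrite divr_gt0.
(* The very small values of [b] are delegated to the other region, with exponent [eta / 2] and
   [rho = 1/4]. *)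
have [N0 H0] := @region2_frame (eta / 2) 4^-1 e20 ltac:(lra) ltac:(lra).
have C0 := @Cosc_gt0 R.
have [B B0 B2] : exists2 B : R, 0 < B & B ^+ 2 = Cosc.
  by exists (Num.sqrt Cosc); [rewrite sqrtr_gt0|rewrite sqr_sqrtr// ltW].
have [K K0 KE] : exists2 K : R, 0 < K & K = (16 ^+ 2 * Cosc) ^+ 2.
  by exists ((16 ^+ 2 * Cosc) ^+ 2) => //; rewrite exprn_gt0// mulr_gt0// exprn_gt0.
have i6 : 0 < 6^-1 :> R by rewrite invr_gt0.
(* The thresholds serve 5 K <= c, the size of [D] (4 comes from c^2 <= 4 p^2), the size of [a] (48 =
   3 * 8 * 2 from gam <= 3 and c <= 2 p), and ab <= 1/4. *)
have [N1 H1] := powR_large (5 * K) i6.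
have [N2 H2] := powR_large (4 * (160 * K * (B + 1))) e20.
have [N3 H3] := powR_large (48 * K ^+ 2) e20.
have [N4 H4] := powR_large 4 e20.
exists (maxn (maxn 1 N0) (maxn (maxn N1 N2) (maxn N3 N4))) => n.
rewrite !geq_max => /andP[/andP[n1 nN0] /andP[/andP[nN1 nN2] /andP[nN3 nN4]]] a b k k0 a0 b0 ba ab.
have x1 : 1 <= n%:R :> R by rewrite ler1n.
have x0 : 0 < n%:R :> R by rewrite ltr0n.
have xn0 : n%:R != 0 :> R by rewrite gt_eqF.
have := H1 n nN1; have := H2 n nN2; have := H3 n nN3; have := H4 n nN4.
set q := n%:R `^ (eta / 2); set p := n%:R `^ 6^-1 => h4 h3 h2 h1.
have p0 : 0 < p by rewrite powR_gt0.
have q0 : 0 < q by rewrite powR_gt0.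
have powp m : n%:R `^ (m%:R / 6) = p ^+ m.
  by rewrite mulrC powRrM powR_mulrn// ltW.
have p6 : p ^+ 6 = n%:R by rewrite -powp divff// powRr1// ltW.
have p1 : 1 <= p.
  by rewrite -(ler_pXn2r (n := 6)) ?nnegrE ?(ltW p0)// expr1n p6.
have abE : a * b <= (p ^+ 4 * q ^+ 2)^-1.
  apply: (le_trans ab); rewrite -opprD powRN powRD ?xn0 ?implybT//.
  have -> : 2 / 3 = 4%:R / 6 :> R by field.
  rewrite powp; have -> : eta = eta / 2 * 2 by field.
  by rewrite powRrM -/q (@powR_mulrn _ q 2)// ltW.
have ab4 : a * b <= 4^-1.
  apply: (le_trans abE); rewrite lef_pV2 ?posrE ?mulr_gt0 ?exprn_gt0//.
  have q1 : 1 <= q by lra.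
  have h : 1 <= p ^+ 4 by apply: exprn_ege1.
  have : q <= q ^+ 2 by rewrite expr2 ler_peMr// ltW.
  have : 1 * q ^+ 2 <= p ^+ 4 * q ^+ 2 by rewrite ler_wpM2r// sqr_ge0.
  by lra.
(* With p = n^(1/6) and q = n^(eta/2), the threshold is n^(- 1/2 - eta/2). Above it, ab <= 1 / (p^4
   q^2) forces a <= 1 / (p q), the smallness relative to 1/c that the inner window requires. *)
have [bs|bl] := leP b (p ^+ 3 * q)^-1.
  apply: (H0 n nN0) => //; first by lra.
  rewrite -opprD powRN powRD ?xn0 ?implybT//.
  by have -> : 1 / 2 = 3%:R / 6 :> R; [field|rewrite powp].
(* From b <= a: b^2 <= ab. This is where the exponent 2/3 turns into b << n^(-1/3), that is [D]
   large against c^2. *)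
have bE : b <= (p ^+ 2 * q)^-1.
  rewrite -ler_sqr ?nnegrE ?(ltW b0) ?invr_ge0 ?mulr_ge0 ?exprn_ge0 ?(ltW p0) ?(ltW q0)//.
  have -> : (p ^+ 2 * q)^-1 ^+ 2 = (p ^+ 4 * q ^+ 2)^-1 by field; rewrite !gt_eqF.
  by apply: le_trans abE; rewrite expr2 ler_pM2r.
have aE : a <= (p * q)^-1.
  rewrite -(ler_pM2r b0); apply: (le_trans abE).
  have -> : (p ^+ 4 * q ^+ 2)^-1 = (p * q)^-1 * (p ^+ 3 * q)^-1 by field; rewrite !gt_eqF.
  by rewrite ler_pM2l ?invr_gt0 ?mulr_gt0// ltW.
have T0 := @turning_gt0 R n; have T2 := @turning2 R n.
pose c := turning n `^ (3^-1 : R).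
have c0 : 0 < c by rewrite powR_gt0.
have Tc : turning n = c ^+ 3.
  by rewrite /c -powR_mulrn ?powR_ge0// -powRrM mulVf ?powRr1 ?(ltW T0).
have c6 : c ^+ 6 = 2 * n%:R + 1 by rewrite (exprM c 3 2) -Tc.
have pc : p <= c by rewrite -(ler_pXn2r (n := 6)) ?nnegrE ?(ltW p0) ?(ltW c0)// p6 c6; lra.
have cp : c <= 2 * p.
  rewrite -(ler_pXn2r (n := 6)) ?nnegrE ?mulr_ge0 ?(ltW p0) ?(ltW c0)// exprMn p6 c6.
  have : 64 * (n%:R : R) = 2 ^+ 6 * n%:R by ring.
  lra.
have /andP[g1 g3] := gam_bounds.
apply: (inner_frame k0 a0 b0 _ B0 B2 KE _ Tc).
- by lra.
- exact: le_trans pc.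
- exact: le_trans pc.
- rewrite ler_pdivlMr//; apply: le_trans g1.
  apply: (@le_trans _ _ (160 * K * (B + 1) * (2 * p) ^+ 2 * (p ^+ 2 * q)^-1)).
    have KB : 0 <= 160 * K * (B + 1) by apply: mulr_ge0; [apply: mulr_ge0; [rewrite ler0n|exact: ltW]|lra].
    apply: ler_pM => //; [by rewrite mulr_ge0// sqr_ge0|exact: ltW|].
    by rewrite ler_wpM2l// ler_sqr ?nnegrE ?mulr_ge0 ?(ltW p0) ?(ltW c0).
  have -> : 160 * K * (B + 1) * (2 * p) ^+ 2 * (p ^+ 2 * q)^-1 = 4 * (160 * K * (B + 1)) / q.
    by field; rewrite !gt_eqF.
  by rewrite ler_pdivrMr// mul1r.
- apply: (@le_trans _ _ (3 * (p * q)^-1)).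
    by apply: ler_pM; rewrite ?(ltW a0)//; lra.
  have K2 : 0 < K ^+ 2 by rewrite exprn_gt0.
  apply: (@le_trans _ _ (8 * K ^+ 2 * (2 * p))^-1); last first.
    by rewrite lef_pV2 ?posrE ?mulr_gt0// ler_pM2l// mulr_gt0.
  rewrite ler_pdivrMr ?mulr_gt0// ler_pdivlMl ?mulr_gt0//.
  have -> : 8 * K ^+ 2 * (2 * p) * 3 = (48 * K ^+ 2) * p by ring.
  by rewrite [p * q]mulrC ler_pM2r.
Qed.

End Asymptotics.

Theorem theorem1p1 (R : realType) (eta delta rho : R)
  (eta_gt0 : 0 < eta) (delta_gt0 : 0 < delta)
  (rho_gt0 : 0 < rho) (rho_lt : rho < 1 / 2) :
  exists2 N : nat, (0 < N)%N &
    forall n : nat, (N <= n)%N ->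
      [set ab : R * R | [/\ 0 < ab.1, 0 < ab.2 &
         ab.1 * ab.2 <= n%:R `^ (- (2 / 3) - eta)]]
      `|` [set ab : R * R | [/\ 0 < ab.1, 0 < ab.2,
             ab.1 * ab.2 <= 1 / 2 - rho &
             Num.min ab.1 ab.2 <= n%:R `^ (- (1 / 2) - delta)]]
      `<=` frame_set (hermite n).
Proof.
have [N1 H1] := region1_frame eta_gt0.
have [N2 H2] := region2_frame delta_gt0 rho_gt0 rho_lt.
exists (maxn 1 (maxn N1 N2)) => [|n]; first by rewrite leq_max.
rewrite !geq_max => /andP[_ /andP[n1 n2]] [a b] /= [|] /= [a0 b0].
  move=> ab; split=> //=; apply: hermite_gabor_frame => // k k0.
  have [ba|/ltW ba] := leP b a; first exact: (H1 n n1).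
  by apply: swap_hg => //; apply: (H1 n n1) => //; rewrite mulrC.
move=> ab mn; split=> //=; apply: hermite_gabor_frame => // k k0.
have [ba|/ltW ba] := leP b a.
  by move: mn; rewrite min_r// => mn; exact: (H2 n n2).
move: mn; rewrite min_l// => mn.
by apply: swap_hg => //; apply: (H2 n n2) => //; rewrite mulrC.
Qed.
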